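(* Let $T$ be a free ergodic measure-preserving action of a countable abelian group $G$ on a Lebesgue space $(X,\mu)$. The following conditions are equivalent: (i) the action $T$ is rigid; (ii) there exist non-trivial central sequences in $S_T$, i.e. non-trivial central sequences of $R_T$ consisting of elements of $S_T$; (iii) the subgroup $\mathrm{Int}(S_T)$ of $\mathrm{Aut}(R_T)$ is not closed.
   Context: A Lebesgue space is a nonatomic standard probability space. Free: for each $g\neq 0$, $T_gx\ne x$ for almost all $x$. The action $T$ is called rigid if there exists a sequence $\{g_n\}_n$ in $G$ with $g_n\to\infty$ (leaving every finite subset) and $u_{g_n}\to1$ strongly on $L^2(X,\mu)$, where $u_gf=f\circ T_{-g}$. Put $\alpha_g(f)=f\circ T_{-g}$ on $L^\infty(X,\mu)$; $R_T=L^\infty(X,\mu)\rtimes_\alpha G$ is the von Neumann crossed product (a hyperfinite II$_1$-factor with trace $\tau$, $\|x\|_2=\tau(x^*x)^{1/2}$), with canonical unitaries $v_g$, $v_gfv_g^*=\alpha_g(f)$; $S_T\subset R_T$ is the von Neumann subalgebra generated by $\{v_g:g\in G\}$. A central sequence of $R_T$ is a norm-bounded sequence $\{x_n\}$ in $R_T$ with $\|x_ny-yx_n\|_2\to0$ for all $y\in R_T$; it is trivial if $\|x_n-\tau(x_n)1\|_2\to0$. $\mathrm{Int}(S_T)$ is the group of inner automorphisms $\mathrm{Ad}\,w$ of $R_T$ with $w$ a unitary in $S_T$. $\mathrm{Aut}(R_T)$ carries the topology of pointwise strong convergence. *)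

(* Defs.v *)
From HB Require Import structures.
From mathcomp Require Import all_boot all_order all_algebra.
From mathcomp Require Import generic_quotient ring_quotient complex.
From mathcomp Require Import all_classical all_reals all_analysis.

Set Implicit Arguments.
Unset Strict Implicit.
Unset Printing Implicit Defensive.

Import Order.TTheory GRing.Theory Num.Theory.
Import numFieldNormedType.Exports.

Local Open Scope classical_set_scope.
Local Open Scope ring_scope.
Local Open Scope quotient_scope.

Section ComplexL2.
Context d (T : measurableType d) (R : realType).
Variable nu : {measure set T -> \bar R}.

Definition cLfun (p : \bar R) (f : T -> R[i]) : Prop :=
  (fun x => complex.Re (f x)) \in Lfun nu p /\
  (fun x => complex.Im (f x)) \in Lfun nu p.

Definition cint (f : T -> R[i]) : R[i] :=
  Complex (\int[nu]_x complex.Re (f x)) (\int[nu]_x complex.Im (f x)).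

Definition sqint : {pred T -> (R[i])^o} := fun f => `[< cLfun 2%:E f >].

Fact sqint_submod_closed : submod_closed sqint.
Proof.
have h2 : (1 <= 2%:E :> \bar R)%E by rewrite lee_fin ler1n.
have [L0 LD] := @Lfun_submod_closed _ T R nu _ h2.
split=> [|a f g /asboolP[fr fi] /asboolP[gr gi]]; apply/asboolP.
  by split; exact: L0.
pose Ref : T -> R := fun x => complex.Re (f x).
pose Imf : T -> R := fun x => complex.Im (f x).
split.
- have -> : (fun x => complex.Re ((a *: f + g) x)) =
      complex.Re a *: Ref +
        ((- complex.Im a) *: Imf + (fun x => complex.Re (g x))).
    apply/funext => x; rewrite /GRing.add /= /GRing.scale /= /Ref /Imf.
    case: a (f x) (g x) => [a b] [c e] [u v] /=.
    by rewrite -[RHS]/(a * c + (- b * e + u)) mulNr addrA.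
  exact: (LD _ _ _ fr (LD _ _ _ fi gr)).
- have -> : (fun x => complex.Im ((a *: f + g) x)) =
      complex.Re a *: Imf + (complex.Im a *: Ref + (fun x => complex.Im (g x))).
    apply/funext => x; rewrite /GRing.add /= /GRing.scale /= /Ref /Imf.
    case: a (f x) (g x) => [a b] [c e] [u v] /=.
    by rewrite -[RHS]/(a * e + (b * c + v)) addrA.
  exact: (LD _ _ _ fi (LD _ _ _ fr gi)).
Qed.

HB.instance Definition _ :=
  GRing.isSubmodClosed.Build _ _ sqint sqint_submod_closed.

Record sqintType := SqInt { sqint_fun : T -> (R[i])^o; _ : sqint_fun \in sqint }.

HB.instance Definition _ := [isSub for sqint_fun].
HB.instance Definition _ := [Choice of sqintType by <:].
HB.instance Definition _ := [SubChoice_isSubLmodule of sqintType by <:].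

Definition ae_null : {pred sqintType} :=
  fun f => `[< {ae nu, forall x, sqint_fun f x = 0} >].

Fact ae_null_zmod_closed : zmod_closed ae_null.
Proof.
split=> [|f g /asboolP f0 /asboolP g0]; apply/asboolP; first exact: aeW.
apply: filterS2 f0 g0 => x /= f0 g0.
rewrite -[LHS]/(sqint_fun f x - sqint_fun g x) f0 g0.
exact: subr0.
Qed.

HB.instance Definition _ :=
  GRing.isZmodClosed.Build _ ae_null ae_null_zmod_closed.

Definition L2 : Type := Quotient.quot ae_null.
HB.instance Definition _ := GRing.Zmodule.on L2.
HB.instance Definition _ := EqQuotient.on L2.

Definition L2_scale (a : R[i]) (u : L2) : L2 := \pi_L2 (a *: repr u).

Fact pi_L2_scale a (f : sqintType) : L2_scale a (\pi_L2 f) = \pi_L2 (a *: f).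
Proof.
apply/eqP; rewrite /L2_scale -Quotient.idealrBE -scalerBr; apply/asboolP.
have : repr (\pi_L2 f) - f \in ae_null by rewrite Quotient.idealrBE reprK.
move=> /asboolP; apply: filterS => x /= f0.
rewrite -[LHS]/(a *: (sqint_fun (repr (\pi_L2 f)) - sqint_fun f) x) f0.
exact: scaler0.
Qed.

Fact L2_scalerA a b (u : L2) : L2_scale a (L2_scale b u) = L2_scale (a * b) u.
Proof. by rewrite pi_L2_scale scalerA. Qed.

Fact L2_scale1r : left_id 1 L2_scale.
Proof. by move=> u; rewrite /L2_scale scale1r reprK. Qed.

Fact L2_scalerDr : right_distributive L2_scale +%R.
Proof.
move=> a u v; rewrite -[u]reprK -[v]reprK -[\pi_L2 (repr u) + _]pi_addr.
by rewrite !pi_L2_scale scalerDr pi_addr.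
Qed.

Fact L2_scalerDl (u : L2) : {morph L2_scale^~ u : a b / a + b}.
Proof. by move=> a b; rewrite /L2_scale scalerDl pi_addr. Qed.

HB.instance Definition _ := GRing.Zmodule_isLmodule.Build R[i] L2
  L2_scalerA L2_scale1r L2_scalerDr L2_scalerDl.

Definition L2_repr (u : L2) : T -> R[i] := sqint_fun (repr u).

(* The class of [f] when [f] is square integrable, and 0 otherwise. *)
Definition to_L2 (f : T -> R[i]) : L2 := \pi_L2 (insubd (0 : sqintType) f).

Definition dot (u v : L2) : R[i] :=
  cint (fun x => L2_repr u x * conjc (L2_repr v x)).

Definition L2norm (u : L2) : R := Num.sqrt (complex.Re (dot u u)).

End ComplexL2.

Coercion L2_repr : L2 >-> Funclass.

Section Operators.
Context d (T : measurableType d) (R : realType).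
Variable nu : {measure set T -> \bar R}.
Local Notation H := (L2 nu).
Implicit Types (a b : H -> H) (S M : set (H -> H)).

Definition op_bound a (r : R) : Prop := forall u, L2norm (a u) <= r * L2norm u.

Definition bounded_op : set (H -> H) :=
  [set a | linear a /\ exists r, op_bound a r].

(* Riesz representation makes the set below a singleton when [a] is bounded. *)
Definition adj a : H -> H :=
  xget 0 [set b | bounded_op b /\ forall u v, dot (a u) v = dot u (b v)].

Definition commutant S : set (H -> H) :=
  [set a | bounded_op a /\ forall b, S b -> a \o b = b \o a].

Definition von_neumann M : Prop :=
  [/\ M `<=` bounded_op, (forall a, M a -> M (adj a))
    & commutant (commutant M) = M].

Definition vN_generated S : set (H -> H) := smallest von_neumann S.

Definition unitary_op a : Prop :=
  [/\ bounded_op a, adj a \o a = id & a \o adj a = id].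

(* The *-automorphisms of [M]; the values of [theta] outside [M] are
   irrelevant. *)
Definition vN_aut M (theta : (H -> H) -> (H -> H)) : Prop :=
  [/\ set_bij M M theta,
      forall (z : R[i]) a b, M a -> M b ->
        theta (z *: a + b) = z *: theta a + theta b,
      forall a b, M a -> M b -> theta (a \o b) = theta a \o theta b
    & forall a, M a -> theta (adj a) = adj (theta a)].

(* [I] is a closed subset of [Aut M] for the topology in which
   [sigma --> theta] iff [sigma a --> theta a] strongly for every [a] in [M]. *)
Definition closed_in_aut M (I : set ((H -> H) -> (H -> H))) : Prop :=
  forall theta, vN_aut M theta ->
  forall F : set_system ((H -> H) -> (H -> H)), ProperFilter F -> F I ->
  (forall a, M a -> forall u : H,
     L2norm (sigma a u - theta a u) @[sigma --> F] --> (0 : R)) ->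
  I theta.

Definition inner_aut M N : set ((H -> H) -> (H -> H)) :=
  [set theta | vN_aut M theta /\
    exists w, [/\ N w, unitary_op w &
      forall a, M a -> theta a = w \o a \o adj w]].

End Operators.

Section Dynamics.
Context d (X : measurableType d) (R : realType).
Variable mu : probability X R.

(* Isomorphism mod 0 with a Polish space [Y] carrying a Borel probability
   measure; the [B1], [B2] allow the sigma-algebra of [X] to be either the
   Borel one or its completion. *)
Definition standard_probability : Prop :=
  exists (Y : completePseudoMetricType R) (X0 : set X) (f : X -> Y),
    let borel := <<s [set U : set Y | open U] >> in
    [/\ hausdorff_space Y /\ @second_countable Y,
        measurable X0 /\ mu X0 = 1%E,
        set_bij X0 [set: Y] f,
        forall B, borel B -> measurable (X0 `&` f @^-1` B)
      & forall A, measurable A -> A `<=` X0 ->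
          exists B1 B2, [/\ borel B1, borel B2,
            B1 `<=` f @` A, f @` A `<=` B2
            & mu (X0 `&` f @^-1` (B2 `\` B1)) = 0%E]].

Definition nonatomic : Prop :=
  forall A, measurable A -> (0 < mu A)%E ->
  exists B, [/\ measurable B, B `<=` A, (0 < mu B)%E & (mu B < mu A)%E].

Definition lebesgue_space : Prop := standard_probability /\ nonatomic.

Variable G : countZmodType.
Variable T : G -> X -> X.

Definition mp_action : Prop :=
  [/\ forall x, T 0 x = x,
      forall g h x, T (g + h) x = T g (T h x),
      forall g, measurable_fun setT (T g)
    & forall g A, measurable A -> mu (T g @^-1` A) = mu A].

Definition free_action : Prop :=
  forall g, g != 0 -> {ae mu, forall x, T g x <> x}.

Definition ergodic_action : Prop :=
  forall A, measurable A -> (forall g, T g @^-1` A = A) ->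
  mu A = 0%E \/ mu A = 1%E.

Definition koopman (g : G) (f : L2 mu) : L2 mu :=
  to_L2 mu (fun x => f (T (- g) x)).

Definition rigid_action : Prop :=
  exists g : nat -> G,
    (forall A : set G, finite_set A -> \forall n \near \oo, ~ A (g n)) /\
    (forall f : L2 mu, L2norm (koopman (g n) f - f) @[n --> \oo] --> (0 : R)).

End Dynamics.

(* [G] with the sigma-algebra of all its subsets *)
Definition discr (G : Type) : Type := G.

Section Discrete.
Variable G : countZmodType.

HB.instance Definition _ := GRing.Zmodule.on (discr G).
HB.instance Definition _ := isPointed.Build (discr G) (0 : G).
HB.instance Definition _ := @isMeasurable.Build default_measure_display
  (discr G) (@discrete_measurable G) (@discrete_measurable0 G)
  (@discrete_measurableC G) (@discrete_measurableU G).

End Discrete.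

(* The crossed product in its standard representation on
   L^2(G * X) = l^2(G, L^2(X)) *)

Section CrossedProduct.
Context d (X : measurableType d) (R : realType) (mu : probability X R).
Variables (G : countZmodType) (T : G -> X -> X).

Definition counting_prod : {measure set (discr G * X) -> \bar R} :=
  (@counting (discr G) R \x mu)%E.

Local Notation H := (L2 counting_prod).
Implicit Types (x y : H -> H).

(* (f xi)(h) = alpha_{-h}(f) xi(h) = (f \o T_h) xi(h) *)
Definition cp_fun (f : X -> R[i]) : H -> H :=
  fun xi => to_L2 counting_prod (fun p => f (T p.1 p.2) * xi p).

Definition cp_unit (g : G) : H -> H :=
  fun xi => to_L2 counting_prod (fun p => xi (p.1 - g, p.2)).

Definition R_T : set (H -> H) :=
  vN_generated ([set cp_fun f | f in cLfun mu +oo%E] `|` range cp_unit).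

Definition S_T : set (H -> H) := vN_generated (range cp_unit).

(* The cyclic trace vector 1 (x) delta_0 *)
Definition trace_vec : H := to_L2 counting_prod (fun p => (p.1 == 0)%:R).

Definition tau x : R[i] := dot (x trace_vec) trace_vec.

Definition norm2 x : R := Num.sqrt (complex.Re (tau (adj x \o x))).

Definition central_sequence (x : nat -> H -> H) : Prop :=
  [/\ forall n, R_T (x n),
      exists r : R, forall n, op_bound (x n) r
    & forall y, R_T y -> norm2 ((x n \o y) - (y \o x n)) @[n --> \oo] --> (0 : R)].

Definition trivial_sequence (x : nat -> H -> H) : Prop :=
  norm2 (x n - tau (x n) *: idfun) @[n --> \oo] --> (0 : R).

End CrossedProduct.

Arguments R_T {d X R} mu {G} T.
Arguments S_T {d X R} mu G.
Arguments central_sequence {d X R} mu {G} T x.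
Arguments trivial_sequence {d X R} mu {G} x.

(* Main.v *)
Require Import Defs.
From HB Require Import structures.
From mathcomp Require Import all_boot all_order all_algebra.
From mathcomp Require Import generic_quotient ring_quotient complex.
From mathcomp Require Import all_classical all_reals all_analysis.
From mathcomp Require finmap.
From mathcomp Require Import ring lra measurable_realfun ess_sup_inf.

(* Let Omega be the trace vector of the standard representation of R_T on
   l^2(G, L^2(X)).  Then x Omega is constant in the X-coordinate for x in S_T,
   so x = sum_h c_h v_h in the 2-norm, and for measurable A
     |x 1_A - 1_A x|_2^2 = sum_h |c_h|^2 mu(A Delta T_h A).
   If T is not rigid then 0 is isolated in G for the topology given by the
   mu(A Delta T_h A), by freeness, and finitely many sets B_i satisfy
   sum_i mu(B_i Delta T_h B_i) >= e for all h <> 0.  Hence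
     e |x - tau(x)|_2^2 <= sum_i |[x, 1_(B_i)]|_2^2   (x in S_T),
   which makes central sequences in S_T trivial, and makes the unitaries w of S_T
   Cauchy, up to phases, whenever the Ad w converge: Int(S_T) is closed.
   If T is rigid along g_n then v_(g_n) is a nontrivial central sequence.
   Moreover G is then a nondiscrete countable metrizable group, hence has a Cauchy
   sequence s_k without limit in G.  The Ad v_(s_k) converge to an automorphism
   of R_T; were it Ad w with w in S_T, a nonzero coefficient c_h of w would
   force s_k -> h. *)

Set Implicit Arguments.
Unset Strict Implicit.
Unset Printing Implicit Defensive.

Import Order.TTheory GRing.Theory Num.Theory.
Import numFieldNormedType.Exports.

Local Open Scope classical_set_scope.
Local Open Scope ring_scope.
Local Open Scope quotient_scope.

Local Notation CRe := complex.Re.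
Local Notation CIm := complex.Im.

(** * Complex L2 spaces *)

Section SquareIntegrable.
Context d (T : measurableType d) (R : realType).
Variable nu : {measure set T -> \bar R}.
Implicit Types (f g : T -> R[i]).

(** The v_(s_k) themselves have no strong limit, since their values at Omega are orthogonal for
    distinct group elements. What converges is 1 (x) u_(s_k): it differs from v_(s_k) by a unitary
    of the commutant, so it induces the same automorphism of [R_T]. Rigidity and the Cauchy property
    are tested on countably many sets only: asymptotically invariant sets form a sigma-algebra, so a
    sequence generating the measurable sets mod 0 decides for all of them. In the closedness
    argument Ad w sees w only up to a phase, so each w is first rotated to have a positive inner
    product with one reference unitary. A strong limit of unitaries may fail to be surjective;
    convergence of the adjoints is obtained from |x^* Omega| = |x Omega|, which the modular
    conjugation provides. Limits in the automorphism group are taken along arbitrary filters, hence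
    the versions of completeness for filters. *)

Definition nsq (z : R[i]) : R := CRe z ^+ 2 + CIm z ^+ 2.

Definition cmeas f := measurable_fun setT (fun x => CRe (f x)) /\
  measurable_fun setT (fun x => CIm (f x)).

Definition sqnorm f : \bar R := (\int[nu]_x (nsq (f x))%:E)%E.

Lemma nsq_ge0 z : 0 <= nsq z. Proof. by rewrite addr_ge0 ?sqr_ge0. Qed.

Lemma nsq_eq0 z : nsq z = 0 -> z = 0.
Proof.
case: z => a b /eqP; rewrite /nsq paddr_eq0 ?sqr_ge0 // !sqrf_eq0 /=.
by case/andP=> /eqP-> /eqP->.
Qed.

Lemma nsqM z w : nsq (z * w) = nsq z * nsq w.
Proof. case: z w => [a b] [c e]; rewrite /nsq /=; ring. Qed.

Lemma nsq_real (t : R) : nsq t%:C%C = t ^+ 2.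
Proof. by rewrite /nsq /= expr0n addr0. Qed.

Lemma nsqC z : nsq (conjc z) = nsq z.
Proof. case: z => [a b]; rewrite /nsq /=; ring. Qed.

Lemma nsqD z w : nsq (z + w) <= 2 * nsq z + 2 * nsq w.
Proof.
case: z w => [a b] [c e]; rewrite /nsq /=.
by have := sqr_ge0 (a - c); have := sqr_ge0 (b - e); nra.
Qed.

Lemma cmeas_nsq f : cmeas f -> measurable_fun setT (fun x => nsq (f x)).
Proof.
by move=> [mr mi]; apply: measurable_funD; exact: measurable_funX.
Qed.

Lemma Lfun2P (h : T -> R) : h \in Lfun nu 2%:E <->
  measurable_fun setT h /\ (\int[nu]_x (h x ^+ 2)%:E < +oo)%E.
Proof.
split=> [h2|[mh h2]].
  split; last exact: integrable_lty (Lfun2_integrable_sqr h2).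
  by move: h2; rewrite inE => /andP[]; rewrite inE.
apply/andP; split; first by rewrite inE.
rewrite !inE /= /finite_norm unlock /=; apply: poweR_lty; apply: le_lt_trans h2.
under eq_integral => x _ do rewrite /= powR_mulrn // real_normK ?num_real//.
by [].
Qed.

Lemma sqintP f : f \in sqint nu <-> cmeas f /\ (sqnorm f < +oo)%E.
Proof.
have E g : cmeas g -> sqnorm g =
    (\int[nu]_x (CRe (g x) ^+ 2)%:E + \int[nu]_x (CIm (g x) ^+ 2)%:E)%E.
  move=> [mr mi]; rewrite -ge0_integralD //=.
  - by move=> x _; rewrite lee_fin sqr_ge0.
  - by apply/measurable_EFinP; exact: measurable_funX.
  - by move=> x _; rewrite lee_fin sqr_ge0.
  - by apply/measurable_EFinP; exact: measurable_funX.
split=> [/asboolP[/Lfun2P[mr fr] /Lfun2P[mi fi]]|[mf]].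
  by split=> //; rewrite E // lte_add_pinfty.
rewrite E // => fy; apply/asboolP; case: mf => mr mi; split; apply/Lfun2P; split=> //.
  apply: le_lt_trans fy; rewrite leeDl //.
  by apply: integral_ge0 => x _; rewrite lee_fin sqr_ge0.
apply: le_lt_trans fy; rewrite leeDr //.
by apply: integral_ge0 => x _; rewrite lee_fin sqr_ge0.
Qed.

Lemma sqnorm_ge0 f : (0 <= sqnorm f)%E.
Proof. by apply: integral_ge0 => x _; rewrite lee_fin nsq_ge0. Qed.

(** Domination almost everywhere provides at once the membership that [to_L2] demands and the norm
    bound for multiplication operators. *)
Lemma sqint_dom f g r : cmeas f -> g \in sqint nu -> 0 <= r ->
  {ae nu, forall x, nsq (f x) <= r * nsq (g x)} ->
  f \in sqint nu /\ (sqnorm f <= r%:E * sqnorm g)%E.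
Proof.
move=> mf /sqintP[mg gy] r0 fg.
have h : (sqnorm f <= r%:E * sqnorm g)%E.
  rewrite /sqnorm -ge0_integralZl ?lee_fin //; last 2 first.
  - by apply/measurable_EFinP; exact: cmeas_nsq.
  - by move=> x _; rewrite lee_fin nsq_ge0.
  apply: ae_ge0_le_integral => //.
  - by move=> x _; rewrite lee_fin nsq_ge0.
  - by apply/measurable_EFinP; exact: cmeas_nsq.
  - by move=> x _; rewrite -EFinM lee_fin mulr_ge0 ?nsq_ge0.
  - apply/measurable_EFinP; apply: measurable_funM => //; exact: cmeas_nsq.
  - by apply: filterS fg => x fg _; rewrite -EFinM lee_fin.
split=> //; apply/sqintP; split=> //.
by apply: (le_lt_trans h); rewrite lte_mul_pinfty ?lee_fin.
Qed.

Lemma sqnorm_ae f g : cmeas f -> cmeas g -> {ae nu, forall x, f x = g x} ->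
  sqnorm f = sqnorm g.
Proof.
move=> mf mg fg; apply: ge0_ae_eq_integral => //.
- by apply/measurable_EFinP; exact: cmeas_nsq.
- by apply/measurable_EFinP; exact: cmeas_nsq.
- by move=> x _; rewrite lee_fin nsq_ge0.
- by move=> x _; rewrite lee_fin nsq_ge0.
- by apply: filterS fg => x -> _.
Qed.

Lemma sqnorm_eq0 f : cmeas f -> sqnorm f = 0%E -> {ae nu, forall x, f x = 0}.
Proof.
move=> mf f0.
have : ae_eq nu setT (fun x => (nsq (f x))%:E) (cst 0%E).
  apply/ae_eq_integral_abs => //; first by apply/measurable_EFinP; exact: cmeas_nsq.
  rewrite -[RHS]f0; apply: eq_integral => x _.
  by rewrite gee0_abs // lee_fin nsq_ge0.
by apply: filterS => x /(_ I)[] /nsq_eq0.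
Qed.

Lemma cmeasD f g : cmeas f -> cmeas g -> cmeas (fun x => f x + g x).
Proof.
move=> [fr fi] [gr gi]; split.
  by rewrite (_ : (fun x => _) = (fun x => CRe (f x)) \+ (fun x => CRe (g x)));
    [exact: measurable_funD|apply/funext => x /=; case: (f x) (g x) => ? ? [? ?]].
by rewrite (_ : (fun x => _) = (fun x => CIm (f x)) \+ (fun x => CIm (g x)));
    [exact: measurable_funD|apply/funext => x /=; case: (f x) (g x) => ? ? [? ?]].
Qed.

Lemma cmeasM f g : cmeas f -> cmeas g -> cmeas (fun x => f x * g x).
Proof.
move=> [fr fi] [gr gi]; split.
  rewrite (_ : (fun x => _) = (fun x => CRe (f x)) \* (fun x => CRe (g x)) \-
    (fun x => CIm (f x)) \* (fun x => CIm (g x))).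
    by apply: measurable_funB; apply: measurable_funM.
  by apply/funext => x /=; case: (f x) (g x) => ? ? [? ?].
rewrite (_ : (fun x => _) = (fun x => CRe (f x)) \* (fun x => CIm (g x)) \+
    (fun x => CIm (f x)) \* (fun x => CRe (g x))).
  by apply: measurable_funD; apply: measurable_funM.
by apply/funext => x /=; case: (f x) (g x) => ? ? [? ?].
Qed.

Lemma cmeas_conj f : cmeas f -> cmeas (fun x => conjc (f x)).
Proof.
move=> [fr fi]; split.
  by rewrite (_ : (fun x => _) = (fun x => CRe (f x)));
    [|apply/funext => x /=; case: (f x)].
by rewrite (_ : (fun x => _) = \- (fun x => CIm (f x)));
    [exact: measurable_funN|apply/funext => x /=; case: (f x)].
Qed.

Lemma cmeas_cst (z : R[i]) : cmeas (fun=> z).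
Proof. by split; exact: measurable_cst. Qed.

End SquareIntegrable.

(** * Square-integrable functions modulo null sets *)

Section L2ae.
Context d (T : measurableType d) (R : realType).
Variable nu : {measure set T -> \bar R}.
Local Notation H := (L2 nu).
Implicit Types (u v w : H) (f g : T -> R[i]).

Lemma L2_sqint u : (u : T -> R[i]) \in sqint nu.
Proof. by rewrite /L2_repr; case: (repr u). Qed.

Lemma L2_cmeas u : cmeas u.
Proof. by have /sqintP[] := L2_sqint u. Qed.

Lemma L2_eqP u v : u = v <-> {ae nu, forall x, u x = v x}.
Proof.
split=> [->|uv]; first exact: aeW.
rewrite -[u]reprK -[v]reprK; apply/eqP; rewrite -Quotient.idealrBE.
apply/asboolP; apply: filterS uv => x uv.
rewrite -[LHS]/(u x - v x) uv; exact: subrr.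
Qed.

Lemma to_L2_ae f : f \in sqint nu -> {ae nu, forall x, to_L2 nu f x = f x}.
Proof.
move=> fs; pose F := SqInt fs.
have E : to_L2 nu f = \pi_(L2 nu) F.
  rewrite /to_L2; congr (\pi _); apply: val_inj; rewrite insubdK //.
have : repr (to_L2 nu f) - F \in @ae_null _ _ _ nu.
  by rewrite Quotient.idealrBE reprK E.
move=> /asboolP; apply: filterS => x /= f0; apply/eqP; rewrite -subr_eq0; apply/eqP.
exact: f0.
Qed.

Lemma L2D_ae u v : {ae nu, forall x, L2_repr (u + v) x = u x + v x}.
Proof.
have : repr (u + v) - (repr u + repr v) \in @ae_null _ _ _ nu.
  by rewrite Quotient.idealrBE reprK pi_addr !reprK.
move=> /asboolP; apply: filterS => x /= f0; apply/eqP; rewrite -subr_eq0; apply/eqP.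
exact: f0.
Qed.

Lemma L2Z_ae (a : R[i]) u : {ae nu, forall x, L2_repr (a *: u) x = a * u x}.
Proof.
have : repr (a *: u) - (a *: repr u) \in @ae_null _ _ _ nu.
  by rewrite Quotient.idealrBE reprK.
move=> /asboolP; apply: filterS => x /= f0; apply/eqP; rewrite -subr_eq0; apply/eqP.
exact: f0.
Qed.

Lemma L20_ae : {ae nu, forall x, L2_repr (0 : H) x = 0}.
Proof.
have := L2Z_ae 0 0; rewrite scale0r; apply: filterS => x ->; exact: mul0r.
Qed.

Lemma L2B_ae u v : {ae nu, forall x, L2_repr (u - v) x = u x - v x}.
Proof.
have := L2D_ae u (-1 *: v); rewrite scaleN1r => h.
have := L2Z_ae (-1) v; rewrite scaleN1r; apply: filterS2 h => x -> ->.
by rewrite mulN1r.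
Qed.

Lemma to_L2_eq f g : f \in sqint nu -> cmeas g -> {ae nu, forall x, f x = g x} ->
  to_L2 nu f = to_L2 nu g.
Proof.
move=> fs mg fg; have gs : g \in sqint nu.
  have [] := @sqint_dom _ _ _ _ g f 1 mg fs ler01 _ => //.
  by apply: filterS fg => x ->; rewrite mul1r.
apply/L2_eqP; have := to_L2_ae gs; have := to_L2_ae fs.
by apply: filterS3 fg => x -> -> ->.
Qed.

Lemma to_L2K u : to_L2 nu u = u.
Proof. apply/L2_eqP; exact: to_L2_ae (L2_sqint u). Qed.

End L2ae.

(** * The complex integral and the inner product *)

Section CInt.
Context d (T : measurableType d) (R : realType).
Variable nu : {measure set T -> \bar R}.
Local Notation H := (L2 nu).
Implicit Types (u v w : H) (f g : T -> R[i]).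

Definition cintegrable f :=
  nu.-integrable setT (EFin \o (fun x => CRe (f x))) /\
  nu.-integrable setT (EFin \o (fun x => CIm (f x))).

Lemma cintD f g : cintegrable f -> cintegrable g ->
  cint nu (fun x => f x + g x) = cint nu f + cint nu g.
Proof.
move=> [fr fi] [gr gi]; rewrite /cint.
rewrite -[RHS]/(Complex (_ + _) (_ + _)) -!RintegralD //.
by congr Complex; apply: eq_Rintegral => x _; case: (f x) (g x) => ? ? [].
Qed.

Lemma cintZ a f : cintegrable f ->
  cint nu (fun x => a * f x) = a * cint nu f.
Proof.
case: a => a b [fr fi]; rewrite /cint.
have I c (h : T -> R) : nu.-integrable setT (EFin \o h) ->
    nu.-integrable setT (EFin \o (fun x => c * h x)).
  by move=> hi; have := integrableZl measurableT c hi; congr integrable.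
rewrite -[RHS]/(Complex (_ - _) (_ + _)) -!RintegralZl //.
rewrite -(RintegralB measurableT (I _ _ fr) (I _ _ fi)).
rewrite -(RintegralD measurableT (I _ _ fi) (I _ _ fr)).
by congr Complex; apply: eq_Rintegral => x _; case: (f x) => ? ? //=; rewrite addrC.
Qed.

Lemma cint_conj f : cintegrable f -> cint nu (fun x => conjc (f x)) = conjc (cint nu f).
Proof.
move=> [fr fi]; rewrite /cint /= -[- _]mulN1r -RintegralZl //.
by congr Complex; apply: eq_Rintegral => x _; case: (f x) => ? ? //=; rewrite mulN1r.
Qed.

Lemma cint_ae f g : cmeas f -> cmeas g -> {ae nu, forall x, f x = g x} ->
  cint nu f = cint nu g.
Proof.
move=> [fr fi] [gr gi] fg; rewrite /cint /Rintegral.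
congr (Complex (fine _) (fine _)); apply: ae_eq_integral => //; try exact/measurable_EFinP;
  by apply: filterS fg => x /= -> _.
Qed.

Lemma cint_comp (phi : T -> T) f : measurable_fun setT phi ->
  (forall A, measurable A -> nu (phi @^-1` A) = nu A) -> cintegrable f ->
  cint nu (fun x => f (phi x)) = cint nu f.
Proof.
move=> mphi nuphi [fr fi].
have E (h : T -> R) : nu.-integrable setT (EFin \o h) ->
    \int[nu]_x h (phi x) = \int[nu]_x h x.
  move=> hi; rewrite /Rintegral; congr fine.
  have mh : measurable_fun setT (EFin \o h) by case/integrableP: hi.
  have hphi : nu.-integrable setT ((EFin \o h) \o phi).
    apply/integrableP; split; first exact: measurableT_comp.
    case/integrableP: hi => _; apply: le_lt_trans.
    have <- := @ge0_integral_pushforward _ _ _ _ _ _ mphi nu setT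
      (fun x => `|(EFin \o h) x|)%E measurableT _ _ => //.
    - rewrite le_eqVlt; apply/orP; left; apply/eqP.
      by apply: eq_measure_integral => A mA _; first [exact: nuphi|exact/esym/nuphi].
    - exact: measurableT_comp.
  rewrite -[LHS]/(\int[nu]_(x in phi @^-1` setT) ((EFin \o h) \o phi) x)%E.
  rewrite -(@integral_pushforward _ _ _ _ _ _ mphi nu setT (EFin \o h)) //.
  by apply: eq_measure_integral => A mA _; first [exact: nuphi|exact/esym/nuphi].
by rewrite /cint (E (fun x => CRe (f x))) // (E (fun x => CIm (f x))).
Qed.

Lemma sqint_cintegrable f g : f \in sqint nu -> g \in sqint nu ->
  cintegrable (fun x => f x * conjc (g x)).
Proof.
move=> /asboolP[fr fi] /asboolP[gr gi].
have P h k : h \in Lfun nu 2%:E -> k \in Lfun nu 2%:E ->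
    nu.-integrable setT (EFin \o (fun x => h x * k x)).
  by move=> h2 k2; apply/Lfun1_integrable; exact: Lfun2_mul_Lfun1.
split.
  have := integrableD measurableT (P _ _ fr gr) (P _ _ fi gi).
  congr integrable; apply/funext => x /=; rewrite -EFinD.
  by case: (f x) (g x) => ? ? [? ?] /=; congr EFin; ring.
have := integrableB measurableT (P _ _ fi gr) (P _ _ fr gi).
congr integrable; apply/funext => x /=; rewrite -EFinB.
by case: (f x) (g x) => ? ? [? ?] /=; congr EFin; ring.
Qed.

Lemma sqint_cmeas f : f \in sqint nu -> cmeas f.
Proof. by move=> /sqintP[]. Qed.

Lemma dot_to_L2 f g : f \in sqint nu -> g \in sqint nu ->
  dot (to_L2 nu f) (to_L2 nu g) = cint nu (fun x => f x * conjc (g x)).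
Proof.
move=> fs gs; apply: cint_ae.
- by apply: cmeasM; last apply: cmeas_conj; exact: L2_cmeas.
- by apply: cmeasM; last apply: cmeas_conj; exact: sqint_cmeas.
have := to_L2_ae gs; have := to_L2_ae fs.
by apply: filterS2 => x -> ->.
Qed.

Lemma cmeas_dot u v : cmeas (fun x => u x * conjc (v x)).
Proof. by apply: cmeasM; last apply: cmeas_conj; exact: L2_cmeas. Qed.

Lemma dotDl u v w : dot (u + v) w = dot u w + dot v w.
Proof.
rewrite -cintD; [|exact: sqint_cintegrable (L2_sqint _) (L2_sqint _)..].
apply: cint_ae.
- exact: cmeas_dot.
- by apply: cmeasD; exact: cmeas_dot.
by have := L2D_ae u v; apply: filterS => x ->; rewrite mulrDl.
Qed.

Lemma dotZl a u w : dot (a *: u) w = a * dot u w.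
Proof.
rewrite -cintZ; [|exact: sqint_cintegrable (L2_sqint _) (L2_sqint _)].
apply: cint_ae.
- exact: cmeas_dot.
- by apply: (cmeasM (cmeas_cst _ _)); exact: cmeas_dot.
by have := L2Z_ae a u; apply: filterS => x ->; rewrite mulrA.
Qed.

Lemma dotC u v : dot v u = conjc (dot u v).
Proof.
rewrite -cint_conj; last exact: sqint_cintegrable (L2_sqint _) (L2_sqint _).
congr cint; apply/funext => x.
by rewrite rmorphM /= conjcK mulrC.
Qed.

Lemma L2norm_sqnorm u : (L2norm u ^+ 2)%:E = sqnorm nu u.
Proof.
have /sqintP[mu uy] := L2_sqint u.
have E : CRe (dot u u) = fine (sqnorm nu u).
  by rewrite /dot /cint /=; congr fine; apply: eq_integral => x _; case: (u x) => ? ? /=;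
    congr EFin; rewrite /nsq /=; ring.
rewrite /L2norm E sqr_sqrtr ?fine_ge0 ?sqnorm_ge0 // fineK // ge0_fin_numE ?sqnorm_ge0 //.
Qed.

Lemma L2norm_sq u : L2norm u ^+ 2 = CRe (dot u u).
Proof.
rewrite /L2norm sqr_sqrtr // /dot /cint /=; apply: Rintegral_ge0 => x _.
by case: (u x) => a b /=; nra.
Qed.

Lemma L2norm_ge0 u : 0 <= L2norm u. Proof. exact: sqrtr_ge0. Qed.

Lemma L2norm_eq0 u : L2norm u = 0 -> u = 0.
Proof.
move=> u0; apply/L2_eqP; have := L2norm_sqnorm u; rewrite u0 expr0n /= => /esym s0.
have := sqnorm_eq0 (L2_cmeas u) s0; have := L20_ae nu.
by apply: filterS2 => x -> ->.
Qed.

End CInt.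

(** * Hermitian geometry of L2 *)

Section InnerProduct.
Context d (T : measurableType d) (R : realType).
Variable nu : {measure set T -> \bar R}.
Local Notation H := (L2 nu).
Implicit Types (u v w : H) (a : R[i]) (t : R).

Definition rdot u v : R := CRe (dot u v).

Lemma dotDr u v w : dot u (v + w) = dot u v + dot u w.
Proof. by rewrite dotC dotDl (dotC v u) (dotC w u) rmorphD. Qed.

Lemma dotZr a u v : dot u (a *: v) = conjc a * dot u v.
Proof. by rewrite dotC dotZl (dotC v u) rmorphM. Qed.

Lemma dot0l v : dot (0 : H) v = 0.
Proof. by rewrite -(scale0r (0 : H)) dotZl mul0r. Qed.

Lemma dot0r v : dot v (0 : H) = 0.
Proof. by rewrite dotC dot0l rmorph0. Qed.

Lemma dotNl u v : dot (- u) v = - dot u v.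
Proof. by rewrite -scaleN1r dotZl mulN1r. Qed.

Lemma dotNr u v : dot u (- v) = - dot u v.
Proof. by rewrite dotC dotNl (dotC v u) rmorphN. Qed.

Lemma dotBl u v w : dot (u - v) w = dot u w - dot v w.
Proof. by rewrite dotDl dotNl. Qed.

Lemma dotBr u v w : dot u (v - w) = dot u v - dot u w.
Proof. by rewrite dotDr dotNr. Qed.

Lemma CReD (x y : R[i]) : CRe (x + y) = CRe x + CRe y.
Proof. by case: x y => ? ? []. Qed.

Lemma CReN (x : R[i]) : CRe (- x) = - CRe x.
Proof. by case: x. Qed.

Lemma rdotC u v : rdot u v = rdot v u.
Proof. by rewrite /rdot dotC; case: (dot u v). Qed.

Lemma rdotDl u v w : rdot (u + v) w = rdot u w + rdot v w.
Proof. by rewrite /rdot dotDl CReD. Qed.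

Lemma rdotDr u v w : rdot w (u + v) = rdot w u + rdot w v.
Proof. by rewrite !(rdotC w) rdotDl. Qed.

Lemma rdotZl t u v : rdot (t%:C%C *: u) v = t * rdot u v.
Proof. by rewrite /rdot dotZl; case: (dot u v) => x y /=; rewrite mul0r subr0. Qed.

Lemma rdotZr t u v : rdot u (t%:C%C *: v) = t * rdot u v.
Proof. by rewrite !(rdotC u) rdotZl. Qed.

Lemma rdotNl u v : rdot (- u) v = - rdot u v.
Proof. by rewrite /rdot dotNl CReN. Qed.

Lemma rdotNr u v : rdot u (- v) = - rdot u v.
Proof. by rewrite !(rdotC u) rdotNl. Qed.

(** The imaginary part of z is the real part of -i z. Identities proved for the real form [rdot], on
    which the Riesz argument runs, thus lift to [dot]. *)
Lemma dot_rdot u v : dot u v = Complex (rdot u v) (rdot (Complex 0 (-1) *: u) v).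
Proof. by rewrite /rdot dotZl; case: (dot u v) => x y /=; rewrite mul0r mulN1r sub0r opprK. Qed.

Lemma L2norm_rdot u : L2norm u ^+ 2 = rdot u u.
Proof. exact: L2norm_sq. Qed.

Lemma dotuu u : dot u u = (L2norm u ^+ 2)%:C%C.
Proof.
rewrite L2norm_sq; have := dotC u u; case: (dot u u) => x y /= [] yN.
by congr Complex; lra.
Qed.

Lemma L2norm0 : L2norm (0 : H) = 0.
Proof. by apply/eqP; rewrite -sqrf_eq0 L2norm_sq dot0l. Qed.

Lemma L2normN u : L2norm (- u) = L2norm u.
Proof.
by apply/eqP; rewrite -(@eqrXn2 _ 2) ?L2norm_ge0 // !L2norm_rdot rdotNl rdotNr opprK.
Qed.

Lemma L2normB u v : L2norm (u - v) = L2norm (v - u).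
Proof. by rewrite -L2normN opprB. Qed.

Lemma L2normZ_sq a u : L2norm (a *: u) ^+ 2 = nsq a * L2norm u ^+ 2.
Proof.
rewrite !L2norm_sq dotZl dotZr dotuu; case: a => x y; rewrite /nsq /=; ring.
Qed.

Lemma L2normZ a u : L2norm (a *: u) = Num.sqrt (nsq a) * L2norm u.
Proof.
apply/eqP; rewrite -(@eqrXn2 _ 2) ?mulr_ge0 ?L2norm_ge0 ?sqrtr_ge0 //.
by rewrite L2normZ_sq exprMn (sqr_sqrtr (nsq_ge0 a)).
Qed.

Lemma L2norm_gt0 u : u <> 0 -> 0 < L2norm u.
Proof. by move=> u0; rewrite lt_neqAle L2norm_ge0 andbT eq_sym; apply/eqP => /L2norm_eq0. Qed.

Lemma L2normD_sq u v :
  L2norm (u + v) ^+ 2 = L2norm u ^+ 2 + 2 * rdot u v + L2norm v ^+ 2.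
Proof. by rewrite !L2norm_rdot rdotDl !rdotDr (rdotC v u); ring. Qed.

Lemma L2normB_sq u v :
  L2norm (u - v) ^+ 2 = L2norm u ^+ 2 - 2 * rdot u v + L2norm v ^+ 2.
Proof. by rewrite L2normD_sq rdotNr L2normN mulrN. Qed.

(** Expanding |b u - a v|^2 >= 0 with a = |u| and b = |v| gives 2ab(ab - <u, v>) >= 0 for the real
    form. *)
Lemma rdot_le u v : rdot u v <= L2norm u * L2norm v.
Proof.
have [->|u0] := pselect (u = 0); first by rewrite /rdot dot0l L2norm0 mul0r.
have [->|v0] := pselect (v = 0); first by rewrite /rdot dot0r L2norm0 mulr0.
have a0 := L2norm_gt0 u0; have b0 := L2norm_gt0 v0.
have h := sqr_ge0 (L2norm ((L2norm v)%:C%C *: u - (L2norm u)%:C%C *: v)).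
rewrite L2normB_sq rdotZl rdotZr 2!L2normZ_sq 2!nsq_real in h.
rewrite -(ler_pM2l (mulr_gt0 a0 b0)).
move: (L2norm u) (L2norm v) (rdot u v) a0 b0 h => a b c a0 b0 h.
nra.
Qed.

(** Rotating [u] by the conjugate of z = [dot u v] turns the inner product into the real number
    |z|^2, to which the real inequality applies. *)
Lemma nsq_dot_le u v : nsq (dot u v) <= L2norm u ^+ 2 * L2norm v ^+ 2.
Proof.
set z := dot u v; have [z0|z0] := pselect (z = 0).
  by rewrite z0 /nsq /= expr0n addr0 mulr_ge0 ?sqr_ge0.
have nz : 0 < nsq z.
  by rewrite lt_neqAle nsq_ge0 andbT eq_sym; apply/eqP => /nsq_eq0.
have h : nsq z = rdot (conjc z *: u) v.
  by rewrite /rdot dotZl -/z; case: (z) => x y; rewrite /nsq /=; ring.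
have := rdot_le (conjc z *: u) v; rewrite -h => h2.
have : nsq z ^+ 2 <= (L2norm (conjc z *: u) * L2norm v) ^+ 2.
  by apply: lerXn2r h2; rewrite nnegrE ?nsq_ge0 ?mulr_ge0 ?L2norm_ge0.
rewrite exprMn L2normZ_sq nsqC => h3; rewrite -(ler_pM2l nz); nra.
Qed.

Lemma ler_L2normD u v : L2norm (u + v) <= L2norm u + L2norm v.
Proof.
rewrite -(@ler_pXn2r _ 2) ?nnegrE ?addr_ge0 ?L2norm_ge0 //.
rewrite L2normD_sq sqrrD; have := rdot_le u v; lra.
Qed.

Lemma ler_L2norm_dist u v w : L2norm (u - w) <= L2norm (u - v) + L2norm (v - w).
Proof. by rewrite -[u - w](subrKA v); exact: ler_L2normD. Qed.

Lemma ler_L2norm_sub u v : `|L2norm u - L2norm v| <= L2norm (u - v).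
Proof.
rewrite ler_norml; apply/andP; split.
  rewrite lerBrDl lerBlDr (L2normB u v) -{1}[v](subrK u) addrC [leRHS]addrC.
  by apply: le_trans (ler_L2normD _ _); rewrite addrC.
by rewrite lerBlDr -{1}[u](subrK v); exact: ler_L2normD.
Qed.

Lemma parallelogram u v :
  L2norm (u + v) ^+ 2 + L2norm (u - v) ^+ 2 = 2 * L2norm u ^+ 2 + 2 * L2norm v ^+ 2.
Proof. by rewrite L2normD_sq L2normB_sq; ring. Qed.

Lemma rdot_eq0 u : (forall v, rdot v u = 0) -> u = 0.
Proof. by move=> h; apply: L2norm_eq0; apply/eqP; rewrite -sqrf_eq0 L2norm_rdot h. Qed.

Lemma dot_eq0 u : (forall v, dot v u = 0) -> u = 0.
Proof. by move=> h; apply: rdot_eq0 => v; rewrite /rdot h. Qed.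

End InnerProduct.

(** * Completeness of L2 and Riesz representation *)

Section Complete.
Context d (T : measurableType d) (R : realType).
Variable nu : {measure set T -> \bar R}.
Local Notation H := (L2 nu).

Lemma telescope_bound_cvg (a e : R^nat) (M : R) :
  (forall k, `|a k.+1 - a k| <= e k) -> (forall n, \sum_(k < n) e k <= M) ->
  cvgn a.
Proof.
move=> ae eM; have : cvgn (series (telescope a)).
  apply: normed_cvg; apply: nondecreasing_is_cvgn.
    apply: nondecreasing_series => // k _ _; exact: normr_ge0.
  exists M => _ [n _ <-]; apply: le_trans (eM n).
  by rewrite /normed_series_of seriesEord; apply: ler_sum => k _; exact: ae.
rewrite telescopeK => h.
have -> : a = (fun n => (a n - a 0%N) + a 0%N) by apply/funext => n; rewrite subrK.
by apply: is_cvgD => //; exact: is_cvg_cst.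
Qed.

(** Riesz-Fischer. The sum of 2^k |v_(k+1) - v_k|^2 has integral at most the sum of 2^k 4^-k = 2, so
    it is finite almost everywhere and [v] converges pointwise there; Fatou then transfers the norm
    bounds to the limit. *)
Lemma L2_fast_complete (v : nat -> H) :
  (forall k m, (k <= m)%N -> L2norm (v m - v k) <= 2^-1 ^+ k) ->
  exists w, forall k, L2norm (w - v k) <= 2^-1 ^+ k.
Proof.
move=> vfast.
pose D k x : R[i] := v k.+1 x - v k x.
have mD k : cmeas (D k).
  rewrite /D (_ : (fun x => _) = (fun x => v k.+1 x + (fun=> -1) x * v k x)).
    by apply: cmeasD; [exact: L2_cmeas|apply: cmeasM (cmeas_cst _ _) (L2_cmeas _)].
  by apply/funext => x; rewrite mulN1r.
have sD (k m : nat) : sqnorm nu (fun x => v m x - v k x) = (L2norm (v m - v k) ^+ 2)%:E.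
  rewrite L2norm_sqnorm; apply: sqnorm_ae; last first.
  - by have := L2B_ae (v m) (v k); apply: filterS => x ->.
  - exact: L2_cmeas.
  rewrite (_ : (fun x => _) = (fun x => v m x + (fun=> -1) x * v k x)).
    by apply: cmeasD; [exact: L2_cmeas|apply: cmeasM (cmeas_cst _ _) (L2_cmeas _)].
  by apply/funext => x; rewrite mulN1r.
pose h k x : \bar R := (2 ^+ k * nsq (D k x))%:E.
have h0 k x : (0 <= h k x)%E by rewrite lee_fin mulr_ge0 ?nsq_ge0 ?exprn_ge0.
have mh k : measurable_fun setT (h k).
  by apply/measurable_EFinP; apply: measurable_funM => //; apply: cmeas_nsq.
have mS : measurable_fun setT (fun x => \sum_(0 <= k <oo) h k x)%E.
  by apply: (@ge0_emeasurable_sum _ _ _ _ h xpredT).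
have S0 x : (0 <= \sum_(0 <= k <oo) h k x)%E by apply: nneseries_ge0.
have SI : nu.-integrable setT (fun x => \sum_(0 <= k <oo) h k x)%E.
  apply/integrableP; split=> //.
  under eq_integral => x _ do rewrite gee0_abs //.
  rewrite integral_nneseries //.
  apply: le_lt_trans (ltry 2); apply: le_trans (@epsilon_trick0 _ 2 xpredT _) => //.
  apply: lee_nneseries => k _; first by move=> _; apply: integral_ge0.
  rewrite /h; under eq_integral => x _ do rewrite EFinM.
  rewrite ge0_integralZl ?lee_fin ?exprn_ge0 //; last 2 first.
  - by apply/measurable_EFinP; apply: cmeas_nsq.
  - by move=> x _; rewrite lee_fin nsq_ge0.
  rewrite -/(sqnorm nu (D k)) sD -EFinM lee_fin.
  have h1 : L2norm (v k.+1 - v k) ^+ 2 <= (2^-1 ^+ k) ^+ 2.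
    by apply: lerXn2r; rewrite ?nnegrE ?L2norm_ge0 ?exprn_ge0 ?invr_ge0 // vfast.
  apply: (le_trans (ler_wpM2l _ h1)); first by rewrite exprn_ge0.
  rewrite natrX (exprS 2 k) exprVn; set c : R := 2 ^+ k.
  have c0 : 0 < c by rewrite exprn_gt0.
  rewrite le_eqVlt; apply/orP; left; apply/eqP; field.
  by rewrite gt_eqF.
(* Upper limits are measurable whether or not the sequence converges, and agree with the limit where
   it does. *)
pose fr x := fine (limn_esup (fun n => (CRe (v n x))%:E)).
pose fi x := fine (limn_esup (fun n => (CIm (v n x))%:E)).
pose f x : R[i] := Complex (fr x) (fi x).
have mf : cmeas f.
  split; apply: (measurableT_comp (fine_measurable measurableT));
    apply: measurable_fun_limn_esup => n; apply/measurable_EFinP;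
    by have [] := L2_cmeas (v n).
have lim_f : {ae nu, forall x, (fun n => CRe (v n x)) @ \oo --> fr x /\
    (fun n => CIm (v n x)) @ \oo --> fi x}.
  have := integrable_ae measurableT SI; apply: filterS => x /(_ I) Sfin.
  pose e k := 2 ^+ k * nsq (D k x) + 2^-1 ^+ k.
  have eM n : \sum_(k < n) e k <= fine (\sum_(0 <= k <oo) h k x)%E + 2.
    rewrite big_split /=; apply: lerD.
      rewrite -lee_fin fineK // -sumEFin.
      by have := @nneseries_lim_ge _ (h ^~ x) xpredT 0 n (fun k _ _ => h0 k x);
        rewrite big_mkord.
    have : series (geometric 1 (2^-1)) n <= 2 :> R.
      rewrite geometric_seriesE ?mul1r; last by rewrite lt_eqF //; lra.
      rewrite ler_pdivrMr; last by lra.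
      have : 0 <= 2^-1 ^+ n :> R by rewrite exprn_ge0.
      by lra.
    rewrite seriesEord; apply: le_trans.
    by apply: ler_sum => k _; rewrite /geometric /= mul1r.
  (* From (2^k |t| - 1)^2 >= 0: square summability with weights 2^k gives absolute summability of
     the increments. *)
  have am (t s : R) k : t ^+ 2 <= s -> `|t| <= 2 ^+ k * s + 2^-1 ^+ k.
    move=> ts; set c := 2 ^+ k; have c0 : 0 < c by rewrite exprn_gt0.
    have -> : 2^-1 ^+ k = c^-1 :> R by rewrite exprVn.
    rewrite -(ler_pM2l c0) mulrDr divff ?gt_eqF //.
    have : (c * `|t|) ^+ 2 <= c * (c * s).
      by rewrite exprMn real_normK ?num_real // expr2 -mulrA ler_pM2l // ler_pM2l.
    by have := sqr_ge0 (c * `|t| - 1); nra.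
  have C (g : R[i] -> R) : (forall z w, g (z - w) = g z - g w) ->
      (forall z, g z ^+ 2 <= nsq z) ->
      (fun n => g (v n x)) @ \oo --> fine (limn_esup (fun n => (g (v n x))%:E)).
    move=> gB gn.
    have : cvgn (fun n => g (v n x)).
      apply: (telescope_bound_cvg _ eM) => k; rewrite -gB; apply: am; exact: gn.
    move=> /cvg_ex[l gl].
    have /cvg_limn_einf_sup[_ ->] : (fun n => (g (v n x))%:E) @ \oo --> l%:E.
      by apply: cvg_EFin => //; exact: nearW.
    exact: gl.
  split; apply: C.
  - by move=> [? ?] [].
  - by move=> [a b]; rewrite /nsq /= lerDl sqr_ge0.
  - by move=> [? ?] [].
  - by move=> [a b]; rewrite /nsq /= lerDr sqr_ge0.
have mfv k : cmeas (fun x => f x - v k x).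
  rewrite (_ : (fun x => _) = (fun x => f x + (fun=> -1) x * v k x)).
    by apply: cmeasD => //; apply: cmeasM (cmeas_cst _ _) (L2_cmeas _).
  by apply/funext => x; rewrite mulN1r.
have mvv m k : cmeas (fun x => v m x - v k x).
  rewrite (_ : (fun x => _) = (fun x => v m x + (fun=> -1) x * v k x)).
    by apply: cmeasD; [exact: L2_cmeas|apply: cmeasM (cmeas_cst _ _) (L2_cmeas _)].
  by apply/funext => x; rewrite mulN1r.
have key k : (sqnorm nu (fun x => f x - v k x)%R <= ((2^-1 ^+ k) ^+ 2)%:E)%E.
  pose F m x : \bar R := (nsq (v (m + k)%N x - v k x))%:E.
  have mF m : measurable_fun setT (F m) by apply/measurable_EFinP; exact: cmeas_nsq.
  have F0 m x : (0 <= F m x)%E by rewrite lee_fin nsq_ge0.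
  apply: (@le_trans _ _ (\int[nu]_x limn_einf (F ^~ x))%E).
    apply: ae_ge0_le_integral => //.
    - by move=> x _; rewrite lee_fin nsq_ge0.
    - by apply/measurable_EFinP; apply: cmeas_nsq.
    - move=> x _; rewrite limn_einf_lim; apply: lime_ge; first exact: is_cvg_einfs.
      by apply: nearW => n; apply/le_ereal_inf_tmp => _ [m _ <-].
    - rewrite (_ : (fun x => _) = (fun x => - limn_esup (fun m => - F m x))%E) //.
      apply: measurableT_comp => //; apply: measurable_fun_limn_esup => n.
      exact: measurableT_comp.
    apply: filterS lim_f => x [lr li] _.
    suff /cvg_limn_einf_sup[-> _] : F ^~ x @ \oo --> (nsq (f x - v k x))%:E by [].
    apply: cvg_EFin; first exact: nearW.
    rewrite /F /nsq /=; apply: cvgD.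
    - rewrite (_ : CRe _ = fr x - CRe (v k x)); last by case: (v k x).
      rewrite (_ : (fun _ => _) =
          fun m => (CRe (v (m + k)%N x) - CRe (v k x)) * (CRe (v (m + k)%N x) - CRe (v k x))).
        by rewrite expr2; apply: cvgM; apply: cvgB; [|exact: cvg_cst|
          |exact: cvg_cst]; rewrite (cvg_shiftn k (fun m => CRe (v m x))).
      by apply/funext => m; rewrite -expr2; case: (v _ x) (v _ x) => ? ? [].
    - rewrite (_ : CIm _ = fi x - CIm (v k x)); last by case: (v k x).
      rewrite (_ : (fun _ => _) =
          fun m => (CIm (v (m + k)%N x) - CIm (v k x)) * (CIm (v (m + k)%N x) - CIm (v k x))).
        by rewrite expr2; apply: cvgM; apply: cvgB; [|exact: cvg_cst|
          |exact: cvg_cst]; rewrite (cvg_shiftn k (fun m => CIm (v m x))).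
      by apply/funext => m; rewrite -expr2; case: (v _ x) (v _ x) => ? ? [].
  apply: le_trans (fatou _ _ mF _) _ => //.
  apply: le_trans (limn_einf_sup _) _; rewrite limn_esup_lim.
  apply: lime_le; first exact: is_cvg_esups.
  apply: nearW => n; apply/ge_ereal_sup => _ [m _ <-].
  rewrite -/(sqnorm nu (fun x => v (m + k)%N x - v k x)) sD lee_fin.
  by apply: lerXn2r; rewrite ?nnegrE ?L2norm_ge0 ?exprn_ge0 ?invr_ge0 // vfast // leq_addl.
have fs : f \in sqint nu.
  apply/sqintP; split=> //.
  have /sqintP[_ v0] := L2_sqint (v 0%N).
  have sf : (sqnorm nu (fun x => f x - v 0%N x)%R < +oo)%E.
    exact: le_lt_trans (key 0%N) (ltry _).
  apply: (@le_lt_trans _ _ (2%:E * sqnorm nu (fun x => f x - v 0%N x)%R +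
      2%:E * sqnorm nu (v 0%N))%E); last first.
    by rewrite lte_add_pinfty // lte_mul_pinfty // lee_fin.
  have m1 : measurable_fun setT (fun x => (nsq (f x - v 0%N x))%:E).
    by apply/measurable_EFinP; apply: cmeas_nsq.
  have m2 : measurable_fun setT (fun x => (nsq (v 0%N x))%:E).
    by apply/measurable_EFinP; apply: cmeas_nsq; exact: L2_cmeas.
  rewrite /sqnorm -!ge0_integralZl ?lee_fin //; last 2 first.
  - by move=> x _; rewrite lee_fin nsq_ge0.
  - by move=> x _; rewrite lee_fin nsq_ge0.
  rewrite -ge0_integralD //; last 4 first.
  - by move=> x _; rewrite mule_ge0 // lee_fin nsq_ge0.
  - exact: emeasurable_funM.
  - by move=> x _; rewrite mule_ge0 // lee_fin nsq_ge0.
  - exact: emeasurable_funM.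
  apply: ge0_le_integral => //.
  - by move=> x _; rewrite lee_fin nsq_ge0.
  - by apply/measurable_EFinP; apply: cmeas_nsq.
  - by apply: emeasurable_funD; exact: emeasurable_funM.
  - by move=> x _; rewrite -!EFinM -EFinD lee_fin -{1}(subrK (v 0%N x) (f x)) nsqD.
exists (to_L2 nu f) => k.
rewrite -(@ler_pXn2r _ 2) ?nnegrE ?L2norm_ge0 ?exprn_ge0 ?invr_ge0 //.
rewrite -lee_fin L2norm_sqnorm; apply: le_trans (key k).
rewrite le_eqVlt; apply/orP; left; apply/eqP; apply: sqnorm_ae => //.
  exact: L2_cmeas.
have := L2B_ae (to_L2 nu f) (v k); have := to_L2_ae fs.
by apply: filterS2 => x <- ->.
Qed.

Lemma cvg0P (I : Type) (F : set_system I) {FF : Filter F} (f : I -> R) :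
  (forall i, 0 <= f i) ->
  f @ F --> 0 <-> (forall e : R, 0 < e -> \forall i \near F, f i <= e).
Proof.
move=> f0; split=> [/cvgrPdist_le h e e0|h].
  by have := h e e0; apply: filterS => i; rewrite sub0r normrN ger0_norm.
apply/cvgrPdist_le => e e0; have := h e e0; apply: filterS => i.
by rewrite sub0r normrN ger0_norm.
Qed.

Lemma L2_complete (u : nat -> H) :
  (forall e : R, 0 < e -> exists N, forall m n, (N <= m)%N -> (N <= n)%N ->
    L2norm (u m - u n) <= e) ->
  exists v, L2norm (u n - v) @[n --> \oo] --> (0 : R).
Proof.
move=> uC.
have P k : 0 < 2^-1 ^+ k :> R by rewrite exprn_gt0.
have /choice[N HN] : forall k, exists N, forall m n, (N <= m)%N -> (N <= n)%N ->
    L2norm (u m - u n) <= 2^-1 ^+ k by move=> k; exact: uC.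
(* The sum dominates [N i] for every i <= k, so the subsequence is fast from each index on. *)
pose phi k := (\sum_(i < k.+1) N i)%N.
have Nphi k m : (k <= m)%N -> (N k <= phi m)%N.
  move=> km; rewrite /phi.
  have km' : (k < m.+1)%N by [].
  by rewrite (bigD1 (Ordinal km')) //= leq_addr.
have [w Hw] := @L2_fast_complete (fun k => u (phi k))
  (fun k m km => HN k _ _ (Nphi _ _ km) (Nphi _ _ (leqnn k))).
exists w; apply/cvg0P => [n|e e0]; first exact: L2norm_ge0.
have /cvgrPdist_le/(_ (e / 2))[] : (fun n => 2^-1 ^+ n : R) @ \oo --> 0.
  by apply: cvg_expr; rewrite ger0_norm //; lra.
  by lra.
move=> k _ /(_ k (leqnn k)); rewrite sub0r normrN (ger0_norm (ltW (P k))) => ke.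
exists (N k) => // n /= kn; apply: le_trans (ler_L2norm_dist _ (u (phi k)) _) _.
rewrite (splitr e); apply: lerD; first by apply: le_trans ke; apply: HN => //; exact: Nphi.
by rewrite L2normB; apply: le_trans ke.
Qed.

Definition closed_subspace (K : set H) : Prop :=
  [/\ K 0, forall a u v, K u -> K v -> K (a *: u + v) &
     forall (u : nat -> H) v, (forall n, K (u n)) ->
       L2norm (u n - v) @[n --> \oo] --> (0 : R) -> K v].

(* The minimiser of |u|^2 - 2 phi(u) over [K] represents [phi]; minimising
   sequences are Cauchy by the parallelogram law. *)
Lemma riesz_subspace (K : set H) (phi : H -> R) (C : R) : closed_subspace K ->
  (forall u v, phi (u + v) = phi u + phi v) ->
  (forall (t : R) u, phi (t%:C%C *: u) = t * phi u) ->
  (forall u, phi u <= C * L2norm u) ->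
  exists2 w, K w & forall u, K u -> phi u = rdot u w.
Proof.
move=> [K0 KL Kc] phiD phiZ phiC.
pose J u := L2norm u ^+ 2 - 2 * phi u.
have JC u : - C ^+ 2 <= J u.
  by rewrite /J; have := phiC u; have := sqr_ge0 (L2norm u - C); nra.
pose S := [set J u | u in K].
have S0 : has_inf S.
  split; first by exists (J 0), 0.
  by exists (- C ^+ 2) => _ [u _ <-].
have infS u : K u -> inf S <= J u.
  by move=> Ku; apply: ge_inf; [case: S0|exists u].
have Khalf u v : K u -> K v -> K ((2^-1)%:C%C *: (u + v)).
  move=> Ku Kv; rewrite -[_ *: _]addr0; apply: (KL) => //.
  by rewrite -[u]scale1r; exact: KL.
have /choice[u Hu] : forall n, exists u, K u /\ J u < inf S + n.+1%:R^-1.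
  move=> n; have n0 : 0 < n.+1%:R^-1 :> R by rewrite invr_gt0.
  by have [_ [u Ku <-] Ju] := inf_adherent n0 S0; exists u.
have dist m n : L2norm (u m - u n) ^+ 2 <= 2 * (m.+1%:R^-1 + n.+1%:R^-1).
  have [Km Jm] := Hu m; have [Kn Jn] := Hu n.
  have := infS _ (Khalf _ _ Km Kn); rewrite {1}/J phiZ phiD L2normZ_sq /nsq /=.
  have := parallelogram (u m) (u n); move: Jm Jn; rewrite {1 2}/J.
  move: (inf S) (m.+1%:R^-1) (n.+1%:R^-1) => s p q; rewrite expr0n addr0 => Jm Jn.
  have -> : 2^-1 ^+ 2 = 4^-1 :> R by field.
  move: (L2norm _ ^+ 2) (L2norm _ ^+ 2) Jm Jn => a b; lra.
have uC : forall e : R, 0 < e -> exists N, forall m n, (N <= m)%N -> (N <= n)%N ->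
    L2norm (u m - u n) <= e.
  move=> e e0; have /cvgrPdist_le/(_ (e ^+ 2 / 4))[] := @cvg_harmonic R.
    by rewrite divr_gt0 ?exprn_gt0.
  move=> N _ HN; exists N => m n /HN Hm /HN Hn; move: Hm Hn.
  rewrite /harmonic /= !sub0r !normrN !ger0_norm ?invr_ge0 // => Hm Hn.
  rewrite -(@ler_pXn2r _ 2) ?nnegrE ?L2norm_ge0 ?(ltW e0) //.
  apply: le_trans (dist m n) _; move: Hm Hn.
  by move: (m.+1%:R^-1) (n.+1%:R^-1) => p q; lra.
have [w uw] := L2_complete uC.
have Kw : K w by apply: Kc uw => n; case: (Hu n).
exists w => // z Kz.
have phiB a b : phi (a - b) = phi a - phi b.
  rewrite phiD -scaleN1r (_ : -1 = (-1)%:C%C) ?phiZ ?mulN1r //.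
  by rewrite rmorphN1.
have Jw : J w <= inf S.
  apply/ler_addgt0Pr => e e0.
  (* As soon as |u_n - w| <= 1, [J w - J (u n)] is at most [M] times |u_n - w|: the squared norms
     contribute 2|w| + 1 and the functional 2|C|. *)
  pose M := 2 * L2norm w + 1 + 2 * `|C|.
  have w0 := L2norm_ge0 w; have C0 := normr_ge0 C.
  have M0 : 0 < M by rewrite /M; lra.
  have d0 : 0 < Num.min 1 (e / 2 / M) by rewrite lt_min ltr01 !divr_gt0.
  have e20 : 0 < e / 2 by rewrite divr_gt0.
  have h1 : \forall n \near \oo, L2norm (u n - w) <= Num.min 1 (e / 2 / M).
    exact: ((cvg0P (fun n => L2norm_ge0 (u n - w))).1 uw _ d0).
  have h2 : \forall n \near \oo, n.+1%:R^-1 <= e / 2.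
    have /cvgrPdist_le/(_ _ e20) := @cvg_harmonic R; apply: filterS => n.
    by rewrite /harmonic /= sub0r normrN ger0_norm.
  have [n [{}h1 {}h2]] := filter_ex (filterI h1 h2).
  move: h1; rewrite le_min ler_pdivlMr // => /andP[h1 h3].
  have [_ Jn] := Hu n.
  have un := ler_L2norm_sub (u n) w.
  have p1 : phi (u n) - phi w <= `|C| * L2norm (u n - w).
    rewrite -phiB; apply: (le_trans (phiC _)).
    by rewrite ler_wpM2r ?L2norm_ge0 // ler_norm.
  have un0 := L2norm_ge0 (u n); have dn0 := L2norm_ge0 (u n - w).
  move: Jn p1 un h1 h3 dn0; rewrite /J /M ler_norml.
  move: (L2norm (u n - w)) (L2norm w) (L2norm (u n)) w0 un0 => dn a b a0 b0.
  move: (phi (u n)) (phi w) `|C| C0 (inf S) (n.+1%:R^-1) h2 => pu pw c c0 s q h2.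
  move=> Jn p1 /andP[un un'] h1 h3 dn0.
  have ab0 : 0 <= a + b by lra.
  have k1 : (a - b) * (a + b) <= dn * (a + b) by rewrite ler_wpM2r //; lra.
  have k2 : dn * (a + b) <= dn * (2 * a + 1) by rewrite ler_wpM2l //; lra.
  lra.
have key (t : R) : 0 <= 2 * t * (rdot z w - phi z) + t ^+ 2 * L2norm z ^+ 2.
  have Kt : K (t%:C%C *: z + w) by exact: KL.
  have := le_trans Jw (infS _ Kt); rewrite /J phiD phiZ (L2normD_sq (t%:C%C *: z) w) L2normZ_sq rdotZl nsq_real.
  lra.
apply/eqP; rewrite eq_sym -subr_eq0; apply/negPn/negP => ne0.
set D := rdot z w - phi z in key ne0; set b := L2norm z ^+ 2 in key.
have b0 : 0 <= b by rewrite sqr_ge0.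
(* The minimum of 2tD + t^2 b is at t = -D/b; replacing b by b + 1 keeps the denominator positive
   even for z = 0, and the value stays negative. *)
have := key (- D / (b + 1)).
have -> : 2 * (- D / (b + 1)) * D + (- D / (b + 1)) ^+ 2 * b = - (D ^+ 2) * (b + 2) / (b + 1) ^+ 2.
  by field; rewrite gt_eqF //; lra.
have D2 : 0 < D ^+ 2 by rewrite lt_neqAle sqr_ge0 andbT eq_sym sqrf_eq0.
apply/negP; rewrite -ltNge !mulNr oppr_lt0; apply: divr_gt0.
  by apply: mulr_gt0 => //; lra.
by apply: exprn_gt0; lra.
Qed.
End Complete.

(** * Bounded operators and von Neumann algebras *)

Section Operators.
Context d (T : measurableType d) (R : realType).
Variable nu : {measure set T -> \bar R}.
Local Notation H := (L2 nu).
Local Notation BH := (@bounded_op _ _ _ nu).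
Implicit Types (a b c : H -> H) (u v w : H) (S M : set (H -> H)).

Lemma linear_D a u v : linear a -> a (u + v) = a u + a v.
Proof. by move=> /(_ 1 u v); rewrite !scale1r. Qed.

Lemma linear_0 a : linear a -> a 0 = 0.
Proof. by move=> /(_ (-1) 0 0); rewrite !scaleN1r oppr0 addr0 addNr. Qed.

Lemma linear_Z a (k : R[i]) u : linear a -> a (k *: u) = k *: a u.
Proof. by move=> al; have := al k u 0; rewrite !addr0 (linear_0 al) addr0. Qed.

Lemma linear_N a u : linear a -> a (- u) = - a u.
Proof. by move=> al; rewrite -scaleN1r (linear_Z _ _ al) scaleN1r. Qed.

Lemma linear_B a u v : linear a -> a (u - v) = a u - a v.
Proof. by move=> al; rewrite (linear_D _ _ al) (linear_N _ al). Qed.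

Lemma op_bound_le a r s : r <= s -> op_bound a r -> op_bound a s.
Proof.
by move=> rs ar u; apply: le_trans (ar u) _; rewrite ler_wpM2r ?L2norm_ge0.
Qed.

Lemma bounded_opP a : bounded_op a -> exists r, 0 <= r /\ op_bound a r.
Proof.
move=> [_ [r ar]]; exists `|r|; split; rewrite ?normr_ge0 //.
by apply: op_bound_le ar; exact: ler_norm.
Qed.

Lemma bounded_op_lin a : bounded_op a -> linear a. Proof. by case. Qed.

Lemma bounded_id : bounded_op (id : H -> H).
Proof. by split=> [k u v|] //; exists 1 => u; rewrite mul1r. Qed.

Lemma bounded_0 : bounded_op (0 : H -> H).
Proof.
split=> [k u v|]; first by rewrite /= scaler0 addr0.
by exists 0 => u; rewrite mul0r -[(0 : H -> H) u]/(0 : H) L2norm0.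
Qed.

Lemma bounded_comp a b : bounded_op a -> bounded_op b -> bounded_op (a \o b).
Proof.
move=> ba bb; have [r [r0 ar]] := bounded_opP ba; have [s [s0 bs]] := bounded_opP bb.
split=> [k u v|].
  by rewrite /= (bounded_op_lin bb) (bounded_op_lin ba).
exists (r * s) => u; apply: le_trans (ar _) _.
by rewrite -mulrA ler_wpM2l.
Qed.

Lemma bounded_lin k a b : bounded_op a -> bounded_op b -> bounded_op (k *: a + b).
Proof.
move=> ba bb; have [r [r0 ar]] := bounded_opP ba; have [s [s0 bs]] := bounded_opP bb.
split=> [z u v|].
  rewrite -[LHS]/(k *: a (z *: u + v) + b (z *: u + v)).
  rewrite -[RHS]/(z *: (k *: a u + b u) + (k *: a v + b v)).
  rewrite (bounded_op_lin bb) (bounded_op_lin ba) !scalerDr !scalerA (mulrC k z).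
  by rewrite addrACA.
exists (Num.sqrt (nsq k) * r + s) => u.
rewrite -[X in L2norm X]/(k *: a u + b u); apply: le_trans (ler_L2normD _ _) _.
by rewrite L2normZ mulrDl -mulrA lerD // ler_wpM2l ?sqrtr_ge0.
Qed.

Lemma bounded_sub a b : bounded_op a -> bounded_op b -> bounded_op (a - b).
Proof.
by move=> ba bb; rewrite addrC -scaleN1r; exact: bounded_lin.
Qed.

Lemma adj_unique a b : bounded_op b -> (forall u v, dot (a u) v = dot u (b v)) ->
  adj a = b.
Proof.
move=> bb ab; rewrite /adj; case: xgetP => [c _ [bc ac]|/(_ b)[]//].
apply/funext => v; apply/eqP; rewrite -subr_eq0; apply/eqP.
by apply: dot_eq0 => u; rewrite dotBr -ab -ac subrr.
Qed.

Lemma adj_bounded a : bounded_op (adj a).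
Proof.
by rewrite /adj; case: xgetP => [c _ [bc ac]//|_]; exact: bounded_0.
Qed.

Lemma setT_closed_subspace : closed_subspace (@setT H).
Proof. by []. Qed.

(** Riesz represents u |-> Re <a u, v> for each v, and complex linearity of [a] recovers the
    imaginary part. Linearity and boundedness of the representing map follow by testing against
    inner products. *)
Lemma adjP a : bounded_op a -> forall u v, dot (a u) v = dot u (adj a v).
Proof.
move=> ba; suff [b [bb ab]] : exists b, bounded_op b /\ forall u v, dot (a u) v = dot u (b v).
  by rewrite (adj_unique bb ab).
have al := bounded_op_lin ba; have [r [r0 ar]] := bounded_opP ba.
have /choice[b Hb] : forall v, exists w, forall u, rdot (a u) v = rdot u w.
  move=> v; have [] := @riesz_subspace _ _ _ _ _ (fun u => rdot (a u) v) (r * L2norm v)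
    setT_closed_subspace.
  - by move=> u w; rewrite (linear_D _ _ al) rdotDl.
  - by move=> t u; rewrite (linear_Z _ _ al) rdotZl.
  - move=> u; apply: le_trans (rdot_le _ _) _.
    by rewrite mulrAC ler_wpM2r ?L2norm_ge0.
  by move=> w _ h; exists w => u; exact: h.
have ab u v : dot (a u) v = dot u (b v).
  by rewrite !dot_rdot Hb -(linear_Z _ _ al) Hb.
exists b; split=> //; split=> [k u v|].
  apply/eqP; rewrite -subr_eq0; apply/eqP; apply: dot_eq0 => w.
  by rewrite dotBr dotDr dotZr -!ab dotDr dotZr subrr.
exists r => v; have := L2norm_ge0 (b v); rewrite le_eqVlt => /predU1P[<-|bv].
  by rewrite mulr_ge0 ?L2norm_ge0.
rewrite -(ler_pM2l bv) -expr2 L2norm_rdot -Hb; apply: le_trans (rdot_le _ _) _.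
by rewrite mulrA (mulrC _ r) ler_wpM2r ?L2norm_ge0.
Qed.

Lemma adjPr a : bounded_op a -> forall u v, dot u (a v) = dot (adj a u) v.
Proof. by move=> ba u v; rewrite dotC (adjP ba) -dotC. Qed.

Lemma adjK a : bounded_op a -> adj (adj a) = a.
Proof. by move=> ba; apply: adj_unique => // u v; rewrite (adjPr ba). Qed.

Lemma adj_comp a b : bounded_op a -> bounded_op b -> adj (a \o b) = adj b \o adj a.
Proof.
move=> ba bb; apply: adj_unique => [|u v]; first by apply: bounded_comp; exact: adj_bounded.
by rewrite /= (adjP ba) (adjP bb).
Qed.

Lemma adj_id : adj (id : H -> H) = id.
Proof. by apply: adj_unique => //; exact: bounded_id. Qed.

Lemma adj_lin k a b : bounded_op a -> bounded_op b ->
  adj (k *: a + b) = conjc k *: adj a + adj b.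
Proof.
move=> ba bb; apply: adj_unique => [|u v].
  by apply: bounded_lin; exact: adj_bounded.
rewrite -[(k *: a + b) u]/(k *: a u + b u).
rewrite -[(_ *: _ + _) v]/(conjc k *: adj a v + adj b v).
by rewrite dotDl dotDr dotZl dotZr (adjP ba) (adjP bb) conjcK.
Qed.

Lemma commutant_sub S M : S `<=` M -> commutant M `<=` commutant S.
Proof. by move=> SM a [ba aM]; split=> // b /SM; exact: aM. Qed.

Lemma sub_commutant2 S : S `<=` BH -> S `<=` commutant (commutant S).
Proof.
move=> Sb a Sa; split; first exact: Sb.
by move=> b [_ bS]; rewrite bS.
Qed.

(** The identity S''' = S', valid because taking commutants reverses inclusions and S is contained
    in S''. *)
Lemma vN_commutant S : S `<=` BH -> (forall a, S a -> S (adj a)) ->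
  von_neumann (commutant S).
Proof.
move=> Sb Sadj; split; first by move=> a [].
- move=> a [ba aS]; split; first exact: adj_bounded.
  move=> b Sb'; have bb := Sb _ Sb'; have := aS _ (Sadj _ Sb') => h.
  have := congr1 (@adj _ _ _ nu) h.
  by rewrite (adj_comp ba (adj_bounded b)) (adj_comp (adj_bounded b) ba) (adjK bb).
- apply/seteqP; split.
    by apply: commutant_sub; exact: sub_commutant2.
  by apply: sub_commutant2 => a [].
Qed.

Lemma vN_generated_min S M : von_neumann M -> S `<=` M -> vN_generated S `<=` M.
Proof. by move=> vM SM; exact: smallest_sub. Qed.

Lemma sub_vN_generated S : S `<=` vN_generated S.
Proof. exact: sub_gen_smallest. Qed.

Lemma vN_bounded : von_neumann (@bounded_op _ _ _ nu).
Proof.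
split=> //; first by move=> a _; exact: adj_bounded.
apply/seteqP; split; first by move=> a [].
by apply: sub_commutant2.
Qed.

(** Each von Neumann algebra containing S contains the generated set, hence also the bicommutant of
    that set; so the intersection is its own bicommutant. *)
Lemma vN_generated_vN S : S `<=` BH -> von_neumann (vN_generated S).
Proof.
move=> Sb; have gb : vN_generated S `<=` BH.
  by apply: vN_generated_min => //; exact: vN_bounded.
split=> //.
- by move=> a ga M [vM SM]; have [_ + _] := vM; apply; apply: ga.
- apply/seteqP; split; last exact: sub_commutant2.
  move=> a ga M [vM SM]; have [_ _ <-] := vM; move: a ga.
  by do 2 apply: commutant_sub; exact: vN_generated_min.
Qed.

Lemma vN_sub_bounded M : von_neumann M -> M `<=` BH.
Proof. by case. Qed.

Lemma vN_comp M a b : von_neumann M -> M a -> M b -> M (a \o b).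
Proof.
move=> [Mb _ ME]; rewrite -ME => -[ba aM] [bb bM]; split; first exact: bounded_comp.
by move=> c cM; rewrite -compA bM // compA aM.
Qed.

Lemma vN_id M : von_neumann M -> M id.
Proof. by move=> [_ _ <-]; split=> //; exact: bounded_id. Qed.

Lemma vN_lin M k a b : von_neumann M -> M a -> M b -> M (k *: a + b).
Proof.
move=> [Mb _ ME]; rewrite -ME => -[ba aM] [bb bM]; split; first exact: bounded_lin.
move=> c cM; have [bc _] := cM; apply/funext => u.
rewrite -[LHS]/(k *: a (c u) + b (c u)) -[RHS]/(c (k *: a u + b u)).
rewrite (bounded_op_lin bc).
by have /(congr1 (@^~ u))/= -> := aM _ cM; have /(congr1 (@^~ u))/= -> := bM _ cM.
Qed.

Lemma vN_sub M a b : von_neumann M -> M a -> M b -> M (a - b).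
Proof. by move=> vM Ma Mb; rewrite addrC -scaleN1r; exact: vN_lin. Qed.

Lemma vN_adj M a : von_neumann M -> M a -> M (adj a).
Proof. by case=> _ + _; apply. Qed.

Definition strong_cvg (I : Type) (F : set_system I) (A : I -> H -> H) a : Prop :=
  forall u, L2norm (A i u - a u) @[i --> F] --> (0 : R).

Lemma L2norm_cvg_le (I : Type) (F : set_system I) {FF : Filter F} (f : I -> H) (h : I -> R) :
  (forall i, L2norm (f i) <= h i) -> h @ F --> (0 : R) ->
  L2norm (f i) @[i --> F] --> (0 : R).
Proof.
move=> fh h0; apply: (@squeeze_cvgr _ _ _ _ (fun=> 0) _ _ _ _ (cvg_cst _) h0).
by apply: nearW => i; rewrite L2norm_ge0 fh.
Qed.

Lemma L2_cvg_unique (I : Type) (F : set_system I) {FF : ProperFilter F} (f : I -> H) u v :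
  L2norm (f i - u) @[i --> F] --> (0 : R) -> L2norm (f i - v) @[i --> F] --> (0 : R) ->
  u = v.
Proof.
move=> fu fv; apply/eqP; rewrite -subr_eq0; apply/eqP/L2norm_eq0.
have h : L2norm (u - v) @[i --> F] --> (0 : R).
  apply: (L2norm_cvg_le (h := fun i => L2norm (f i - u) + L2norm (f i - v))).
    by move=> i; rewrite (L2normB _ u); exact: ler_L2norm_dist.
  by rewrite -[0]addr0; exact: cvgD.
by apply: (cvg_unique _ _ h) => //; exact: cvg_cst.
Qed.

(** Commutation with a fixed bounded operator passes to strong limits, so a bicommutant is strongly
    closed, along filters as well as sequences. *)
Lemma strong_cvg_vN (I : Type) (F : set_system I) {FF : ProperFilter F}
    (A : I -> H -> H) a M :
  von_neumann M -> (\forall i \near F, M (A i)) -> bounded_op a -> strong_cvg F A a -> M a.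
Proof.
move=> vM MA ba Aa; have [_ _ <-] := vM; split=> // c [bc cM].
have [r [r0 cr]] := bounded_opP bc.
apply/funext => u /=; apply: (@L2_cvg_unique _ F _ (fun i => A i (c u))); first exact: Aa.
have h : r * L2norm (A i u - a u) @[i --> F] --> (0 : R).
  by rewrite -(mulr0 r); apply: cvgM; [exact: cvg_cst|exact: Aa].
apply: (@squeeze_cvgr _ _ _ _ (fun=> 0) _ _ _ _ (cvg_cst _) h).
apply: filterS MA => i /cM /(congr1 (@^~ u))/= <-.
by rewrite L2norm_ge0 -(linear_B _ _ (bounded_op_lin bc)) cr.
Qed.

(** By an epsilon/3 argument from the uniform bound. Strong convergence of contractions can then be
    checked on indicators alone. *)
Lemma strong_cvg_subspace (I : Type) (F : set_system I) {FF : Filter F}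
    (A : I -> H -> H) a r : (forall i, linear (A i)) -> linear a ->
  (forall i, op_bound (A i) r) -> op_bound a r ->
  closed_subspace [set u | L2norm (A i u - a u) @[i --> F] --> (0 : R)].
Proof.
move=> Al al Ar ar; split=> /=.
- rewrite (linear_0 al); apply: cvg_near_cst; apply: nearW => i.
  by rewrite (linear_0 (Al i)) subrr L2norm0.
- move=> k u v hu hv; apply: (L2norm_cvg_le (h := fun i =>
    Num.sqrt (nsq k) * L2norm (A i u - a u) + L2norm (A i v - a v))).
    move=> i; rewrite Al al opprD addrACA -scalerBr; apply: le_trans (ler_L2normD _ _) _.
    by rewrite L2normZ.
  rewrite -[0 in X in _ --> X]addr0 -{1}(mulr0 (Num.sqrt (nsq k))).
  by apply: cvgD => //; apply: cvgM => //; exact: cvg_cst.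
- move=> w u hw wu; apply/cvg0P => [i|e e0]; first exact: L2norm_ge0.
  pose s := `|r| + 1; have s0 : 0 < s by rewrite ltr_wpDl.
  have rs : r <= s by rewrite (le_trans (ler_norm r)) // lerDl.
  have [n hn] : exists n, L2norm (w n - u) <= e / 3 / s.
    have : \forall n \near \oo, L2norm (w n - u) <= e / 3 / s.
      have ed : 0 < e / 3 / s by rewrite !divr_gt0.
      exact: ((cvg0P (fun n => L2norm_ge0 (w n - u))).1 wu _ ed).
    by move=> /filter_ex.
  have e3 : 0 < e / 3 by rewrite divr_gt0.
  have := (cvg0P (fun i => L2norm_ge0 (A i (w n) - a (w n)))).1 (hw n) _ e3.
  move=> /(_ FF); apply: filterS => i hi.
  have h1 : L2norm (A i u - A i (w n)) <= e / 3.
    rewrite -(linear_B _ _ (Al i)) (le_trans (Ar i _)) // L2normB.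
    apply: (@le_trans _ _ (s * L2norm (w n - u))); first by rewrite ler_wpM2r ?L2norm_ge0.
    by rewrite mulrC -ler_pdivlMr.
  have h2 : L2norm (a (w n) - a u) <= e / 3.
    rewrite -(linear_B _ _ al) (le_trans (ar _)) //.
    apply: (@le_trans _ _ (s * L2norm (w n - u))); first by rewrite ler_wpM2r ?L2norm_ge0.
    by rewrite mulrC -ler_pdivlMr.
  have := ler_L2norm_dist (A i u) (A i (w n)) (a u).
  have := ler_L2norm_dist (A i (w n)) (a (w n)) (a u).
  move: (L2norm (A i u - a u)) (L2norm (A i u - A i (w n))) (L2norm (A i (w n) - a u))
    (L2norm (A i (w n) - a (w n))) (L2norm (a (w n) - a u)) h1 h2 hi => x1 x2 x3 x4 x5.
  by lra.
Qed.

End Operators.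

(** * Orthogonal projections and unitary conjugation *)

Section Geometry.
Context d (T : measurableType d) (R : realType).
Variable nu : {measure set T -> \bar R}.
Local Notation H := (L2 nu).
Local Notation BH := (@bounded_op _ _ _ nu).
Implicit Types (a b c : H -> H) (u v w : H) (S M : set (H -> H)) (K : set H).

Lemma orthogonal_closed (Z : set H) :
  closed_subspace [set u | forall z, Z z -> dot u z = 0].
Proof.
split=> [z _|k u v hu hv z Zz|w u hw wu z Zz]; first exact: dot0l.
  by rewrite dotDl dotZl hu // hv // mulr0 addr0.
apply: nsq_eq0; apply/eqP; rewrite eq_le nsq_ge0 andbT.
have h : L2norm (w n - u) ^+ 2 * L2norm z ^+ 2 @[n --> \oo] --> (0 : R).
  rewrite -(mul0r (L2norm z ^+ 2)); apply: cvgM; last exact: cvg_cst.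
  by rewrite -(mulr0 0); exact: (cvgM wu wu).
apply: (cvgr_to_ge h); apply: nearW => n.
have -> : dot u z = - dot (w n - u) z by rewrite dotBl hw // sub0r opprK.
rewrite (_ : nsq (- _) = nsq (dot (w n - u) z)); first exact: nsq_dot_le.
by case: (dot _ _) => x y; rewrite /nsq /= !sqrrN.
Qed.

(** [P v] represents u |-> Re <u, v> on [K]; uniqueness of the representing vector yields complex
    linearity. *)
Lemma projection K : closed_subspace K -> exists P : H -> H,
  [/\ bounded_op P, forall u, K (P u), forall u, K u -> P u = u &
      forall u v, K u -> dot u (P v) = dot u v].
Proof.
move=> cK; have [K0 KL _] := cK.
have /choice[P HP] : forall v, exists w, K w /\ forall u, K u -> rdot u v = rdot u w.
  move=> v; have [] := @riesz_subspace _ _ _ _ _ (fun u => rdot u v) (L2norm v) cK.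
  - by move=> u w; rewrite rdotDl.
  - by move=> t u; rewrite rdotZl.
  - by move=> u; rewrite mulrC; exact: rdot_le.
  by move=> w Kw h; exists w.
have Pdot u v : K u -> dot u (P v) = dot u v.
  move=> Ku; rewrite !dot_rdot; have [_ h] := HP v; congr Complex; apply/esym/h => //.
  by rewrite -[_ *: _]addr0; exact: KL.
have Puniq w v : K w -> (forall u, K u -> dot u w = dot u v) -> P v = w.
  move=> Kw wv; have [KP _] := HP v; apply/eqP; rewrite -subr_eq0; apply/eqP.
  apply: L2norm_eq0; apply/eqP; rewrite -sqrf_eq0 L2norm_sq.
  have KPw : K (P v - w) by rewrite addrC -scaleN1r; exact: KL.
  by rewrite dotBr Pdot // wv // subrr.
exists P; split=> //.
- split=> [k u v|]; first apply: Puniq => [|w Kw].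
  + by apply: KL; case: (HP u) (HP v) => ? _ [].
  + by rewrite !dotDr !dotZr !Pdot.
  + exists 1 => v; rewrite mul1r; have := L2norm_ge0 (P v).
    rewrite le_eqVlt => /predU1P[<-|p0]; first exact: L2norm_ge0.
    rewrite -(ler_pM2l p0) -expr2 L2norm_rdot /rdot Pdot; first exact: rdot_le.
    by case: (HP v).
- by move=> u; case: (HP u).
- by move=> u Ku; apply: Puniq.
Qed.

(** The residue [u - P u] is orthogonal to [K]. The density arguments for indicators rest on this
    criterion. *)
Lemma closed_subspace_full K : closed_subspace K ->
  (forall z, (forall u, K u -> dot u z = 0) -> z = 0) -> forall u, K u.
Proof.
move=> cK Korth u; have [P [_ KP _ Pdot]] := projection cK.
suff -> : u = P u by [].
apply/eqP; rewrite -subr_eq0; apply/eqP; apply: Korth => v Kv.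
by rewrite dotBr Pdot // subrr.
Qed.

(* The orthogonal projection onto [K] commutes with [S]. *)
Lemma vN_generated_invariant S K : S `<=` BH -> closed_subspace K ->
  (forall a u, S a -> K u -> K (a u)) ->
  (forall a u, S a -> K u -> K (adj a u)) ->
  forall x u, vN_generated S x -> K u -> K (x u).
Proof.
move=> Sb cK SK SaK x u Sx Ku; have [P [bP KP Pid Pdot]] := projection cK.
have adjP_P : adj P = P.
  by apply: adj_unique => // v w; rewrite -(Pdot _ _ (KP v)) dotC Pdot // -dotC.
have : commutant [set P] x.
  move: x Sx; apply: vN_generated_min.
    by apply: vN_commutant => [_ ->|_ ->]; rewrite ?adjP_P.
  move=> a Sa; have ba := Sb _ Sa; split=> // _ ->; apply/funext => v /=.
  apply/eqP; rewrite -subr_eq0; apply/eqP; apply: L2norm_eq0; apply/eqP.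
  rewrite -sqrf_eq0 L2norm_sq; set z := _ - _.
  have Kz : K z.
    have [_ KL _] := cK; rewrite /z addrC -scaleN1r; apply: KL => //; exact: SK.
  rewrite {2}/z dotBr Pdot // (adjPr ba) Pdot; last exact: SaK.
  by rewrite (adjPr ba) subrr.
by move=> [_ /(_ P erefl)/(congr1 (@^~ u))] /=; rewrite (Pid _ Ku) => ->.
Qed.

Lemma unitary_op_inv a b : bounded_op a -> bounded_op b ->
  (forall u v, dot (a u) v = dot u (b v)) -> a \o b = id -> b \o a = id ->
  unitary_op a /\ adj a = b.
Proof.
by move=> ba bb ab abK baK; have E := adj_unique bb ab; split=> //; split; rewrite ?E.
Qed.

Lemma unitary_dot a u v : unitary_op a -> dot (a u) (a v) = dot u v.
Proof. by case=> ba aK _; rewrite (adjP ba) -[adj a (a v)]/((adj a \o a) v) aK. Qed.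

Lemma unitary_norm a u : unitary_op a -> L2norm (a u) = L2norm u.
Proof. by move=> ua; rewrite /L2norm unitary_dot. Qed.

Lemma unitary_adj a : unitary_op a -> unitary_op (adj a).
Proof.
by case=> ba aK Ka; split; rewrite ?(adjK ba) //; exact: adj_bounded.
Qed.

(** Here [w] merely normalises [M]. This covers a strong limit of the operators 1 (x) u_(s_k), about
    which membership in [R_T] is not asserted. *)
Lemma vN_aut_Ad M (w : H -> H) : von_neumann M -> unitary_op w ->
  (forall a, M a -> M (w \o a \o adj w)) ->
  (forall a, M a -> M (adj w \o a \o w)) ->
  vN_aut M (fun a => w \o a \o adj w).
Proof.
move=> vM [bw wK Kw] Mw Mw'; have Mb := vN_sub_bounded vM.
have K1 u : adj w (w u) = u by rewrite -[LHS]/((adj w \o w) u) wK.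
have K2 u : w (adj w u) = u by rewrite -[LHS]/((w \o adj w) u) Kw.
split.
- split=> [a Ma|a b _ _ ab|b Mb'].
  + exact: Mw.
  + apply/funext => u; have /(congr1 (@^~ (w u)))/= := ab; rewrite K1 => /(congr1 (adj w)).
    by rewrite !K1.
  + exists (adj w \o b \o w); first exact: Mw'.
    by apply/funext => u /=; rewrite !K2.
- move=> z a b _ _; apply/funext => u; exact: (bounded_op_lin bw).
- by move=> a b _ _; apply/funext => u /=; rewrite K1.
- move=> a Ma; have ba := Mb _ Ma; have bw' := adj_bounded w.
  rewrite (adj_comp (bounded_comp bw ba) bw') (adj_comp bw ba) (adjK bw).
  by rewrite compA.
Qed.

Lemma vN_aut_Ad_mem M (w : H -> H) : von_neumann M -> M w -> unitary_op w ->
  vN_aut M (fun a => w \o a \o adj w).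
Proof.
move=> vM Mw uw; have Mw' := vN_adj vM Mw; apply: vN_aut_Ad => // a Ma;
  by do 2!apply: vN_comp => //.
Qed.

End Geometry.

(** * Composition and multiplication operators *)

Section FunctionOperators.
Context d (T : measurableType d) (R : realType).
Variable nu : {measure set T -> \bar R}.
Local Notation H := (L2 nu).
Implicit Types (u v w : H) (phi psi : T -> T) (m : T -> R[i]).

Definition measure_preserving phi := measurable_fun setT phi /\
  forall A, measurable A -> nu (phi @^-1` A) = nu A.

Definition comp_op phi : H -> H := fun u => to_L2 nu (fun x => u (phi x)).

Lemma ae_comp phi (P : T -> Prop) : measure_preserving phi ->
  {ae nu, forall x, P x} -> {ae nu, forall x, P (phi x)}.
Proof.
move=> [mphi nuphi] [A [mA A0 PA]]; exists (phi @^-1` A); split.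
- by rewrite -[_ @^-1` _]setTI; exact: mphi.
- by rewrite nuphi.
- by move=> x /= Px; exact: PA.
Qed.

Lemma cmeas_comp phi m : measurable_fun setT phi -> cmeas m -> cmeas (fun x => m (phi x)).
Proof.
move=> mphi [mr mi]; split.
  exact: (measurableT_comp mr mphi).
exact: (measurableT_comp mi mphi).
Qed.

Lemma sqnorm_comp phi m : measure_preserving phi -> cmeas m ->
  sqnorm nu (fun x => m (phi x)) = sqnorm nu m.
Proof.
move=> [mphi nuphi] mm; rewrite /sqnorm.
have E : (\int[pushforward nu phi]_x (nsq (m x))%:E = \int[nu]_x (nsq (m (phi x)))%:E)%E.
  apply: (ge0_integral_pushforward mphi nu measurableT).
  - by apply/measurable_EFinP; exact: cmeas_nsq.
  - by move=> x _; rewrite lee_fin nsq_ge0.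
rewrite -E; apply: eq_measure_integral => A mA _; exact: nuphi.
Qed.

Lemma sqint_comp phi m : measure_preserving phi -> m \in sqint nu ->
  (fun x => m (phi x)) \in sqint nu.
Proof.
move=> mp /sqintP[mm my]; apply/sqintP; split; first by apply: cmeas_comp => //; case: mp.
by rewrite sqnorm_comp.
Qed.

Lemma comp_op_ae phi u : measure_preserving phi ->
  {ae nu, forall x, comp_op phi u x = u (phi x)}.
Proof. by move=> mp; apply: to_L2_ae; apply: sqint_comp => //; exact: L2_sqint. Qed.

Lemma comp_op_linear phi : measure_preserving phi -> linear (comp_op phi).
Proof.
move=> mp k u v; apply/L2_eqP.
have h1 := comp_op_ae (k *: u + v) mp.
have h2 := ae_comp mp (L2D_ae (k *: u) v); have h3 := ae_comp mp (L2Z_ae k u).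
have h4 := L2D_ae (k *: comp_op phi u) (comp_op phi v).
have h5 := L2Z_ae k (comp_op phi u).
have h6 := comp_op_ae u mp; have h7 := comp_op_ae v mp.
apply: filterS3 (filterI h1 h2) (filterI h3 h4) (filterI h5 (filterI h6 h7)).
by move=> x [e1 e2] [e3 e4] [e5 [e6 e7]]; rewrite e1 e2 e3 e4 e5 e6 e7.
Qed.

Lemma comp_op_norm phi u : measure_preserving phi -> L2norm (comp_op phi u) = L2norm u.
Proof.
move=> mp; apply/eqP; rewrite -(@eqrXn2 _ 2) ?L2norm_ge0 //; apply/eqP/EFin_inj.
rewrite !L2norm_sqnorm -(sqnorm_comp mp (L2_cmeas u)).
by apply: sqnorm_ae (comp_op_ae u mp); [exact: L2_cmeas|apply: cmeas_comp (L2_cmeas u); case: mp].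
Qed.

Lemma comp_op_bounded phi : measure_preserving phi -> bounded_op (comp_op phi).
Proof.
move=> mp; split; first exact: comp_op_linear.
by exists 1 => u; rewrite mul1r comp_op_norm.
Qed.

Lemma comp_op_comp phi psi u : measure_preserving phi -> measure_preserving psi ->
  comp_op phi (comp_op psi u) = comp_op (psi \o phi) u.
Proof.
move=> mphi mpsi; apply: to_L2_eq.
- by apply: sqint_comp => //; exact: L2_sqint.
- case: mphi mpsi => mphi _ [mpsi _].
  exact: (cmeas_comp (measurableT_comp mpsi mphi) (L2_cmeas u)).
exact: ae_comp mphi (comp_op_ae u mpsi).
Qed.

Lemma comp_op_id u : comp_op id u = u.
Proof. exact: to_L2K. Qed.

Lemma comp_op_dot phi u v : measure_preserving phi ->
  dot (comp_op phi u) (comp_op phi v) = dot u v.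
Proof.
move=> mp; rewrite dot_to_L2; try by apply: sqint_comp => //; exact: L2_sqint.
case: (mp) => mphi nuphi; rewrite (@cint_comp _ _ _ _ phi (fun x => u x * conjc (v x))) //.
exact: sqint_cintegrable (L2_sqint _) (L2_sqint _).
Qed.

Lemma comp_op_adj phi psi : measure_preserving phi -> measure_preserving psi ->
  psi \o phi = id -> adj (comp_op phi) = comp_op psi.
Proof.
move=> mphi mpsi K; apply: adj_unique; first exact: comp_op_bounded.
move=> u v; rewrite -[in LHS](comp_op_id v) -K -comp_op_comp //.
exact: comp_op_dot.
Qed.

Definition mul_op m : H -> H := fun u => to_L2 nu (fun x => m x * u x).

Definition ess_bounded m (C : R) :=
  [/\ cmeas m, 0 <= C & {ae nu, forall x, nsq (m x) <= C}].

Lemma mul_sqint m C u : ess_bounded m C -> (fun x => m x * u x) \in sqint nu /\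
  (sqnorm nu (fun x => m x * u x)%R <= C%:E * sqnorm nu u)%E.
Proof.
move=> [mm C0 mC]; apply: sqint_dom => //.
- exact: cmeasM (L2_cmeas u).
- exact: L2_sqint.
- by apply: filterS mC => x mC; rewrite nsqM ler_wpM2r ?nsq_ge0.
Qed.

Lemma mul_op_ae m C u : ess_bounded m C ->
  {ae nu, forall x, mul_op m u x = m x * u x}.
Proof. by move=> mb; apply: to_L2_ae; case: (mul_sqint u mb). Qed.

Lemma mul_op_linear m C : ess_bounded m C -> linear (mul_op m).
Proof.
move=> mb k u v; apply/L2_eqP.
have h1 := mul_op_ae (k *: u + v) mb.
have h2 := L2D_ae (k *: u) v; have h3 := L2Z_ae k u.
have h4 := L2D_ae (k *: mul_op m u) (mul_op m v).
have h5 := L2Z_ae k (mul_op m u).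
have h6 := mul_op_ae u mb; have h7 := mul_op_ae v mb.
apply: filterS3 (filterI h1 h2) (filterI h3 h4) (filterI h5 (filterI h6 h7)).
move=> x [e1 e2] [e3 e4] [e5 [e6 e7]]; rewrite e1 e2 e3 e4 e5 e6 e7.
by rewrite mulrDr mulrCA.
Qed.

Lemma mul_op_norm m C u : ess_bounded m C -> L2norm (mul_op m u) ^+ 2 <= C * L2norm u ^+ 2.
Proof.
move=> mb; rewrite -lee_fin (EFinM C) !L2norm_sqnorm; have [s h] := mul_sqint u mb.
rewrite (_ : sqnorm nu (mul_op m u) = sqnorm nu (fun x => m x * u x)%R) //.
apply: sqnorm_ae (mul_op_ae u mb); first exact: L2_cmeas.
by case: mb => mm _ _; exact: cmeasM (L2_cmeas u).
Qed.

Lemma mul_op_bounded m C : ess_bounded m C -> bounded_op (mul_op m).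
Proof.
move=> mb; split; first exact: mul_op_linear mb.
have C0 : 0 <= C by case: mb.
exists (Num.sqrt C) => u; rewrite -(@ler_pXn2r _ 2) ?nnegrE ?mulr_ge0 ?L2norm_ge0 ?sqrtr_ge0 //.
by rewrite exprMn (sqr_sqrtr C0); exact: mul_op_norm.
Qed.

Lemma ess_bounded_conj m C : ess_bounded m C -> ess_bounded (fun x => conjc (m x)) C.
Proof.
move=> [mm C0 mC]; split=> //; first exact: cmeas_conj.
by apply: filterS mC => x; rewrite nsqC.
Qed.

Lemma mul_op_adj m C : ess_bounded m C -> adj (mul_op m) = mul_op (fun x => conjc (m x)).
Proof.
move=> mb; have mb' := ess_bounded_conj mb.
apply: adj_unique; first exact: mul_op_bounded mb'.
move=> u v; apply: cint_ae.
- exact: cmeas_dot.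
- exact: cmeas_dot.
have h1 := mul_op_ae u mb; have h2 := mul_op_ae v mb'.
apply: filterS2 h1 h2 => x -> ->.
by rewrite rmorphM /= conjcK mulrCA mulrA.
Qed.

Lemma mul_op_mul m C m' C' u : ess_bounded m C -> ess_bounded m' C' ->
  mul_op m (mul_op m' u) = mul_op (fun x => m x * m' x) u.
Proof.
move=> mb mb'; apply: to_L2_eq.
- by case: (mul_sqint (mul_op m' u) mb).
- case: mb mb' => mm _ _ [mm' _ _].
  by apply: cmeasM; [exact: cmeasM|exact: L2_cmeas].
have h := mul_op_ae u mb'; apply: filterS h => x ->; exact: mulrA.
Qed.

Lemma mul_op_comm m C m' C' u : ess_bounded m C -> ess_bounded m' C' ->
  mul_op m (mul_op m' u) = mul_op m' (mul_op m u).
Proof.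
move=> mb mb'; rewrite (mul_op_mul _ mb mb') (mul_op_mul _ mb' mb).
by congr (mul_op _ u); apply/funext => x; rewrite mulrC.
Qed.

Lemma comp_mul_op phi m C u : measure_preserving phi -> ess_bounded m C ->
  comp_op phi (mul_op m u) = mul_op (fun x => m (phi x)) (comp_op phi u).
Proof.
move=> mp mb; apply: to_L2_eq.
- by apply: sqint_comp => //; exact: L2_sqint.
- apply: cmeasM (L2_cmeas _); apply: cmeas_comp; first by case: mp.
  by case: mb.
have h1 := ae_comp mp (mul_op_ae u mb); have h2 := comp_op_ae u mp.
by apply: filterS2 h1 h2 => x -> ->.
Qed.

Definition ind (E : set T) : T -> R[i] := fun x => (x \in E)%:R.

Definition indv (E : set T) : H := to_L2 nu (ind E).

Lemma indE E x : ind E x = (\1_E x)%:C%C.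
Proof. by rewrite /ind indicE; case: (x \in E). Qed.

Lemma cmeas_ind E : measurable E -> cmeas (ind E).
Proof.
move=> mE; split.
  by rewrite (_ : (fun x => _) = \1_E) //; apply/funext => x; rewrite indE.
by rewrite (_ : (fun x => _) = cst 0) //; apply/funext => x; rewrite indE.
Qed.

Lemma nsq_ind E x : nsq (ind E x) = \1_E x.
Proof.
rewrite indE /nsq /= expr0n addr0 indicE.
by case: (x \in E); rewrite /= ?expr1n ?expr0n.
Qed.

Lemma ess_bounded_ind E : measurable E -> ess_bounded (ind E) 1.
Proof.
move=> mE; split=> //; first exact: cmeas_ind.
by apply: aeW => x; rewrite nsq_ind indicE; case: (x \in E).
Qed.

Lemma sqnorm_ind E : measurable E -> sqnorm nu (ind E) = nu E.
Proof.
move=> mE; rewrite /sqnorm; under eq_integral => x _ do rewrite nsq_ind.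
by rewrite integral_indic // setIT.
Qed.

Lemma sqint_ind E : measurable E -> (nu E < +oo)%E -> ind E \in sqint nu.
Proof.
move=> mE fE; apply/sqintP; split; first exact: cmeas_ind.
by rewrite sqnorm_ind.
Qed.

Lemma indv_ae E : measurable E -> (nu E < +oo)%E -> {ae nu, forall x, indv E x = ind E x}.
Proof. by move=> mE fE; apply: to_L2_ae; exact: sqint_ind. Qed.

Lemma comp_op_indv phi E : measure_preserving phi -> measurable E -> (nu E < +oo)%E ->
  comp_op phi (indv E) = indv (phi @^-1` E).
Proof.
move=> mp mE fE; have [mphi nuphi] := mp.
have mE' : measurable (phi @^-1` E) by rewrite -[_ @^-1` _]setTI; exact: mphi.
apply: to_L2_eq; [by apply: sqint_comp => //; exact: L2_sqint|exact: cmeas_ind|].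
exact: (ae_comp mp (indv_ae mE fE)).
Qed.

Lemma mul_op_indv m C E : ess_bounded m C -> measurable E -> (nu E < +oo)%E ->
  mul_op m (indv E) = to_L2 nu (fun x => m x * ind E x).
Proof.
move=> mb mE fE; apply: to_L2_eq.
- by case: (mul_sqint (indv E) mb).
- by apply: cmeasM (cmeas_ind mE); case: mb.
by apply: filterS (indv_ae mE fE) => x ->.
Qed.

Lemma mul_ind_indv E F : measurable E -> measurable F -> (nu F < +oo)%E ->
  mul_op (ind E) (indv F) = indv (E `&` F).
Proof.
move=> mE mF fF; rewrite (mul_op_indv (ess_bounded_ind mE)) //.
congr to_L2; apply/funext => x; rewrite /ind in_setI.
by case: (x \in E) (x \in F) => [] []; rewrite ?mul1r ?mul0r.
Qed.

Lemma dot_indv u E : measurable E -> (nu E < +oo)%E ->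
  dot u (indv E) = Complex (\int[nu]_(x in E) CRe (u x)) (\int[nu]_(x in E) CIm (u x)).
Proof.
move=> mE fE; have h := indv_ae mE fE; have p0 : point = 0 :> R by [].
rewrite -[dot _ _]/(cint nu _) (@cint_ae _ _ _ _ _ (fun x => u x * ind E x)).
- rewrite /cint !(@Rintegral_mkcond _ _ _ _ E); congr Complex; apply: eq_Rintegral => x _;
  by rewrite patchE indE indicE; case: (u x) => a b; case: (x \in E) => /=; rewrite ?p0; ring.
- exact: cmeas_dot.
- exact: cmeasM (L2_cmeas u) (cmeas_ind mE).
- apply: filterS h => x ->; rewrite indE; congr (_ * _).
  by rewrite /= oppr0.
Qed.

Lemma integrable_on u E : measurable E -> (nu E < +oo)%E ->
  nu.-integrable E (EFin \o (fun x => CRe (u x))) /\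
  nu.-integrable E (EFin \o (fun x => CIm (u x))).
Proof.
move=> mE fE; have [hr hi] := sqint_cintegrable (L2_sqint u) (sqint_ind mE fE).
have p0 : point = 0%:E :> \bar R by [].
split; apply/(integrable_mkcond _ mE).
  move: hr; congr integrable; apply/funext => x /=; rewrite patchE indE indicE /= p0.
  by case: (u x) => a b /=; case: (x \in E) => /=; congr EFin; ring.
move: hi; congr integrable; apply/funext => x /=; rewrite patchE indE indicE /= p0.
by case: (u x) => a b /=; case: (x \in E) => /=; congr EFin; ring.
Qed.

(** Integrals over all measurable subsets determine an integrable function almost everywhere; this
    is applied to real and imaginary parts on [D], where finite measure makes [u] integrable. *)
Lemma L2_cst_on u D (z : R[i]) : measurable D -> (nu D < +oo)%E ->
  (forall E, measurable E -> E `<=` D -> dot u (indv E) = z * (fine (nu E))%:C%C) ->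
  {ae nu, forall x, D x -> u x = z}.
Proof.
move=> mD fD h; have [Ir Ii] := integrable_on u mD fD.
have fin E : measurable E -> E `<=` D -> (nu E < +oo)%E.
  by move=> mE ED; apply: le_lt_trans fD; apply: le_measure; rewrite ?inE.
have key E : measurable E -> E `<=` D ->
    \int[nu]_(x in E) CRe (u x) = CRe z * fine (nu E) /\
    \int[nu]_(x in E) CIm (u x) = CIm z * fine (nu E).
  move=> mE ED; have := h E mE ED; rewrite (dot_indv u mE (fin E mE ED)).
  by case: (z) => a b [-> ->] /=; split; ring.
have ae (f : T -> R) c : nu.-integrable D (EFin \o f) ->
    (forall E, measurable E -> E `<=` D -> \int[nu]_(x in E) f x = c * fine (nu E)) ->
    {ae nu, forall x, D x -> f x = c}.
  move=> If hf.
  have prem E : E `<=` D -> measurable E ->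
      (\int[nu]_(x in E) (EFin \o f) x = \int[nu]_(x in E) cst c%:E x)%E.
    move=> ED mE; have nuE : nu E \is a fin_num by rewrite ge0_fin_numE ?fin.
    rewrite integral_cst // -(fineK nuE) -EFinM -hf // /Rintegral fineK //.
    apply: integrable_fin_num => //; exact: integrableS mE ED If.
  have := integral_ae_eq mD If (measurable_cst _) prem.
  by apply: filterS => x h1 /h1 [].
have h1 := ae _ _ Ir (fun E mE ED => (key E mE ED).1).
have h2 := ae _ _ Ii (fun E mE ED => (key E mE ED).2).
apply: filterS2 h1 h2 => x h1 h2 Dx; move: (h1 Dx) (h2 Dx).
by case: (u x) (z) => [a b] [c e] /= -> ->.
Qed.

Lemma ae_countable (I : countType) (P : I -> T -> Prop) :
  (forall i, {ae nu, forall x, P i x}) -> {ae nu, forall x, forall i, P i x}.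
Proof.
move=> h; pose F n := if unpickle n is Some i then ~` [set x | P i x] else set0.
have : nu.-negligible (\bigcup_n F n).
  apply: negligible_bigcup => n; rewrite /F; case: (unpickle n) => [i|].
    exact: (h i).
  exact: negligible_set0.
apply: negligibleS => x /= /existsNP[i nP]; exists (pickle i) => //.
by rewrite /F pickleK.
Qed.

(* [K] is dense, hence everything, as a vector orthogonal to the indicators
   vanishes almost everywhere. *)
Lemma indv_dense (I : countType) (D : I -> set T) (K : set H) :
  (forall i, measurable (D i)) -> (forall i, (nu (D i) < +oo)%E) ->
  (forall x, exists i, D i x) -> closed_subspace K ->
  (forall i E, measurable E -> E `<=` D i -> K (indv E)) -> forall u, K u.
Proof.
move=> mD fD Dcover cK KE; apply: closed_subspace_full => // z Kz.
have h : {ae nu, forall x, forall i, D i x -> z x = 0}.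
  apply: ae_countable => i; apply: L2_cst_on => // E mE EDi.
  by rewrite mul0r dotC Kz ?rmorph0 //; exact: KE EDi.
apply/L2_eqP; apply: filterS2 h (L20_ae nu) => x h ->.
by have [i Di] := Dcover x; exact: h Di.
Qed.

Lemma indv_norm E : measurable E -> (nu E < +oo)%E -> (L2norm (indv E) ^+ 2)%:E = nu E.
Proof.
move=> mE fE; rewrite L2norm_sqnorm -(sqnorm_ind mE).
by apply: sqnorm_ae (indv_ae mE fE); [exact: L2_cmeas|exact: cmeas_ind].
Qed.

Lemma indvB_norm E F : measurable E -> measurable F -> (nu E < +oo)%E -> (nu F < +oo)%E ->
  (L2norm (indv E - indv F) ^+ 2)%:E = (nu (E `\` F) + nu (F `\` E))%E.
Proof.
move=> mE mF fE fF; rewrite L2norm_sqnorm.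
have mEF : measurable (E `\` F) by exact: measurableD.
have mFE : measurable (F `\` E) by exact: measurableD.
have FE0 : (E `\` F) `&` (F `\` E) = set0.
  by apply/seteqP; split=> // x [[_ nF] [/nF]].
rewrite -measureU //.
transitivity (sqnorm nu (ind (E `\` F `|` F `\` E))); last first.
  by apply: sqnorm_ind; exact: measurableU.
transitivity (sqnorm nu (fun x => ind E x + (fun=> -1) x * ind F x)).
  apply: sqnorm_ae; first exact: L2_cmeas.
    exact: cmeasD (cmeas_ind mE) (cmeasM (cmeas_cst _ _) (cmeas_ind mF)).
  apply: filterS3 (L2B_ae (indv E) (indv F)) (indv_ae mE fE) (indv_ae mF fF).
  by move=> x -> -> ->; rewrite mulN1r.
apply: eq_integral => x _; congr EFin; rewrite nsq_ind !indE !indicE in_setU !in_setD.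
by case: (x \in E) (x \in F) => [] []; rewrite /nsq /=; ring.
Qed.

End FunctionOperators.

(** * Weak topology on the acting group *)

Section Displacement.
Context d (X : measurableType d) (R : realType) (mu : probability X R).
Variables (G : countZmodType) (T : G -> X -> X).
Hypothesis HT : mp_action mu T.
Implicit Types (g h : G) (A B : set X).

Lemma mp_action_0 x : T 0 x = x. Proof. by case: HT. Qed.

Lemma mp_action_D g h x : T (g + h) x = T g (T h x). Proof. by case: HT => _ + _ _; apply. Qed.

Lemma mp_actionK g x : T (- g) (T g x) = x.
Proof. by rewrite -mp_action_D addNr mp_action_0. Qed.

Lemma mp_actionVK g x : T g (T (- g) x) = x.
Proof. by rewrite -mp_action_D subrr mp_action_0. Qed.

Lemma mp_action_mp g : measure_preserving mu (T g).
Proof. by case: HT => _ _ mT muT; split=> [|A]; [exact: mT|exact: muT]. Qed.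

Lemma measurable_action g A : measurable A -> measurable (T g @^-1` A).
Proof. by move=> mA; rewrite -[_ @^-1` _]setTI; have [+ _] := mp_action_mp g; apply. Qed.

Lemma prob_fin A : measurable A -> mu A \is a fin_num.
Proof. by move=> mA; rewrite fin_num_measure. Qed.

Lemma prob_lty A : measurable A -> (mu A < +oo)%E.
Proof. by move=> mA; rewrite ltey_eq prob_fin. Qed.

Definition pr A : R := fine (mu A).

Lemma pr_EFin A : measurable A -> (pr A)%:E = mu A.
Proof. by move=> mA; rewrite fineK // prob_fin. Qed.

Lemma pr_ge0 A : 0 <= pr A. Proof. exact: fine_ge0. Qed.

Lemma pr_le A B : measurable A -> measurable B -> A `<=` B -> pr A <= pr B.
Proof. by move=> mA mB AB; rewrite -lee_fin !pr_EFin //; apply: le_measure; rewrite ?inE. Qed.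

Lemma pr_le1 A : measurable A -> pr A <= 1.
Proof. by move=> mA; rewrite -lee_fin pr_EFin // probability_le1. Qed.

Lemma prU A B : measurable A -> measurable B -> pr (A `|` B) <= pr A + pr B.
Proof.
move=> mA mB; rewrite -lee_fin EFinD !pr_EFin //; last exact: measurableU.
exact: measureU2.
Qed.

Lemma prT g A : measurable A -> pr (T g @^-1` A) = pr A.
Proof. by move=> mA; rewrite /pr; have [_ ->] := mp_action_mp g. Qed.

Lemma prD A B : measurable A -> measurable B -> pr (A `\` B) = pr A - pr (A `&` B).
Proof.
move=> mA mB; apply: EFin_inj; rewrite EFinB !pr_EFin //; try exact: measurableI;
  try exact: measurableD.
by rewrite measureD // prob_lty.
Qed.

(* mu(A \ T_g^{-1} A), half the measure of the symmetric difference *)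
Definition disp g A : R := pr (A `\` T g @^-1` A).

Lemma disp_ge0 g A : 0 <= disp g A. Proof. exact: pr_ge0. Qed.

Lemma disp_le1 g A : measurable A -> disp g A <= 1.
Proof. by move=> mA; apply: pr_le1; apply: measurableD => //; exact: measurable_action. Qed.

Lemma disp_sym g A : measurable A -> pr (T g @^-1` A `\` A) = disp g A.
Proof.
move=> mA; have mgA := measurable_action g mA.
by rewrite /disp !prD // prT // setIC.
Qed.

Lemma dispN g A : measurable A -> disp (- g) A = disp g A.
Proof.
move=> mA; have mgA := measurable_action (- g) mA.
rewrite -[RHS]disp_sym // /disp -(prT g); last exact: measurableD.
congr (pr _); apply/seteqP; split=> x /= [h1 h2]; split=> //.
  by rewrite mp_actionK in h2.
by rewrite mp_actionK.
Qed.

(** A point that leaves [A] under g + h either leaves it under h, or is still in [A] after T_h and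
    leaves it under g. *)
Lemma dispD g h A : measurable A -> disp (g + h) A <= disp g A + disp h A.
Proof.
move=> mA; have mgA := measurable_action g mA; have mhA := measurable_action h mA.
rewrite -[disp g A]/(pr (A `\` T g @^-1` A)) -(prT h (measurableD mA mgA)).
have m1 : measurable (T h @^-1` (A `\` T g @^-1` A)).
  by apply: measurable_action; exact: measurableD.
have m2 : measurable (A `\` T h @^-1` A) by exact: measurableD.
apply: le_trans (prU m1 m2); apply: pr_le; last 1 first.
- move=> x; rewrite /= mp_action_D => -[Ax nA].
  by have [Ahx|nAhx] := pselect (A (T h x)); [left|right].
- by apply: measurableD => //; exact: measurable_action.
- exact: measurableU.
Qed.

Lemma dispC g A : measurable A -> disp g (~` A) = disp g A.
Proof.
move=> mA; rewrite -[RHS]disp_sym //; congr (pr _).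
apply/seteqP; split=> x /= [h1 h2]; split=> //.
exact: contrapT.
Qed.

Lemma dispU g A B : measurable A -> measurable B -> disp g (A `|` B) <= disp g A + disp g B.
Proof.
move=> mA mB; have mgA := measurable_action g mA; have mgB := measurable_action g mB.
apply: le_trans (prU _ _); [|exact: measurableD..].
apply: pr_le.
- apply: measurableD; first exact: measurableU.
  by apply: measurable_action; exact: measurableU.
- by apply: measurableU; exact: measurableD.
- move=> x /= [[Ax|Bx] nAB]; [left|right]; split=> // h; apply: nAB; [left|right]; exact: h.
Qed.

(** A point leaving [A] lies in A \ B, or leaves [B], or is sent into B \ A. The error terms do not
    depend on g. *)
Lemma disp_approx g A B : measurable A -> measurable B ->
  disp g A <= disp g B + (pr (A `\` B) + pr (B `\` A)).
Proof.
move=> mA mB; have mgA := measurable_action g mA; have mgB := measurable_action g mB.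
rewrite -(prT g (measurableD mB mA)).
have mBA : measurable (T g @^-1` (B `\` A)) by apply: measurable_action; exact: measurableD.
have mAB : measurable (A `\` B) by exact: measurableD.
have mBB : measurable (B `\` T g @^-1` B) by exact: measurableD.
apply: (@le_trans _ _ (pr (B `\` T g @^-1` B `|` (A `\` B `|` T g @^-1` (B `\` A))))).
  apply: pr_le; [exact: measurableD|by do 2?apply: measurableU|].
  move=> x /= [Ax nAx]; have [Bx|nBx] := pselect (B x); last by right; left.
  by have [Bgx|nBgx] := pselect (B (T g x)); [right; right|left].
apply: le_trans (prU mBB (measurableU _ _ mAB mBA)) _.
by rewrite lerD2l prU.
Qed.

(** Indexed by a filter, so that it covers sequences as well as the differences s_m - s_n along a
    product filter. *)
Definition asymp_invariant (I : Type) (F : set_system I) (g : I -> G) A : Prop :=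
  measurable A /\ forall e : R, 0 < e -> \forall i \near F, disp (g i) A <= e.

(** Complements have the same displacement, and finite unions at most the sum. A countable union is
    approximated from inside by finite ones, at a cost that is uniform in the group element. *)
Lemma asymp_invariant_sigma (I : Type) (F : set_system I) {FF : Filter F} (g : I -> G) :
  sigma_algebra setT (asymp_invariant F g).
Proof.
split.
- split=> // e e0; apply: nearW => i; rewrite /disp set0D /pr measure0; exact: ltW.
- move=> A [mA Ah]; rewrite setTD; split; first exact: measurableC.
  by move=> e e0; apply: filterS (Ah _ e0) => i; rewrite dispC.
- move=> A hA; have mA n : measurable (A n) by case: (hA n).
  have mU : measurable (\bigcup_n A n) by exact: bigcupT_measurable.
  pose B n := \big[setU/set0]_(k < n) A k.
  have BE n : B n = \bigcup_(k < n) A k by rewrite bigcup_mkord.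
  have mB n : measurable (B n) by apply: bigsetU_measurable.
  have hB n e : 0 < e -> \forall i \near F, disp (g i) (B n) <= e.
    elim: n e => [|n IH] e e0.
      by apply: nearW => i; rewrite /B big_ord0 /disp set0D /pr measure0 ltW.
    have e2 : 0 < e / 2 by rewrite divr_gt0.
    have [_ /(_ _ e2)] := hA n; apply: filterS2 (IH _ e2) => i h1 h2.
    rewrite /B big_ord_recr /=; apply: le_trans (dispU _ (mB n) (mA n)) _.
    by rewrite (splitr e) lerD.
  have BA n : B n `<=` \bigcup_n A n by rewrite BE; apply: bigcup_sub => k _ x Ax; exists k.
  have : (mu \o (fun n => \bigcup_n A n `\` B n)) @ \oo --> (0 : \bar R)%E.
    have <- : mu (\bigcap_n (\bigcup_k A k `\` B n)) = 0%E.
      rewrite (_ : \bigcap_n _ = set0) ?measure0 //; apply/seteqP; split=> // x h.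
      have [[k _ Ax] _] := h 0%N Logic.I; have [_] := h k.+1 Logic.I; apply.
      by rewrite BE; exists k => //=.
    apply: nonincreasing_cvg_mu => //.
    - by rewrite prob_lty //; exact: measurableD.
    - by move=> n; exact: measurableD.
    - by apply: bigcapT_measurable => n; exact: measurableD.
    - move=> m n mn; apply/subsetPset; apply: setDS; rewrite !BE => x [k km Ax].
      by exists k => //=; exact: leq_trans mn.
  move=> /fine_cvg mu0; split=> // e e0; have e2 : 0 < e / 2 by rewrite divr_gt0.
  have [n _ /(_ n (leqnn n))] := (cvg0P (fun n => pr_ge0 _)).1 mu0 _ e2.
  rewrite /= -/(pr _) => hn.
  apply: filterS (hB n _ e2) => i hi.
  have BA0 : B n `\` \bigcup_n A n = set0 by apply/seteqP; split=> // x [/BA].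
  apply: le_trans (disp_approx _ mU (mB n)) _.
  by rewrite BA0 [pr set0]/pr measure0 addr0 (splitr e) lerD.
Qed.

End Displacement.

(** * Countable generation of standard probability spaces *)

Section Standard.
Context d (X : measurableType d) (R : realType) (mu : probability X R).

(** Phrased for good-set arguments: a sigma-algebra of measurable sets that is stable under null
    modifications and contains the [A i] contains everything. The null modifications accommodate the
    completion of a Borel sigma-algebra. *)
Definition generates_mod0 (A : nat -> set X) : Prop :=
  forall C : set (set X), sigma_algebra setT C -> C `<=` measurable ->
    (forall E F, measurable E -> C F -> mu (E `\` F) = 0%E -> mu (F `\` E) = 0%E -> C E) ->
    (forall i, C (A i)) -> measurable `<=` C.

Definition separates_mod0 (A : nat -> set X) : Prop :=
  exists X0, [/\ measurable X0, mu X0 = 1%E &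
    forall x y, X0 x -> X0 y -> (forall i, A i x <-> A i y) -> x = y].

Lemma mu_full_setC X0 : measurable X0 -> mu X0 = 1%E -> mu (~` X0) = 0%E.
Proof. by move=> mX0 X01; rewrite probability_setC // X01 subee. Qed.

(** The [A n] are preimages of a countable base. The Hausdorff property separates points of [X0]; a
    measurable set lies, up to null sets, between preimages of two Borel sets, and such preimages
    belong to every admissible class containing the [A n]. *)
Lemma standard_countably_generated : standard_probability mu ->
  exists A : nat -> set X, [/\ forall i, measurable (A i), separates_mod0 A & generates_mod0 A].
Proof.
move=> [Y [X0 [f [[hY [Bs /countable_injP[e einj] [Bo Bnb]]] [mX0 X01] [_ finj fsurj] mf rf]]]].
(* [e] injects the base into the natural numbers; codes outside its range receive the empty set. *)
pose U n := xget set0 [set V | Bs V /\ e V = n].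
have UB V : Bs V -> U (e V) = V.
  move=> BV; rewrite /U; case: xgetP => [W _ [BW eW]|/(_ V)[]//].
  by apply: einj; rewrite ?inE.
have Uo n : open (U n).
  rewrite /U; case: xgetP => [W _ [BW eW]|_]; [exact: Bo|exact: open0].
have nbU (O : set Y) y : open O -> O y -> exists n, U n y /\ U n `<=` O.
  move=> oO Oy; have [|V [BV Vy] VO] := Bnb y O; first by apply: open_nbhs_nbhs; split.
  by exists (e V); rewrite UB.
pose A n := X0 `&` f @^-1` U n.
have mA n : measurable (A n).
  by apply: mf; apply: sub_gen_smallest; exact: Uo.
have mu0 := mu_full_setC mX0 X01.
exists A; split=> //.
- exists X0; split=> // x y X0x X0y xy; apply: finj; rewrite ?inE //.
  apply/eqP/negPn/negP => nxy; move: hY; rewrite open_hausdorff => /(_ _ _ nxy).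
  move=> [[V1 V2] /= [/set_mem V1x /set_mem V2y] [oV1 oV2 /eqP V12]].
  have [n [Unx UO]] := nbU _ _ oV1 V1x.
  have [_ /UO V1y] := (xy n).1 (conj X0x Unx).
  by have : (V1 `&` V2) (f y) by []; rewrite V12.
- move=> C sC Cm Cnull CA E mE; have [C0 CC CU] := sC.
  have CN N : measurable N -> mu N = 0%E -> C N.
    by move=> mN N0; apply: (Cnull N set0); rewrite ?setD0 ?set0D ?measure0.
  have CB B : (<<s [set O : set Y | open O] >>) B -> C (X0 `&` f @^-1` B).
    apply: (@smallest_sub _ _ _ [set B | C (X0 `&` f @^-1` B)]); last first.
      move=> O oO /=.
      rewrite (_ : _ `&` _ = \bigcup_n (if `[< U n `<=` O >] then A n else set0)).
        by apply: CU => n; case: ifP.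
      apply/seteqP; split=> [x [X0x Ofx]|x [n _]].
        by have [n [Unx UO]] := nbU _ _ oO Ofx; exists n => //; rewrite asboolT.
      by case: ifPn => // /asboolP UO [X0x /UO].
    split=> /=.
    + by rewrite preimage_set0 setI0.
    + move=> {}B; rewrite setTD => CB; have mB := Cm _ CB.
      (* The complement relative to [X0] differs from the full complement only inside the null set
         outside [X0]. *)
      have -> : X0 `&` f @^-1` (~` B) = (~` (X0 `&` f @^-1` B)) `&` X0.
        apply/seteqP; split=> x /=; first by move=> [? nB]; split=> // -[].
        by move=> [nB X0x]; split=> // Bx; apply: nB.
      have CB' := CC _ CB; rewrite setTD in CB'.
      apply: (Cnull _ _ _ CB').
      * by apply: measurableI => //; exact: measurableC.
      * by rewrite setDE setIAC setICr set0I measure0.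
      * apply/eqP; rewrite eq_le measure_ge0 andbT -mu0; apply: le_measure; rewrite ?inE.
          apply: measurableD; first exact: measurableC.
          by apply: measurableI => //; exact: measurableC.
          exact: measurableC.
        by move=> x [h1 h2] X0x; apply: h2.
    + move=> {}B CB; rewrite preimage_bigcup setI_bigcupr.
      exact: CU.
  have mEX0 : measurable (E `&` X0) by exact: measurableI.
  have [B1 [B2 [bB1 bB2 B1E EB2 B12]]] := rf _ mEX0 (@subIsetr _ _ _).
  have CB1 := CB _ bB1; have mB1 := Cm _ CB1.
  have B1E' : X0 `&` f @^-1` B1 `<=` E.
    move=> x [X0x /B1E[y [Ey X0y] fxy]].
    by rewrite -(finj y x) // inE.
  apply: (Cnull _ _ mE CB1); last first.
    by rewrite (_ : _ `\` _ = set0) ?measure0 //; apply/seteqP; split=> // x [/B1E'].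
  have mB12 : measurable (X0 `&` f @^-1` (B2 `\` B1)).
    rewrite (_ : _ `&` _ = (X0 `&` f @^-1` B2) `\` (X0 `&` f @^-1` B1)).
      by apply: measurableD => //; exact: mf.
    apply/seteqP; split=> x /=; first by move=> [? [? ?]]; split=> // -[].
    by move=> [[X0x B2x] nB]; do 2!split=> //; move=> B1x; apply: nB.
  apply/eqP; rewrite eq_le measure_ge0 andbT.
  apply: (@le_trans _ _ (mu (~` X0 `|` (X0 `&` f @^-1` (B2 `\` B1))))).
    apply: le_measure; rewrite ?inE.
    + exact: measurableD.
    + by apply: measurableU => //; exact: measurableC.
    + move=> x [Ex nB]; have [X0x|] := pselect (X0 x); last by left.
      right; do 2!split=> //; first by apply: EB2; exists x.
      by move=> B1x; apply: nB.
  have mC : measurable (~` X0) by exact: measurableC.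
  have : (mu (~` X0 `|` (X0 `&` f @^-1` (B2 `\` B1))) <=
      mu (~` X0) + mu (X0 `&` f @^-1` (B2 `\` B1)))%E by exact: measureU2.
  by rewrite mu0 B12 adde0.
Qed.

End Standard.

(** * Freeness and neighbourhoods of 0 in the acting group *)

Section NonDiscrete.
Context d (X : measurableType d) (R : realType) (mu : probability X R).
Variables (G : countZmodType) (T : G -> X -> X) (A : nat -> set X).
Hypotheses (HT : mp_action mu T) (mA : forall i, measurable (A i)).
Hypotheses (sepA : separates_mod0 mu A) (genA : generates_mod0 mu A).
Implicit Types (g h : G) (e : R).

(* A basis of neighbourhoods of 0 for the weak topology on [G]. *)
Definition near0 e : set G := [set g | forall i, disp mu T g (A i) <= 2 ^+ i * e].

Lemma asymp_invariant_all (I : Type) (F : set_system I) {FF : Filter F} (g : I -> G) :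
  (forall i, asymp_invariant mu T F g (A i)) ->
  forall E, measurable E -> asymp_invariant mu T F g E.
Proof.
move=> gA; apply: genA => //; first exact: asymp_invariant_sigma.
  by move=> E [].
move=> E D mE [mD hD] ED DE; split=> // e e0; apply: filterS (hD _ e0) => i.
by apply: le_trans; apply: le_trans (disp_approx HT _ mE mD) _; rewrite /pr ED DE !addr0.
Qed.

Lemma near0_asymp_invariant (I : Type) (F : set_system I) {FF : Filter F} (g : I -> G) :
  (forall e, 0 < e -> \forall i \near F, near0 e (g i)) ->
  forall E, measurable E -> asymp_invariant mu T F g E.
Proof.
move=> h; apply: asymp_invariant_all => i; split=> // e e0.
have c0 : 0 < 2 ^+ i :> R by rewrite exprn_gt0.
have e' : 0 < e / 2 ^+ i by rewrite divr_gt0.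
by apply: filterS (h _ e') => k /(_ i) /le_trans; apply; rewrite mulrCA divff ?mulr1 // gt_eqF.
Qed.

(** Displacements never exceed 1, so the i-th condition holds automatically once 2^i e >= 1, and
    [near0 e] is decided by finitely many sets. *)
Lemma asymp_invariant_near0 (I : Type) (F : set_system I) {FF : Filter F} (g : I -> G) :
  (forall i, asymp_invariant mu T F g (A i)) ->
  forall e, 0 < e -> \forall i \near F, near0 e (g i).
Proof.
move=> h e e0.
have [N HN] : exists N, forall i, (N <= i)%N -> 1 <= 2 ^+ i * e.
  have /cvgrPdist_le/(_ _ e0)[N _ HN] : (fun n => 2^-1 ^+ n : R) @ \oo --> 0.
    by apply: cvg_expr; rewrite ger0_norm //; lra.
  exists N => i /HN; rewrite sub0r normrN exprVn ger0_norm ?invr_ge0 ?exprn_ge0 //.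
  by rewrite -[_^-1]mul1r ler_pdivrMr ?exprn_gt0 // mulrC.
have : \forall i \near F, forall k : 'I_N, disp mu T (g i) (A k) <= 2 ^+ k * e.
  apply: filter_forall => k; have [_] := h k; apply.
  by rewrite mulr_gt0 ?exprn_gt0.
apply: filterS => i hi k; have [kN|Nk] := ltnP k N; first exact: (hi (Ordinal kN)).
exact: le_trans (disp_le1 HT _ (mA k)) (HN _ Nk).
Qed.

Lemma near0D e1 e2 g h : near0 e1 g -> near0 e2 h -> near0 (e1 + e2) (g + h).
Proof.
move=> hg hh i; apply: le_trans (dispD HT _ _ (mA i)) _.
by rewrite mulrDr lerD.
Qed.

Lemma near0N e g : near0 e g -> near0 e (- g).
Proof. by move=> hg i; rewrite (dispN HT). Qed.

Lemma near0_le e1 e2 g : e1 <= e2 -> near0 e1 g -> near0 e2 g.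
Proof. by move=> e12 hg i; apply: le_trans (hg i) _; rewrite ler_wpM2l ?exprn_ge0. Qed.

Lemma near0_zero e : 0 <= e -> near0 e 0.
Proof.
move=> e0 i; rewrite /disp (_ : T 0 @^-1` A i = A i); last first.
  by apply/seteqP; split=> x /=; rewrite (mp_action_0 HT).
by rewrite setDv /pr measure0 mulr_ge0 ?exprn_ge0.
Qed.

(** An element of every [near0 e] leaves each [A i] invariant mod 0. Then almost every x is not
    separated from T_g x by the [A i], so T_g x = x almost everywhere. *)
Lemma free_not_near0 : free_action mu T -> forall g, g != 0 ->
  exists2 e, 0 < e & ~ near0 e g.
Proof.
move=> Tfree g g0; apply: contrapT => h.
have d0 i : disp mu T g (A i) = 0.
  apply/eqP; rewrite eq_le disp_ge0 andbT; apply/ler_addgt0Pl => e e0; rewrite addr0.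
  have c0 : 0 < 2 ^+ i :> R by rewrite exprn_gt0.
  have e' : 0 < e / 2 ^+ i by rewrite divr_gt0.
  have : near0 (e / 2 ^+ i) g by apply: contrapT => n; apply: h; exists (e / 2 ^+ i).
  by move=> /(_ i); rewrite mulrCA divff ?mulr1 // gt_eqF.
have [X0 [mX0 X01 sep]] := sepA.
have mgA i := measurable_action HT g (mA i).
have z E : measurable E -> pr mu E = 0 -> mu E = 0%E.
  by move=> mE E0; rewrite -pr_EFin // E0.
have ae1 : {ae mu, forall x, forall i, A i x <-> A i (T g x)}.
  apply: ae_countable => i.
  have h1 : mu.-negligible (A i `\` T g @^-1` A i).
    apply/negligibleP; first exact: measurableD.
    by apply: z; [exact: measurableD|exact: d0].
  have h2 : mu.-negligible (T g @^-1` A i `\` A i).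
    apply/negligibleP; first exact: measurableD.
    by apply: z; [exact: measurableD|rewrite (disp_sym HT) // d0].
  apply: negligibleS (negligibleU h1 h2) => x /= h3.
  have [Ax|nAx] := pselect (A i x); have [Agx|nAgx] := pselect (A i (T g x)).
  - by exfalso; apply: h3; split.
  - by left.
  - by right.
  - by exfalso; apply: h3; split.
have ae2 : {ae mu, forall x, X0 x}.
  exists (~` X0); split=> //; first exact: measurableC.
  exact: mu_full_setC.
have ae3 := ae_comp (mp_action_mp HT g) ae2.
(* A contradiction holding almost everywhere makes the whole probability space null. *)
have F : {ae mu, forall x : X, False}.
  apply: filterS3 (filterI ae1 ae2) ae3 (Tfree _ g0) => x [h1 h2] h3; apply.
  by apply/esym/sep.
have [N [mN N0 FN]] := F.
have NT : N = setT by apply/seteqP; split=> // x _; exact: FN.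
by move: N0; rewrite NT probability_setT => /eqP; rewrite onee_eq0.
Qed.

End NonDiscrete.

(** * The crossed product on its standard space *)

Section SkewProduct.
Context d (X : measurableType d) (R : realType) (mu : probability X R).
Variable (G : countZmodType).
Local Notation Z := (discr G * X)%type.
Local Notation nu := (counting_prod mu G).

Lemma sigma_finite_discr : sigma_finite [set: discr G] (@counting (discr G) R).
Proof.
exists (fun n => if unpickle n is Some g then [set (g : discr G)] else set0).
  by apply/seteqP; split=> // g _; exists (pickle (g : G)) => //=; rewrite pickleK.
by move=> n; split=> //; rewrite /counting; case: (unpickle n) => [g|];
  rewrite asboolT ?ltry.
Qed.

(** Countability of [G] makes the counting measure sigma-finite, so Tonelli applies. *)
Lemma integral_counting_prod (f : Z -> \bar R) : measurable_fun setT f ->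
  (forall z, (0 <= f z)%E) ->
  (\int[nu]_z f z = \int[@counting (discr G) R]_h \int[mu]_x f (h, x))%E.
Proof.
move=> mf f0.
pose m0 : {measure set (discr G) -> \bar R} := @counting (discr G) R.
pose M := Measure_isSigmaFinite.Build _ _ _ m0 sigma_finite_discr.
pose m1 : {sigma_finite_measure set (discr G) -> \bar R} :=
  HB.pack (m0 : set (discr G) -> \bar R) m0 M.
exact: (@fubini_tonelli1 _ _ _ _ _ m1 mu f).
Qed.

(** A preimage is a countable union of cylinders over single group elements. *)
Lemma measurable_discr_prod d' (Y : measurableType d') (f : Z -> Y) :
  (forall h, measurable_fun setT (fun x => f (h, x))) -> measurable_fun setT f.
Proof.
move=> mf _ B mB; rewrite setTI.
pose C n : set Z := if unpickle n is Some h then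
  [set (h : discr G)] `*` ((fun x => f (h, x)) @^-1` B) else set0.
rewrite (_ : f @^-1` B = \bigcup_n C n).
  apply: bigcupT_measurable => n; rewrite /C; case: (unpickle n) => // h.
  apply: measurableX => //; rewrite -[_ @^-1` _]setTI; exact: mf.
apply/seteqP; split=> [[h x] Bhx|[h x] [n _]]; rewrite /C.
  by exists (pickle (h : G)) => //; rewrite pickleK.
by case: (unpickle n) => // k [/= -> ].
Qed.

Lemma counting_preimage (s s' : G -> G) : cancel s s' -> cancel s' s ->
  forall B : set (discr G), @counting (discr G) R (s @^-1` B) = counting B.
Proof.
move=> ss' s's B; have E : s @^-1` B = s' @` B.
  by apply/seteqP; split=> [x Bx|_ [x Bx <-]]; [exists (s x)|rewrite /preimage /= s's].
have E' : B = s @` (s @^-1` B).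
  apply/seteqP; split=> [x Bx|_ [x Bx <-]] //.
  by exists (s' x); rewrite /preimage /= s's.
rewrite /counting; have [fB|nfB] := pselect (finite_set B).
  have fB' : finite_set (s @^-1` B) by rewrite E; exact: finite_image.
  rewrite !asboolT // E fset_set_image // finmap.card_imfset //; exact: can_inj s's.
rewrite !asboolF // => fB; apply: nfB; rewrite E'; exact: finite_image.
Qed.

Lemma counting_prodE (E : set Z) : nu E = (\int[@counting (discr G) R]_h mu (xsection E h))%E.
Proof. by []. Qed.

(** All point maps behind the operators have this shape. The measure of a set is the sum over h of
    the measures of its sections: the fibre maps preserve each term and the bijection reindexes the
    sum. *)
Lemma skew_mp (s s' : G -> G) (phi : G -> X -> X) : cancel s s' -> cancel s' s ->
  (forall h, measure_preserving mu (phi h)) ->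
  measure_preserving nu (fun p : Z => (s p.1 : discr G, phi p.1 p.2)).
Proof.
move=> ss' s's mphi; have mf : measurable_fun setT (fun p : Z => (s p.1 : discr G, phi p.1 p.2)).
  apply: measurable_discr_prod => h; have [mh _] := mphi h.
  by apply: measurable_fun_pair; [exact: (measurable_cst (s h : discr G))|exact: mh].
split=> // E mE.
rewrite !counting_prodE.
transitivity (\int[@counting (discr G) R]_h mu (xsection E (s h)))%E.
  apply: eq_integral => h _.
  transitivity (mu (phi h @^-1` xsection E (s h))).
    by congr (mu _); apply/seteqP; split=> x; rewrite /xsection /= !inE.
  by have [_ ->] := mphi h; last exact: (measurable_xsection (s h : discr G)).
have ms : measurable_fun [set: discr G] (s : discr G -> discr G) by [].
have mE' : measurable_fun [set: discr G] (fun h => mu (xsection E h)) by [].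
have h := @ge0_integral_pushforward _ _ (discr G) (discr G) _ s ms
  (@counting (discr G) R) setT (fun h => mu (xsection E h)) measurableT mE'
  (fun _ _ => measure_ge0 _ _).
transitivity (\int[pushforward (@counting (discr G) R) (s : discr G -> discr G)]_h
   mu (xsection E h))%E; first exact/esym/h.
by apply: eq_measure_integral => B _ _; exact: counting_preimage ss' s's B.
Qed.

Definition cyl (g : G) (A : set X) : set Z := [set (g : discr G)] `*` A.

Lemma measurable_cyl g A : measurable A -> measurable (cyl g A).
Proof. by move=> mA; exact: measurableX. Qed.

Lemma cyl_measure g A : measurable A -> nu (cyl g A) = mu A.
Proof.
move=> mA; transitivity (@counting (discr G) R [set (g : discr G)] * mu A)%E.
  exact: product_measure1E.
rewrite (_ : counting _ = 1%E) ?mul1e //.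
by rewrite /counting asboolT // fset_set1 finmap.cardfs1.
Qed.

Lemma ae_counting_prod (P : G -> X -> Prop) : (forall h, {ae mu, forall x, P h x}) ->
  {ae nu, forall p, P p.1 p.2}.
Proof.
move=> hP; suff : {ae nu, forall p : Z, forall h : G, p.1 = h -> P h p.2}.
  by apply: filterS => p; apply.
apply: ae_countable => h; have [N [mN N0 PN]] := hP h.
exists (cyl h N); split.
- exact: measurable_cyl.
- by rewrite cyl_measure.
- move=> [g x] /= /not_implyP[gh nP]; split=> //=; exact: PN.
Qed.

Lemma cyl_lty g A : measurable A -> (nu (cyl g A) < +oo)%E.
Proof. by move=> mA; rewrite cyl_measure //; exact: prob_lty. Qed.

Lemma cyl_dense (K : set (L2 nu)) : closed_subspace K ->
  (forall g A, measurable A -> K (indv nu (cyl g A))) -> forall u, K u.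
Proof.
move=> cK KA; apply: (@indv_dense _ _ _ _ G (cyl^~ setT)) => //.
- by move=> g; exact: measurable_cyl.
- by move=> g; exact: cyl_lty.
- by move=> [h x]; exists h.
move=> g E mE Eg; rewrite (_ : E = cyl g (xsection E g)).
  by apply: KA; exact: measurable_xsection.
apply/seteqP; split=> [[h x] Ehx|[h x] [/= ->]]; last by rewrite /xsection /= inE.
have [/= hg _] := Eg _ Ehx; rewrite hg in Ehx *.
by split=> //=; rewrite /xsection /= inE.
Qed.

End SkewProduct.

(** * Operators of the crossed product and of its commutant *)

Section CrossedProductOperators.
Context d (X : measurableType d) (R : realType) (mu : probability X R).
Variables (G : countZmodType) (T : G -> X -> X).
Hypothesis HT : mp_action mu T.
Local Notation Z := (discr G * X)%type.
Local Notation nu := (counting_prod mu G).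
Local Notation H := (L2 nu).
Local Notation Om := (trace_vec mu G).
Local Notation v := (@cp_unit _ X R mu G).
Implicit Types (g h : G) (A : set X) (u : H).

Definition vmap g (p : Z) : Z := (p.1 - g, p.2).
Definition umap g (p : Z) : Z := (p.1 + g, T (- g) p.2).
Definition wmap g (p : Z) : Z := (p.1, T (- g) p.2).
(** Inversion in the transformation groupoid: the arrow from x to T_h x is reversed. The modular
    conjugation is built on it. *)
Definition jmap (p : Z) : Z := (- p.1, T p.1 p.2).

Lemma id_mp : measure_preserving mu id.
Proof. by split=> // ; exact: measurable_id. Qed.

Lemma vmap_mp g : measure_preserving nu (vmap g).
Proof.
exact: (@skew_mp _ _ _ mu G (fun h => h - g) (fun h => h + g) (fun _ => id)
  (subrK g) (addrK g) (fun _ => id_mp)).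
Qed.

Lemma umap_mp g : measure_preserving nu (umap g).
Proof.
exact: (@skew_mp _ _ _ mu G (fun h => h + g) (fun h => h - g) (fun _ => T (- g))
  (addrK g) (subrK g) (fun _ => mp_action_mp HT _)).
Qed.

Lemma wmap_mp g : measure_preserving nu (wmap g).
Proof.
exact: (@skew_mp _ _ _ mu G id id (fun _ => T (- g)) (fun _ => erefl) (fun _ => erefl)
  (fun _ => mp_action_mp HT _)).
Qed.

Lemma jmap_mp : measure_preserving nu jmap.
Proof.
exact: (@skew_mp _ _ _ mu G -%R -%R T opprK opprK (fun h => mp_action_mp HT h)).
Qed.

(* The [right_unit g] commute with [R_T], and [koopman_amp g], which is
   1 (x) u_g, equals [v g \o right_unit g]; so both [koopman_amp g] and [v g]
   implement the same automorphism of [R_T]. *)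
Definition right_unit g : H -> H := comp_op (nu := nu) (umap g).
Definition koopman_amp g : H -> H := comp_op (nu := nu) (wmap g).
Local Notation U := right_unit.
Local Notation W := koopman_amp.

Lemma vE g : v g = comp_op (nu := nu) (vmap g). Proof. by []. Qed.

Lemma vD g h u : v g (v h u) = v (g + h) u.
Proof.
rewrite !vE comp_op_comp; [|exact: vmap_mp..].
by congr (comp_op (nu := nu) _ u); apply/funext => p; rewrite /vmap /= opprD addrA.
Qed.

Lemma v0 u : v 0 u = u.
Proof.
rewrite vE (_ : vmap 0 = id) ?comp_op_id //.
by apply/funext => -[h x]; rewrite /vmap /= subr0.
Qed.

Lemma v_bounded g : bounded_op (v g).
Proof. by rewrite vE; apply: comp_op_bounded; exact: vmap_mp. Qed.

Lemma v_unitary g : unitary_op (v g) /\ adj (v g) = v (- g).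
Proof.
have E : adj (v g) = v (- g).
  rewrite !vE; apply: comp_op_adj; [exact: vmap_mp..|].
  by apply/funext => -[h x]; rewrite /vmap /= opprK subrK.
split=> //; split; first exact: v_bounded.
- by apply/funext => u; rewrite E /= vD addNr v0.
- by apply/funext => u; rewrite E /= vD subrr v0.
Qed.

Lemma U_bounded g : bounded_op (U g).
Proof. by apply: comp_op_bounded; exact: umap_mp. Qed.

Lemma U_adj g : adj (U g) = U (- g).
Proof.
apply: comp_op_adj; [exact: umap_mp..|].
by apply/funext => -[h x]; rewrite /umap /= opprK addrK (mp_actionVK HT).
Qed.

Lemma U_norm g u : L2norm (U g u) = L2norm u.
Proof. by apply: comp_op_norm; exact: umap_mp. Qed.

Lemma WE g u : W g u = U g (v g u).
Proof.
rewrite /U vE comp_op_comp; [|exact: umap_mp|exact: vmap_mp].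
by congr (comp_op (nu := nu) _ u); apply/funext => p; rewrite /vmap /umap /= addrK.
Qed.

Lemma WD g h u : W g (W h u) = W (g + h) u.
Proof.
rewrite /W comp_op_comp; [|exact: wmap_mp..].
by congr (comp_op (nu := nu) _ u); apply/funext => p; rewrite /wmap /= opprD addrC (mp_action_D HT) // addrC.
Qed.

Lemma W0 u : W 0 u = u.
Proof.
rewrite /W (_ : wmap 0 = id) ?comp_op_id //.
by apply/funext => -[h x]; rewrite /wmap /= oppr0 (mp_action_0 HT).
Qed.

Lemma W_bounded g : bounded_op (W g).
Proof. by apply: comp_op_bounded; exact: wmap_mp. Qed.

Lemma W_norm g u : L2norm (W g u) = L2norm u.
Proof. by apply: comp_op_norm; exact: wmap_mp. Qed.

Lemma W_adj g : adj (W g) = W (- g).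
Proof.
apply: comp_op_adj; [exact: wmap_mp..|].
by apply/funext => -[h x]; rewrite /wmap /= opprK (mp_actionVK HT).
Qed.

Lemma U_v g h u : U g (v h u) = v h (U g u).
Proof.
rewrite /U vE comp_op_comp; [|exact: umap_mp|exact: vmap_mp].
rewrite comp_op_comp; [|exact: vmap_mp|exact: umap_mp].
by congr (comp_op (nu := nu) _ u); apply/funext => p; rewrite /vmap /umap /= addrAC.
Qed.

(** At (h, x), [right_ind A] multiplies by 1_A(x) and commutes with [R_T], while [left_ind A]
    multiplies by 1_A(T_h x) and is the copy of 1_A inside [R_T]. *)
Definition right_ind A : H -> H := mul_op (nu := nu) (ind R (setT `*` A)).
Definition left_ind A : H -> H := cp_fun T (ind R A).
Local Notation r := right_ind.
Local Notation l := left_ind.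

Lemma measurable_strip A : measurable A -> measurable ([set: discr G] `*` A).
Proof. by move=> mA; exact: measurableX. Qed.

Lemma r_bound A : measurable A -> ess_bounded nu (ind R ([set: discr G] `*` A)) 1.
Proof. by move=> mA; apply: ess_bounded_ind; exact: measurable_strip. Qed.

Lemma r_bounded A : measurable A -> bounded_op (r A).
Proof. by move=> mA; exact: mul_op_bounded (r_bound mA). Qed.

Lemma r_adj A : measurable A -> adj (r A) = r A.
Proof.
move=> mA; rewrite /r (mul_op_adj (r_bound mA)); congr (mul_op (nu := nu) _).
by apply/funext => p; rewrite indE /= oppr0.
Qed.

Lemma r_v A g u : measurable A -> r A (v g u) = v g (r A u).
Proof.
move=> mA; by rewrite vE /r (comp_mul_op u (vmap_mp g) (r_bound mA)).
Qed.

Lemma Linfty_bounded (f : X -> R[i]) : cLfun mu +oo%E f -> exists C, ess_bounded mu f C.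
Proof.
have B (k : X -> R) : k \in Lfun mu +oo%E ->
    measurable_fun setT k /\ exists C, {ae mu, forall x, k x ^+ 2 <= C ^+ 2}.
  rewrite inE => /andP[]; rewrite !inE /= => mk; rewrite /finite_norm unlock /=.
  have -> : (0 < mu [set: X])%E by rewrite probability_setT lte01.
  move=> fin; split=> //.
  have [C hC] : exists C : R, (ess_sup mu (abse \o (EFin \o k)) <= C%:E)%E.
    rewrite /= in fin; move: fin; case: (ess_sup _ _) => [C _|//|_]; [by exists C|by exists 0; rewrite leNye].
  exists C; move/ess_supP: hC; apply: filterS => x /=; rewrite lee_fin => hC.
  rewrite -[k x ^+ 2]real_normK ?num_real //; apply: lerXn2r => //.
  by rewrite nnegrE (le_trans _ hC).
move=> [/B[mr [C1 h1]] /B[mi [C2 h2]]]; exists (C1 ^+ 2 + C2 ^+ 2); split.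
- by split.
- by rewrite addr_ge0 ?sqr_ge0.
- by apply: filterS2 h1 h2 => x h1 h2; rewrite lerD.
Qed.

Lemma cp_fun_bound f C : ess_bounded mu f C ->
  ess_bounded nu (fun p : Z => f (T p.1 p.2)) C.
Proof.
move=> [[mr mi] C0 fC]; split=> //.
- by split; apply: measurable_discr_prod => h;
    have [mT _] := mp_action_mp HT h; [exact: (measurableT_comp mr mT)|
    exact: (measurableT_comp mi mT)].
- apply: (ae_counting_prod (P := fun h x => nsq (f (T h x)) <= C)) => h.
  exact: (ae_comp (mp_action_mp HT h) fC).
Qed.

Lemma cp_fun_bounded f C : ess_bounded mu f C -> bounded_op (cp_fun (mu := mu) T f).
Proof. by move=> fC; exact: mul_op_bounded (cp_fun_bound fC). Qed.

Lemma U_cp_fun f C g u : ess_bounded mu f C -> U g (cp_fun T f u) = cp_fun T f (U g u).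
Proof.
move=> fC; rewrite /U; have := comp_mul_op u (umap_mp g) (cp_fun_bound fC).
rewrite -/(cp_fun T f u) => ->; congr (mul_op (nu := nu) _ _); apply/funext => -[h x].
by rewrite /umap /= -(mp_action_D HT) addrK.
Qed.

Lemma r_cp_fun f C A u : ess_bounded mu f C -> measurable A ->
  r A (cp_fun T f u) = cp_fun T f (r A u).
Proof. by move=> fC mA; exact: mul_op_comm (r_bound mA) (cp_fun_bound fC). Qed.

(** A part of the commutant of [R_T], large enough to have the trace vector as a cyclic vector. *)
Definition right_ops : set (H -> H) := range U `|` [set r A | A in measurable].

Lemma right_ops_bounded : right_ops `<=` @bounded_op _ _ _ nu.
Proof. by move=> _ [[g _ <-]|[A mA <-]]; [exact: U_bounded|exact: r_bounded]. Qed.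

Lemma gens_bounded : ([set cp_fun T f | f in cLfun mu +oo%E] `|` range v)
  `<=` @bounded_op _ _ _ nu.
Proof.
move=> _ [[f /Linfty_bounded[C fC] <-]|[g _ <-]]; last exact: v_bounded.
exact: cp_fun_bounded fC.
Qed.

Lemma v_range_bounded : range v `<=` @bounded_op _ _ _ nu.
Proof. by move=> _ [g _ <-]; exact: v_bounded. Qed.

Lemma R_T_vN : von_neumann (R_T mu T).
Proof. exact: vN_generated_vN gens_bounded. Qed.

Lemma S_T_vN : von_neumann (S_T mu G).
Proof. exact: vN_generated_vN v_range_bounded. Qed.

Lemma S_T_sub : S_T mu G `<=` R_T mu T.
Proof.
apply: vN_generated_min; first exact: R_T_vN.
by move=> x vx; apply: sub_vN_generated; right.
Qed.

Lemma v_S_T g : S_T mu G (v g).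
Proof. by apply: sub_vN_generated; exists g. Qed.

Lemma R_T_commutant : R_T mu T `<=` commutant right_ops.
Proof.
apply: vN_generated_min.
  apply: vN_commutant; first exact: right_ops_bounded.
  move=> _ [[g _ <-]|[A mA <-]]; first by left; rewrite U_adj; exists (- g).
  by right; rewrite (r_adj mA); exists A.
move=> _ [[f /Linfty_bounded[C fC] <-]|[g _ <-]].
  split; first exact: cp_fun_bounded fC.
  move=> _ [[g _ <-]|[A mA <-]]; apply/funext => u /=; first by rewrite (U_cp_fun _ _ fC).
  by rewrite (r_cp_fun _ fC mA).
split; first exact: v_bounded.
by move=> _ [[h _ <-]|[A mA <-]]; apply/funext => u /=; rewrite ?U_v ?r_v.
Qed.

Lemma R_T_bounded (x : H -> H) : R_T mu T x -> bounded_op x.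
Proof. by move/(vN_sub_bounded R_T_vN). Qed.

Lemma R_T_U (x : H -> H) g u : R_T mu T x -> x (U g u) = U g (x u).
Proof.
move/R_T_commutant => [_ /(_ (U g))] h.
by have /h/(congr1 (@^~ u)) : right_ops (U g) by left; exists g.
Qed.

Lemma R_T_r (x : H -> H) A u : measurable A -> R_T mu T x -> x (r A u) = r A (x u).
Proof.
move=> mA /R_T_commutant[_ /(_ (r A))] h.
by have /h/(congr1 (@^~ u)) : right_ops (r A) by right; exists A.
Qed.

Lemma cLfun_ind A : measurable A -> cLfun mu +oo%E (ind R A).
Proof.
move=> mA; have B (k : X -> R) : measurable_fun setT k -> (forall x, `|k x| <= 1) ->
    k \in Lfun mu +oo%E.
  move=> mk k1; rewrite inE; apply/andP; split; rewrite !inE //= /finite_norm unlock /=.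
  have -> : (0 < mu [set: X])%E by rewrite probability_setT lte01.
  apply: le_lt_trans (ltry 1).
  by apply/ess_supP; apply: aeW => x; rewrite /= lee_fin.
have [mr mi] := @cmeas_ind _ _ R _ mA.
split; apply: B => // x; rewrite indE /= ?normr0 //.
by rewrite indicE; case: (_ \in _); rewrite ?normr1 ?normr0.
Qed.

Lemma l_R_T A : measurable A -> R_T mu T (l A).
Proof.
by move=> mA; apply: sub_vN_generated; left; exists (ind R A) => //; exact: cLfun_ind.
Qed.

Lemma trace_vecE : Om = indv nu (cyl 0 setT).
Proof.
congr (to_L2 nu _); apply/funext => -[h x]; rewrite /ind /cyl /=.
by congr ((_ : bool)%:R); apply/idP/idP; rewrite ?inE /=; [move/eqP|case=> ->].
Qed.

Lemma U_indv g h A : measurable A ->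
  U g (indv nu (cyl h A)) = indv nu (cyl (h - g) (T (- g) @^-1` A)).
Proof.
move=> mA; rewrite /U comp_op_indv; [|exact: umap_mp|exact: measurable_cyl|exact: cyl_lty].
congr (indv nu _); apply/seteqP; split=> -[k x] [/= kh Ax]; split=> //=.
  by rewrite -kh addrK.
by rewrite kh subrK.
Qed.

Lemma W_indv g h A : measurable A ->
  W g (indv nu (cyl h A)) = indv nu (cyl h (T (- g) @^-1` A)).
Proof.
by move=> mA; rewrite /W comp_op_indv //; [exact: wmap_mp|exact: measurable_cyl|exact: cyl_lty].
Qed.

Lemma v_indv g h A : measurable A ->
  v g (indv nu (cyl h A)) = indv nu (cyl (h + g) A).
Proof.
move=> mA; rewrite vE comp_op_indv; [|exact: vmap_mp|exact: measurable_cyl|exact: cyl_lty].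
congr (indv nu _); apply/seteqP; split=> -[k x] [/= kh Ax]; split=> //=.
  by rewrite -kh subrK.
by rewrite kh addrK.
Qed.

Lemma r_indv g A B : measurable A -> measurable B ->
  r A (indv nu (cyl g B)) = indv nu (cyl g (A `&` B)).
Proof.
move=> mA mB; rewrite /r mul_ind_indv; [|exact: measurable_strip|exact: measurable_cyl|exact: cyl_lty].
by congr (indv nu _); apply/seteqP; split=> -[k x] /=; [move=> [[_ ?] [? ?]]|move=> [? [? ?]]].
Qed.

(* The trace vector is cyclic for the commutant of [R_T]. *)
Lemma indv_cylE g A : measurable A -> indv nu (cyl g A) = r A (U (- g) Om).
Proof.
move=> mA; rewrite trace_vecE U_indv // preimage_setT r_indv //.
by rewrite setIT sub0r opprK.
Qed.

Lemma R_T_indv (x : H -> H) g A : R_T mu T x -> measurable A ->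
  x (indv nu (cyl g A)) = r A (U (- g) (x Om)).
Proof. by move=> Rx mA; rewrite indv_cylE // R_T_r // R_T_U. Qed.

Lemma norm2E (x : H -> H) : bounded_op x -> norm2 x = L2norm (x Om).
Proof.
move=> bx; have := adjP (adj_bounded x) (x Om) Om; rewrite (adjK bx) => h.
by rewrite /norm2 /tau /L2norm -h.
Qed.

End CrossedProductOperators.

(** * Fourier coefficients and commutators *)

Section Coefficients.
Context d (X : measurableType d) (R : realType) (mu : probability X R).
Variables (G : countZmodType) (T : G -> X -> X).
Hypothesis HT : mp_action mu T.
Local Notation Z := (discr G * X)%type.
Local Notation nu := (counting_prod mu G).
Local Notation H := (L2 nu).
Local Notation Om := (trace_vec mu G).
Local Notation v := (@cp_unit _ X R mu G).
Local Notation e_ g A := (indv nu (cyl g A)).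
Local Notation W := (@koopman_amp _ X R mu G T).
Local Notation l := (@left_ind _ X R mu G T).
Local Notation r := (@right_ind _ X R mu G).
Implicit Types (g h : G) (A : set X) (u : H).

Lemma cylD h A B : cyl h A `\` cyl h B = cyl h (A `\` B).
Proof.
by apply/seteqP; split=> -[k x] /=; [move=> [[kh Ax] nB]|move=> [kh [Ax nB]]];
  split=> //=; [split=> // Bx; apply: nB|case].
Qed.

Lemma W_indv_norm g h A : measurable A ->
  L2norm (W g (e_ h A) - e_ h A) ^+ 2 = 2 * disp mu T g A.
Proof.
move=> mA; have mgA := measurable_action HT (- g) mA.
rewrite W_indv //; apply: EFin_inj; rewrite indvB_norm; try exact: measurable_cyl; try exact: cyl_lty.
rewrite !cylD !cyl_measure; try exact: measurableD.
rewrite -!pr_EFin; try exact: measurableD.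
rewrite (disp_sym HT) // -[pr mu (A `\` _)]/(disp mu T (- g) A) (dispN HT) // -EFinD.
by congr EFin; ring.
Qed.

Lemma W_strong_cvg (I : Type) (F : set_system I) {FF : Filter F} (g : I -> G) :
  (forall A, measurable A -> asymp_invariant mu T F g A) ->
  strong_cvg F (fun i => W (g i)) id.
Proof.
move=> gA; apply: (@cyl_dense _ _ _ mu G).
  apply: (@strong_cvg_subspace _ _ _ _ _ _ _ _ _ 1) => // [i|i u|u].
  - exact: bounded_op_lin (W_bounded HT _).
  - by rewrite mul1r (W_norm HT).
  - by rewrite mul1r.
move=> h A mA; apply/cvg0P => [i|e e0]; first exact: L2norm_ge0.
have [_ /(_ (e ^+ 2 / 2))] := gA A mA; rewrite divr_gt0 ?exprn_gt0 // => /(_ isT).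
apply: filterS => i; rewrite ler_pdivlMr // => hi.
by rewrite -(@ler_pXn2r _ 2) ?nnegrE ?L2norm_ge0 ?(ltW e0) // W_indv_norm // mulrC.
Qed.

Lemma koopman_indv_norm g A : measurable A ->
  L2norm (koopman T g (indv mu A) - indv mu A) ^+ 2 = 2 * disp mu T g A.
Proof.
move=> mA; have mgA := measurable_action HT (- g) mA.
rewrite -[koopman T g _]/(comp_op (nu := mu) (T (- g)) (indv mu A)).
rewrite comp_op_indv //; [|exact: mp_action_mp|exact: prob_lty].
apply: EFin_inj; rewrite indvB_norm //; try exact: prob_lty.
transitivity ((disp mu T g A)%:E + (disp mu T g A)%:E)%E.
  congr (_ + _)%E; rewrite -(dispN HT g mA).
    by rewrite -(disp_sym HT (- g) mA) pr_EFin //; exact: measurableD.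
  by rewrite /disp pr_EFin //; exact: measurableD.
by rewrite -EFinD; congr EFin; ring.
Qed.

(** |u_g 1_A - 1_A|^2 is twice the displacement of A, and the u_g are isometries, so convergence on
    indicators suffices. *)
Lemma rigidP : rigid_action mu T <-> exists g : nat -> G,
  (forall B : set G, finite_set B -> \forall n \near \oo, ~ B (g n)) /\
  (forall A, measurable A -> asymp_invariant mu T \oo g A).
Proof.
split=> -[g [gB h]]; exists g; split=> //.
  move=> A mA; split=> // e e0.
  have c0 : 0 < Num.sqrt (2 * e) by rewrite sqrtr_gt0 mulr_gt0.
  have : \forall n \near \oo,
      L2norm (koopman T (g n) (indv mu A) - indv mu A) <= Num.sqrt (2 * e).
    exact: ((cvg0P (fun n => L2norm_ge0 _)).1 (h (indv mu A)) _ c0).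
  apply: filterS => n; rewrite -(@ler_pXn2r _ 2) ?nnegrE ?L2norm_ge0 ?sqrtr_ge0 //.
  by rewrite koopman_indv_norm // sqr_sqrtr ?mulr_ge0 ?(ltW e0) // ler_pM2l.
apply: (@indv_dense _ _ _ mu unit (fun=> setT)
  [set f | L2norm (koopman T (g n) f - f) @[n --> \oo] --> (0 : R)]) => //.
- by move=> _; exact: prob_lty.
- apply: (@strong_cvg_subspace _ _ _ mu nat \oo _ (fun n => koopman T (g n)) id 1) => //.
  + by move=> n; exact: comp_op_linear (mp_action_mp HT _).
  + by move=> n u; rewrite mul1r (comp_op_norm u (mp_action_mp HT (- g n))).
  + by move=> u; rewrite mul1r.
move=> _ A mA _; apply/cvg0P => [i|e e0]; first exact: L2norm_ge0.
have [_ /(_ (e ^+ 2 / 2))] := h A mA; rewrite divr_gt0 ?exprn_gt0 // => /(_ isT).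
apply: filterS => i; rewrite ler_pdivlMr // => hi.
by rewrite -(@ler_pXn2r _ 2) ?nnegrE ?L2norm_ge0 ?(ltW e0) // koopman_indv_norm // mulrC.
Qed.

Lemma dot_indv_indv (E F : set Z) : measurable E -> measurable F ->
  (nu E < +oo)%E -> (nu F < +oo)%E ->
  dot (indv nu E) (indv nu F) = (fine (nu (E `&` F)))%:C%C.
Proof.
move=> mE mF fE fF; rewrite dot_to_L2; [|exact: sqint_ind..].
have -> : (fun x => ind R E x * conjc (ind R F x)) = (fun x => (\1_(E `&` F) x)%:C%C).
  apply/funext => x; rewrite !indE !indicE in_setI.
  by case: (x \in E) (x \in F) => [] []; rewrite /= ?oppr0 ?mulr1 ?mulr0 ?mul0r.
rewrite /cint /=; congr Complex; last by rewrite /Rintegral integral0.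
by rewrite /Rintegral integral_indic ?setIT //; exact: measurableI.
Qed.

Lemma sub_cylE g (E : set Z) : E `<=` cyl g setT -> E = cyl g (xsection E g).
Proof.
move=> Eg; apply/seteqP; split=> [[h x] Ehx|[h x] [/= ->]]; last by rewrite /xsection /= inE.
have [/= hg _] := Eg _ Ehx; rewrite hg in Ehx *.
by split=> //=; rewrite /xsection /= inE.
Qed.

(** The Fourier coefficient tau(v_g^* x), because [e_ g setT] is v_g Omega. *)
Definition coef (x : H -> H) g : R[i] := dot (x Om) (e_ g setT).

(** [K] is the orthogonal complement of the vectors e_h(A) - mu(A) e_h(X), that is, the space of
    vectors constant in the X-coordinate. It contains Omega and is invariant under every v_g and its
    adjoint, hence under [S_T]. *)
Lemma S_T_const x : S_T mu G x -> {ae nu, forall p, x Om p = coef x p.1}.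
Proof.
move=> Sx.
pose Q : set H := [set z | exists h A, measurable A /\
  z = e_ h A - (pr mu A)%:C%C *: e_ h setT].
pose K : set H := [set u | forall z, Q z -> dot u z = 0].
have vQ g z : Q z -> Q (v g z).
  move=> [h [A [mA ->]]]; exists (h + g), A; split=> //.
  have vl := bounded_op_lin (v_bounded mu g).
  by rewrite (linear_B _ _ vl) (linear_Z _ _ vl) !v_indv.
have KOm : K Om.
  move=> z [h [A [mA ->]]]; rewrite trace_vecE dotBr dotZr.
  rewrite !dot_indv_indv; try exact: measurable_cyl; try exact: cyl_lty.
  have [->|h0] := eqVneq h 0.
    rewrite (_ : cyl 0 setT `&` cyl 0 A = cyl 0 A); last first.
      by apply/seteqP; split=> -[k y] /=; [case|move=> [? ?]].
    rewrite setIid !cyl_measure // probability_setT -/(pr mu A) /= oppr0.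
    by rewrite (_ : 1%:C%C = 1) // mulr1 subrr.
  have dis B : cyl 0 setT `&` cyl h B = set0.
    apply/seteqP; split=> // -[k y] [[/= k0 _] [/= kh _]].
    by move: h0; rewrite -kh k0 eqxx.
  by rewrite !dis measure0 /= mulr0 subrr.
have Kx : K (x Om).
  apply: (vN_generated_invariant (@v_range_bounded _ _ _ mu G) (orthogonal_closed Q) _ _ Sx KOm).
    move=> _ u [g _ <-] Ku z Qz.
    by rewrite (adjP (v_bounded mu g)) (v_unitary mu g).2; apply: Ku; exact: vQ.
  move=> _ u [g _ <-] Ku z Qz.
  by rewrite -(adjPr (v_bounded mu g)); apply: Ku; exact: vQ.
have h : {ae nu, forall p, forall g, cyl g setT p -> x Om p = coef x g}.
  apply: ae_countable => g; apply: L2_cst_on; first exact: measurable_cyl.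
    exact: cyl_lty.
  move=> E mE Eg; have := sub_cylE Eg; set A := xsection E g => EA.
  have mA : measurable A by exact: measurable_xsection.
  rewrite EA cyl_measure // -/(pr mu A); apply/eqP; rewrite -subr_eq0; apply/eqP.
  have : Q (e_ g A - (pr mu A)%:C%C *: e_ g setT) by exists g, A.
  by move=> /Kx; rewrite dotBr dotZr /= oppr0 [_%:C%C * _]mulrC.
by apply: filterS h => -[h y] /= /(_ h); apply.
Qed.

Lemma L2norm_fibre u (F : Z -> R[i]) : cmeas F -> {ae nu, forall p, u p = F p} ->
  (L2norm u ^+ 2)%:E =
  (\int[@counting (discr G) R]_h \int[mu]_y (nsq (F (h, y)))%:E)%E.
Proof.
move=> mF uF; rewrite L2norm_sqnorm (sqnorm_ae (L2_cmeas u) mF uF).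
have m1 : measurable_fun setT (fun p => (nsq (F p))%:E).
  by apply/measurable_EFinP; exact: cmeas_nsq.
by rewrite /sqnorm (integral_counting_prod mu m1) // => p; rewrite lee_fin nsq_ge0.
Qed.

Lemma cmeas_fst (c : G -> R[i]) : cmeas (fun p : Z => c p.1).
Proof.
by split; apply: measurable_discr_prod => h;
  [exact: (measurable_cst (CRe (c h)))|exact: (measurable_cst (CIm (c h)))].
Qed.

Lemma l_ae A u : measurable A -> {ae nu, forall p, l A u p = ind R A (T p.1 p.2) * u p}.
Proof.
move=> mA; exact: mul_op_ae u (cp_fun_bound HT (ess_bounded_ind mu mA)).
Qed.

(** Over h the difference multiplies the constant [coef x h] by 1_A(T_h y) - 1_A(y), whose squared
    norm is the measure of a symmetric difference, namely twice [disp]. *)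
Lemma commutator_norm x A : S_T mu G x -> measurable A ->
  (L2norm (l A (x Om) - r A (x Om)) ^+ 2)%:E =
  (\int[@counting (discr G) R]_h (nsq (coef x h) * (2 * disp mu T h A))%:E)%E.
Proof.
move=> Sx mA.
pose F (p : Z) := (ind R A (T p.1 p.2) + (fun=> -1) p * ind R ([set: discr G] `*` A) p) * coef x p.1.
have [ml _ _] := cp_fun_bound HT (ess_bounded_ind mu mA).
have [mr _ _] := r_bound mu G mA.
have mF : cmeas F.
  by apply: cmeasM (cmeas_fst _); apply: cmeasD => //; exact: cmeasM (cmeas_cst _ _) mr.
rewrite (L2norm_fibre mF); last first.
  have h1 := L2B_ae (l A (x Om)) (r A (x Om)).
  have h2 := l_ae (x Om) mA.
  have h3 : {ae nu, forall p, r A (x Om) p = ind R (setT `*` A) p * x Om p}.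
    exact: mul_op_ae (x Om) (r_bound mu G mA).
  apply: filterS3 h1 (filterI h2 h3) (S_T_const Sx) => p -> [-> ->] ->.
  by rewrite /F mulN1r mulrBl.
apply: eq_integral => h _.
have mhA := measurable_action HT h mA.
transitivity (\int[mu]_y ((nsq (coef x h))%:E *
   (\1_(A `\` T h @^-1` A) y + \1_(T h @^-1` A `\` A) y)%:E))%E.
  apply: eq_integral => y _; rewrite /F nsqM mulrC -EFinM; congr (_ * _)%:E.
  rewrite /= mulN1r !indE !indicE !in_setD.
  rewrite (_ : ((h, y) \in setT `*` A) = (y \in A)); last first.
    by apply/idP/idP; rewrite !inE => // -[].
  rewrite (_ : (y \in T h @^-1` A) = (T h y \in A)); last by apply/idP/idP; rewrite !inE.
  by case: (y \in A) (_ \in A) => [] []; rewrite /nsq /=; ring.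
have m1 : measurable (A `\` T h @^-1` A) by exact: measurableD.
have m2 : measurable (T h @^-1` A `\` A) by exact: measurableD.
have mi B : measurable B -> measurable_fun setT (fun y : X => (\1_B y : R)%:E).
  by move=> mB; apply/measurable_EFinP; exact: measurable_indic.
rewrite ge0_integralZl.
- under eq_integral do rewrite EFinD.
  rewrite ge0_integralD //; [|exact: mi..].
  have E B : measurable B -> (\int[mu]_y (\1_B y : R)%:E = (pr mu B)%:E)%E.
    by move=> mB; rewrite integral_indic // setIT pr_EFin.
  rewrite (E _ m1) (E _ m2) (disp_sym HT) // -EFinD -EFinM.
  by rewrite /disp; congr EFin; ring.
- exact: measurableT.
- by apply/measurable_EFinP; apply: measurable_funD; exact: measurable_indic.
- by move=> y _; rewrite lee_fin addr_ge0.
- by rewrite lee_fin nsq_ge0.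
Qed.

End Coefficients.

(** * Cauchy filters of operators *)

Section StrongCauchy.
Context d (T : measurableType d) (R : realType).
Variable nu : {measure set T -> \bar R}.
Local Notation H := (L2 nu).
Context (I : Type) (F : set_system I) {FF : ProperFilter F}.
Implicit Types (A B : I -> H -> H) (a b : H -> H) (u w z : H).

Lemma cvg_pairP (f : I * I -> R) : (forall p, 0 <= f p) ->
  (f p @[p --> filter_prod F F] --> (0 : R)) <->
  (forall e, 0 < e -> exists2 P : set I, F P & forall i j, P i -> P j -> f (i, j) <= e).
Proof.
move=> f0; split=> [/(cvg0P f0) h e e0|h].
  have [[P Q] /= [FP FQ] PQ] := h e e0; exists (P `&` Q); first exact: filterI.
  by move=> i j [Pi _] [_ Qj]; exact: (PQ (i, j)).
apply/cvg0P => // e e0; have [P FP Pf] := h e e0.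
by exists (P, P) => // -[i j] [/= Pi Pj]; exact: Pf.
Qed.

(** To handle an arbitrary filter, members P_n on which [f] has diameter at most 1/(n+1) are
    selected, then points in their finite intersections. The resulting sequence is Cauchy, and its
    limit is also the limit along the filter. *)
Lemma L2_complete_filter (f : I -> H) :
  L2norm (f p.1 - f p.2) @[p --> filter_prod F F] --> (0 : R) ->
  exists u, L2norm (f i - u) @[i --> F] --> (0 : R).
Proof.
move=> /(cvg_pairP (fun p => L2norm_ge0 (f p.1 - f p.2))) fC.
have n0 n : 0 < n.+1%:R^-1 :> R by rewrite invr_gt0.
have /choice[P HP] : forall n, exists P : set I, F P /\
    forall i j, P i -> P j -> L2norm (f i - f j) <= n.+1%:R^-1.
  by move=> n; have [P FP h] := fC _ (n0 n); exists P.
have FQ n : F [set i | forall k, (k <= n)%N -> P k i].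
  elim: n => [|n IH]; have [FP _] := HP 0%N.
    by apply: filterS FP => i Pi k; rewrite leqn0 => /eqP ->.
  have [FPn _] := HP n.+1; apply: filterS2 IH FPn => i IH Pi k.
  by rewrite leq_eqVlt => /predU1P[->//|]; rewrite ltnS; exact: IH.
have /choice[s Hs] : forall n, exists i, forall k, (k <= n)%N -> P k i.
  by move=> n; exact: filter_ex (FQ n).
have sP k n : (k <= n)%N -> P k (s n) by move=> kn; exact: Hs.
have small (e : R) : 0 < e -> exists N, N.+1%:R^-1 <= e.
  move=> e0; have /cvgrPdist_le/(_ _ e0)[N _ HN] := @cvg_harmonic R.
  exists N; have := HN N (leqnn N).
  by rewrite /harmonic /= sub0r normrN ger0_norm ?invr_ge0.
have [u su] : exists u, L2norm (f (s n) - u) @[n --> \oo] --> (0 : R).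
  apply: L2_complete => e e0; have [N Ne] := small e e0; exists N => m n Nm Nn.
  by apply: le_trans Ne; have [_ h] := HP N; apply: h; exact: sP.
exists u; apply/cvg0P => [i|e e0]; first exact: L2norm_ge0.
have e2 : 0 < e / 2 by rewrite divr_gt0.
have [N Ne] := small _ e2.
have : \forall n \near \oo, L2norm (f (s n) - u) <= e / 2.
  exact: ((cvg0P (fun n => L2norm_ge0 (f (s n) - u))).1 su _ e2).
move=> [M _ HM]; have [FP PN] := HP N; apply: filterS FP => i Pi.
apply: le_trans (ler_L2norm_dist _ (f (s (maxn M N))) _) _; rewrite (splitr e) lerD //.
  by apply: le_trans Ne; apply: PN => //; apply: sP; exact: leq_maxr.
by apply: HM => /=; exact: leq_maxl.
Qed.

Lemma strong_cauchy A r : (forall i, linear (A i)) -> (forall i, op_bound (A i) r) ->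
  (forall u, L2norm (A p.1 u - A p.2 u) @[p --> filter_prod F F] --> (0 : R)) ->
  exists a, [/\ bounded_op a, op_bound a r & strong_cvg F A a].
Proof.
move=> Al Ar AC; have /choice[a Aa] : forall u, exists w, L2norm (A i u - w) @[i --> F] --> (0 : R).
  by move=> u; exact: L2_complete_filter (AC u).
have al : linear a.
  move=> k u w; apply: (@L2_cvg_unique _ _ _ _ I F _ (fun i => A i (k *: u + w))).
    exact: Aa.
  apply: (L2norm_cvg_le (h := fun i =>
    Num.sqrt (nsq k) * L2norm (A i u - a u) + L2norm (A i w - a w))).
    move=> i; rewrite Al opprD addrACA -scalerBr; apply: le_trans (ler_L2normD _ _) _.
    by rewrite L2normZ.
  rewrite -[0 in X in _ --> X]addr0 -{1}(mulr0 (Num.sqrt (nsq k))).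
  by apply: cvgD; [apply: cvgM; [exact: cvg_cst|exact: Aa]|exact: Aa].
have ar : op_bound a r.
  move=> u; apply/ler_addgt0Pr => e e0.
  have : \forall i \near F, L2norm (A i u - a u) <= e.
    exact: ((cvg0P (fun i => L2norm_ge0 (A i u - a u))).1 (Aa u) _ e0).
  move=> /filter_ex[i hi]; have := Ar i u; have := ler_L2norm_sub (a u) (A i u).
  rewrite L2normB => /(le_trans (ler_norm _)); lra.
by exists a; split=> //; split=> //; exists r.
Qed.

(** Multiplication is jointly strongly continuous when the left factors are uniformly bounded. *)
Lemma strong_cvg_comp A B a b r : (forall i, linear (A i)) ->
  (forall i, op_bound (A i) r) -> strong_cvg F A a -> strong_cvg F B b ->
  strong_cvg F (fun i => A i \o B i) (a \o b).
Proof.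
move=> Al Ar Aa Bb u.
apply: (L2norm_cvg_le (h := fun i => r * L2norm (B i u - b u) + L2norm (A i (b u) - a (b u)))).
  move=> i /=; apply: le_trans (ler_L2norm_dist _ (A i (b u)) _) _; rewrite lerD //.
  by rewrite -(linear_B _ _ (Al i)); exact: Ar.
rewrite -[0 in X in _ --> X]addr0 -{1}(mulr0 r).
by apply: cvgD; [apply: cvgM; [exact: cvg_cst|exact: Bb]|exact: Aa].
Qed.

Lemma strong_cvg_unique A a b : strong_cvg F A a -> strong_cvg F A b -> a = b.
Proof. by move=> Aa Ab; apply/funext => u; exact: L2_cvg_unique (Aa u) (Ab u). Qed.

Lemma strong_cvg_adj A B a b : strong_cvg F A a -> strong_cvg F B b ->
  (forall i u w, dot (A i u) w = dot u (B i w)) ->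
  forall u w, dot (a u) w = dot u (b w).
Proof.
move=> Aa Bb AB u w; apply/eqP; rewrite -subr_eq0; apply/eqP/nsq_eq0/eqP.
rewrite eq_le nsq_ge0 andbT.
have h : 2 * (L2norm (A i u - a u) ^+ 2 * L2norm w ^+ 2) +
    2 * (L2norm u ^+ 2 * L2norm (B i w - b w) ^+ 2) @[i --> F] --> (0 : R).
  have -> : 0 = 2 * (0 * 0 * L2norm w ^+ 2) + 2 * (L2norm u ^+ 2 * (0 * 0)) :> R by ring.
  apply: cvgD; (apply: cvgM; first exact: cvg_cst); apply: cvgM; try exact: cvg_cst.
    exact: (cvgM (Aa u) (Aa u)).
  exact: (cvgM (Bb w) (Bb w)).
apply: (cvgr_to_ge h); apply: nearW => i.
have -> : dot (a u) w - dot u (b w) = dot (a u - A i u) w + dot u (B i w - b w).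
  by rewrite dotBl dotBr AB; ring.
apply: le_trans (nsqD _ _) _; rewrite (L2normB (A i u)).
by rewrite lerD // ler_wpM2l // nsq_dot_le.
Qed.

(** A strong limit of unitaries is in general only an isometry; convergence of the adjoints supplies
    the two-sided inverse. *)
Lemma unitary_strong_limit A a b :
  (forall i, unitary_op (A i)) -> bounded_op a -> bounded_op b ->
  strong_cvg F A a -> strong_cvg F (fun i => adj (A i)) b -> unitary_op a /\ adj a = b.
Proof.
move=> uA ba bb Aa Bb; pose B i := adj (A i).
have isom (C : I -> H -> H) : (forall i, unitary_op (C i)) -> forall i, op_bound (C i) 1.
  by move=> uC i u; rewrite mul1r unitary_norm.
have lin (C : I -> H -> H) : (forall i, unitary_op (C i)) -> forall i, linear (C i).
  by move=> uC i; have [bC _ _] := uC i; exact: bounded_op_lin.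
have uB i : unitary_op (B i) by exact: unitary_adj.
have cst_id : strong_cvg F (fun=> id) (id : H -> H).
  by move=> u; rewrite subrr L2norm0; exact: cvg_cst.
apply: unitary_op_inv => //.
- apply: strong_cvg_adj Aa Bb _ => i u w; apply: adjP; by case: (uA i).
- apply: (strong_cvg_unique (strong_cvg_comp (lin _ uA) (isom _ uA) Aa Bb)).
  rewrite (_ : (fun i => _) = fun=> id) //.
  by apply/funext => i; case: (uA i).
- apply: (strong_cvg_unique (strong_cvg_comp (lin _ uB) (isom _ uB) Bb Aa)).
  rewrite (_ : (fun i => _) = fun=> id) //.
  by apply/funext => i; case: (uA i).
Qed.

End StrongCauchy.

(** * Rigidity and central sequences *)

Section Implications.
Context d (X : measurableType d) (R : realType) (mu : probability X R).
Variables (G : countZmodType) (T : G -> X -> X).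
Hypothesis HT : mp_action mu T.
Local Notation nu := (counting_prod mu G).
Local Notation H := (L2 nu).
Local Notation Om := (trace_vec mu G).
Local Notation v := (@cp_unit _ X R mu G).
Local Notation e_ g A := (indv nu (cyl g A)).
Local Notation U := (@right_unit _ X R mu G T).
Local Notation W := (@koopman_amp _ X R mu G T).
Local Notation l := (@left_ind _ X R mu G T).
Local Notation r := (@right_ind _ X R mu G).
Implicit Types (g h : G) (A : set X) (u : H).

Lemma trace_vec_norm : L2norm Om = 1.
Proof.
apply/eqP; rewrite -(@eqrXn2 _ 2) ?L2norm_ge0 ?expr1n //; apply/eqP/EFin_inj.
rewrite trace_vecE indv_norm; [|exact: measurable_cyl|exact: cyl_lty].
by rewrite cyl_measure // probability_setT.
Qed.

Lemma tau_coef (x : H -> H) : tau x = coef x 0.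
Proof. by rewrite /tau /coef -trace_vecE. Qed.

Lemma spectral_gap (B : nat -> set X) (N : nat) (e : R) (x : H -> H) :
  (forall i, measurable (B i)) -> 0 <= e ->
  (forall h, h != 0 -> exists2 i, (i < N)%N & e <= disp mu T h (B i)) ->
  S_T mu G x ->
  e * L2norm (x Om - tau x *: Om) ^+ 2 <=
  \sum_(i < N) L2norm (l (B i) (x Om) - r (B i) (x Om)) ^+ 2.
Proof.
move=> mB e0 gap Sx.
(* Subtracting [tau x] removes exactly the coefficient at 0, the one element without a gap. *)
pose c h : R[i] := if h == 0 then 0 else coef x h.
have c_ae : {ae nu, forall p, (x Om - tau x *: Om : H) p = c p.1}.
  have h1 := L2B_ae (x Om) (tau x *: Om); have h2 := L2Z_ae (tau x) Om.
  have h3 : {ae nu, forall p, Om p = ind R (cyl 0 setT) p}.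
    by rewrite trace_vecE; apply: indv_ae; [exact: measurable_cyl|exact: cyl_lty].
  apply: filterS3 h1 (filterI h2 h3) (S_T_const Sx) => -[h y] -> [-> ->] ->.
  rewrite /c tau_coef /ind; have [->|h0] := eqVneq h 0.
    by rewrite (_ : _ \in _) /= ?mulr1 ?subrr // inE.
  rewrite (_ : _ \in _ = false) /= ?mulr0 ?subr0 //.
  by apply/negP; rewrite inE => -[/= h00]; move: h0; rewrite h00 eqxx.
have N1 : (L2norm (x Om - tau x *: Om) ^+ 2)%:E =
    (\int[@counting (discr G) R]_h (nsq (c h))%:E)%E.
  rewrite (L2norm_fibre (cmeas_fst X c) c_ae); apply: eq_integral => h _.
  rewrite -[RHS]mule1 -(probability_setT mu).
  exact: (integral_cst mu measurableT (nsq (c h))%:E).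
rewrite -lee_fin EFinM N1 -sumEFin.
under eq_bigr => i _ do rewrite commutator_norm //.
rewrite -ge0_integral_sum //; last by move=> i h _; rewrite lee_fin mulr_ge0 ?nsq_ge0 ?mulr_ge0 ?disp_ge0.
rewrite -ge0_integralZl ?lee_fin //; last by move=> h _; rewrite lee_fin nsq_ge0.
apply: ge0_le_integral => //.
- by move=> h _; rewrite -EFinM lee_fin mulr_ge0 ?nsq_ge0.
- move=> h _; rewrite -EFinM sumEFin lee_fin -mulr_sumr /c.
  have [->|h0] := eqVneq h 0.
    rewrite {1}/nsq /= expr0n addr0 mulr0 mulr_ge0 ?nsq_ge0 ?sumr_ge0 // => i _.
    by rewrite mulr_ge0 ?disp_ge0.
  rewrite mulrC ler_wpM2l ?nsq_ge0 //; have [i iN ei] := gap h h0.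
  rewrite (bigD1 (Ordinal iN)) //=; apply: (le_trans ei).
  have d0 := disp_ge0 mu T h (B i).
  rewrite (@le_trans _ _ (2 * disp mu T h (B i))) //; first by lra.
  by rewrite lerDl sumr_ge0 // => j _; rewrite mulr_ge0 ?disp_ge0.
Qed.

(** The modular conjugation of the trace: antiunitary, with J(x Omega) = x^* Omega for x in
    [R_T]. *)
Definition modular_conj u : H := to_L2 nu (fun p => conjc (comp_op (nu := nu) (jmap T) u p)).
Local Notation J := modular_conj.

Lemma conj_sqint u : (fun p => conjc (u p)) \in sqint nu.
Proof.
have /sqintP[mu' uy] := L2_sqint u; apply/sqintP; split; first exact: cmeas_conj.
rewrite (_ : sqnorm nu _ = sqnorm nu u) //.
by apply: eq_integral => p _; rewrite nsqC.
Qed.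

Lemma J_dot u w : dot (J u) (J w) = dot w u.
Proof.
rewrite dot_to_L2; [|exact: conj_sqint..].
rewrite -[RHS](comp_op_dot w u (jmap_mp HT)).
congr (cint nu _); apply/funext => p.
by rewrite conjcK mulrC.
Qed.

Lemma J_indv g A : measurable A -> J (e_ (- g) (T (- g) @^-1` A)) = e_ g A.
Proof.
move=> mA; have mA' := measurable_action HT (- g) mA.
rewrite /J (comp_op_indv (jmap_mp HT) (measurable_cyl (- g) mA') (cyl_lty mu (- g) mA')).
rewrite (_ : jmap T @^-1` _ = cyl g A); last first.
  apply/seteqP; split=> -[k y] /=.
    by move=> [/= /oppr_inj ->]; rewrite (mp_actionK HT).
  by move=> [/= -> Ay]; split=> //=; rewrite (mp_actionK HT).
have mgA : measurable (cyl g A) by exact: measurable_cyl.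
have fgA : (nu (cyl g A) < +oo)%E by exact: cyl_lty.
apply/L2_eqP; have h1 := indv_ae mgA fgA.
have h2 := to_L2_ae (conj_sqint (e_ g A)).
apply: filterS2 h1 h2 => p h1 ->.
by rewrite h1 indE /= oppr0.
Qed.

(** Tested against e_g(A) = r_A U_(-g) Omega. In <x e_g(A), Omega> the operators r_A and U_(-g) pass
    through x, and their adjoints carry Omega to the vector whose image under J is e_g(A). *)
Lemma adj_trace_vec (x : H -> H) : R_T mu T x -> adj x Om = J (x Om).
Proof.
move=> Rx; have bx := R_T_bounded HT Rx.
apply/eqP; rewrite -subr_eq0; apply/eqP; apply: dot_eq0 => z.
suff h : forall u, [set u | forall y, [set adj x Om - J (x Om)] y -> dot u y = 0] u.
  exact: h z _ erefl.
apply: (cyl_dense (orthogonal_closed _)) => g A mA _ /= ->.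
rewrite dotBr -(adjP bx) (R_T_indv HT g Rx mA).
rewrite (adjP (r_bounded mu G mA)) r_adj // (adjP (U_bounded HT _)) (U_adj HT) opprK.
have -> : U g (r A Om) = e_ (- g) (T (- g) @^-1` A).
  by rewrite trace_vecE r_indv // setIT U_indv // sub0r.
by rewrite -(J_indv g mA) J_dot subrr.
Qed.

Lemma adj_trace_norm (x : H -> H) : R_T mu T x -> L2norm (adj x Om) = L2norm (x Om).
Proof. by move=> /adj_trace_vec ->; rewrite /L2norm J_dot. Qed.

Lemma UK g u : U g (U (- g) u) = u.
Proof.
rewrite /U comp_op_comp; [|exact: umap_mp..].
rewrite (_ : _ \o _ = id) ?comp_op_id //.
by apply/funext => -[h x]; rewrite /umap /= addrK opprK (mp_actionVK HT).
Qed.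

Lemma v_trace_vec g : v g Om = U (- g) Om.
Proof. by rewrite trace_vecE v_indv // U_indv // preimage_setT sub0r opprK add0r. Qed.

(** v_g Omega = U_(-g) Omega, and U_(-g) commutes with y. Applying the isometry U_g then turns v_g
    into [W g]. *)
Lemma commutator_v_norm g (y : H -> H) : R_T mu T y ->
  L2norm (v g (y Om) - y (v g Om)) = L2norm (W g (y Om) - y Om).
Proof.
move=> Ry; rewrite v_trace_vec (R_T_U HT _ _ Ry) -(U_norm HT g).
have Ul := bounded_op_lin (U_bounded HT g).
by rewrite (linear_B _ _ Ul) UK WE.
Qed.

(** Commutators with v_(g_n) have the size of (1 (x) u_(g_n) - 1) y Omega, which tends to 0. The
    sequence is not trivial because tau(v_g) = 0 for g <> 0 while |v_g|_2 = 1. *)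
Lemma rigid_central_sequence : rigid_action mu T ->
  exists x : nat -> H -> H,
    [/\ central_sequence mu T x, (forall n, S_T mu G (x n)) & ~ trivial_sequence mu x].
Proof.
move=> /(rigidP HT)[g [gB ginv]]; exists (fun n => v (g n)).
have bv g' := v_bounded mu g'.
split=> [|n|].
- split=> [n||y Ry]; first by apply: S_T_sub => //; exact: v_S_T.
    by exists 1 => n u; rewrite mul1r unitary_norm //; have [] := v_unitary mu (g n).
  have by' := R_T_bounded HT Ry.
  rewrite (_ : (fun n => _) = fun n => L2norm (W (g n) (y Om) - y Om)).
    exact: (W_strong_cvg HT ginv (y Om)).
  apply/funext => n; rewrite norm2E; last by apply: bounded_sub; exact: bounded_comp.
  by rewrite -commutator_v_norm.
- exact: v_S_T.
move=> triv.
have g0 : \forall n \near \oo, g n != 0.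
  by apply: filterS (gB _ (finite_set1 0)) => n h; apply/eqP => gn; apply: h.
have : \forall n \near \oo, norm2 (v (g n) - tau (v (g n)) *: idfun) <= 1 / 2.
  apply: (cvg0P _).1 triv _ _; last by lra.
  by move=> n; exact: sqrtr_ge0.
move=> /(filterI g0) /filter_ex[n [gn0]].
rewrite norm2E; last first.
  by rewrite addrC -scaleNr; apply: bounded_lin => //; exact: bounded_id.
rewrite -[X in L2norm X]/(v (g n) Om - tau (v (g n)) *: Om).
have -> : tau (v (g n)) = 0.
  rewrite /tau trace_vecE v_indv // add0r dot_indv_indv; try exact: measurable_cyl; try exact: cyl_lty.
  rewrite (_ : _ `&` _ = set0) ?measure0 //.
  apply/seteqP; split=> // -[k y] [[/= kg _] [/= k0 _]].
  by move: gn0; rewrite -kg k0 eqxx.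
rewrite scale0r subr0 unitary_norm; last by have [] := v_unitary mu (g n).
rewrite trace_vec_norm; lra.
Qed.

(** The trace vector is carried by the fibre over 0, where T_0 is the identity. *)
Lemma l_trace_vec A : measurable A -> l A Om = r A Om.
Proof.
move=> mA; rewrite trace_vecE.
have m0 : measurable (cyl (0 : G) [set: X]) by exact: measurable_cyl.
have f0 : (nu (cyl 0%R setT) < +oo)%E by exact: cyl_lty.
have E1 := mul_op_indv (cp_fun_bound HT (ess_bounded_ind mu mA)) m0 f0.
have E2 := mul_op_indv (r_bound mu G mA) m0 f0.
rewrite [LHS]E1 [RHS]E2; congr (to_L2 nu _); apply/funext => -[h y] /=.
have [->|h0] := eqVneq h 0.
  rewrite (mp_action_0 HT) /ind; congr ((_ : bool)%:R * _).
  by apply/idP/idP; rewrite !inE => // -[].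
rewrite [ind R (cyl 0 setT) _](_ : _ = 0) ?mulr0 //.
rewrite /ind (_ : _ \in _ = false) //.
by apply/negP; rewrite inE => -[/= h00]; move: h0; rewrite h00 eqxx.
Qed.

Lemma commutator_l_norm (x : H -> H) A : R_T mu T x -> measurable A ->
  x (l A Om) - l A (x Om) = r A (x Om) - l A (x Om).
Proof. by move=> Rx mA; rewrite l_trace_vec // (R_T_r HT). Qed.

End Implications.

(** * Spectral gap of nonrigid actions *)

Section Gap.
Context d (X : measurableType d) (R : realType) (mu : probability X R).
Variables (G : countZmodType) (T : G -> X -> X).
Hypothesis HT : mp_action mu T.
Local Notation nu := (counting_prod mu G).
Local Notation H := (L2 nu).
Local Notation Om := (trace_vec mu G).
Local Notation l := (@left_ind _ X R mu G T).
Implicit Types (g h : G) (A : set X) (u : H).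

(** Otherwise there are nonzero g_n with g_n in [near0] of 1/(n+1). By freeness the g_n eventually
    avoid each given element, hence leave every finite set and witness rigidity. *)
Lemma nonrigid_isolated (A : nat -> set X) : (forall i, measurable (A i)) ->
  separates_mod0 mu A -> generates_mod0 mu A -> free_action mu T ->
  ~ rigid_action mu T ->
  exists2 e : R, 0 < e & forall g, g != 0 -> ~ near0 mu T A e g.
Proof.
move=> mA sepA genA Tfree nrig; apply: contrapT => h; apply: nrig.
have n0 n : 0 < n.+1%:R^-1 :> R by rewrite invr_gt0.
have /choice[g Hg] : forall n, exists g, g != 0 /\ near0 mu T A n.+1%:R^-1 g.
  move=> n; apply: contrapT => h'; apply: h; exists n.+1%:R^-1 => // g g0 ng.
  by apply: h'; exists g.
have gnear (e : R) : 0 < e -> \forall n \near \oo, near0 mu T A e (g n).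
  move=> e0; have /cvgrPdist_le/(_ _ e0) := @cvg_harmonic R; apply: filterS => n.
  rewrite /harmonic /= sub0r normrN ger0_norm ?invr_ge0 // => ne.
  by apply: near0_le ne _; case: (Hg n).
apply/(rigidP HT); exists g; split; last exact: (near0_asymp_invariant HT mA genA gnear).
move=> B fB; have gB b : \forall n \near \oo, g n <> b.
  have [->|b0] := eqVneq b 0; first by apply: nearW => n; case: (Hg n) => /eqP.
  have [e e0 nb] := free_not_near0 HT mA sepA Tfree b0.
  by apply: filterS (gnear e e0) => n + gb; rewrite gb.
have : \forall n \near \oo, forall b, B b -> g n <> b.
  have /finite_seqP[s ->] := fB.
  elim: s => [|b s IH]; first by apply: nearW => n b; rewrite /= in_nil.
  apply: filterS2 (gB b) IH => n gb IH c /=.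
  by rewrite in_cons => /orP[/eqP -> //|]; exact: IH.
by apply: filterS => n hn Bgn; exact: (hn _ Bgn).
Qed.

(** The conditions defining [near0 e] hold automatically for large i, so the isolation of 0 is
    witnessed by finitely many sets; 2^i >= 1 makes [e] a common lower bound. *)
Lemma nonrigid_gap : standard_probability mu -> free_action mu T -> ~ rigid_action mu T ->
  exists (B : nat -> set X) (N : nat) (e : R), [/\ forall i, measurable (B i), 0 < e &
    forall h, h != 0 -> exists2 i, (i < N)%N & e <= disp mu T h (B i)].
Proof.
move=> /standard_countably_generated[A [mA sepA genA]] Tfree nrig.
have [e e0 he] := nonrigid_isolated mA sepA genA Tfree nrig.
have [N HN] : exists N, forall i, (N <= i)%N -> 1 <= 2 ^+ i * e.
  have /cvgrPdist_le/(_ _ e0)[N _ HN] : (fun n => 2^-1 ^+ n : R) @ \oo --> 0.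
    by apply: cvg_expr; rewrite ger0_norm //; lra.
  exists N => i /HN; rewrite sub0r normrN exprVn ger0_norm ?invr_ge0 ?exprn_ge0 //.
  by rewrite -[_^-1]mul1r ler_pdivrMr ?exprn_gt0 // mulrC.
exists A, N, e; split=> // h h0.
have [i hi] : exists i, ~ (disp mu T h (A i) <= 2 ^+ i * e).
  by apply: contrapT => nh; apply: (he h h0) => i; apply: contrapT => ni; apply: nh; exists i.
exists i.
  rewrite ltnNge; apply/negP => Ni; apply: hi.
  exact: le_trans (disp_le1 HT _ (mA i)) (HN i Ni).
apply: ltW; move/negP: hi; rewrite -ltNge; apply: le_lt_trans.
by rewrite ler_peMl ?(ltW e0) // exprn_ege1 // ler1n.
Qed.

Lemma trivial_of_gap (B : nat -> set X) (N : nat) (e : R) (x : nat -> H -> H) :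
  (forall i, measurable (B i)) -> 0 < e ->
  (forall h, h != 0 -> exists2 i, (i < N)%N & e <= disp mu T h (B i)) ->
  central_sequence mu T x -> (forall n, S_T mu G (x n)) -> trivial_sequence mu x.
Proof.
move=> mB e0 gap [Rx _ xc] Sx; have bx n := R_T_bounded HT (Rx n).
have key n : e * norm2 (x n - tau (x n) *: idfun) ^+ 2 <=
    \sum_(i < N) norm2 ((x n \o l (B i)) - (l (B i) \o x n)) ^+ 2.
  rewrite norm2E; last first.
    by rewrite addrC -scaleNr; apply: bounded_lin => //; exact: bounded_id.
  apply: le_trans (spectral_gap HT mB (ltW e0) gap (Sx n)) _.
  apply: ler_sum => i _; have bl := R_T_bounded HT (l_R_T (mB i)).
  rewrite norm2E; last by apply: bounded_sub; exact: bounded_comp.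
  rewrite -[X in _ <= L2norm X ^+ 2]/(x n (l (B i) Om) - l (B i) (x n Om)).
  by rewrite (commutator_l_norm HT (Rx n) (mB i)) -[X in _ <= L2norm X ^+ 2]opprB L2normN.
have sum0 : (\sum_(i < N) norm2 ((x n \o l (B i)) - (l (B i) \o x n)) ^+ 2)
    @[n --> \oo] --> (0 : R).
  elim: (index_enum _) => [|i s IH].
    by under eq_fun do rewrite big_nil; exact: cvg_cst.
  under eq_fun do rewrite big_cons.
  have h := xc _ (l_R_T (mB i)).
  have h2 := cvgM h h; rewrite mulr0 in h2.
  by have h3 := cvgD (h2 _) IH; rewrite addr0 in h3; exact: h3.
apply/cvg0P => [n|eps eps0]; first exact: sqrtr_ge0.
have c0 : 0 < e * eps ^+ 2 by rewrite mulr_gt0 ?exprn_gt0.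
have S0 n : 0 <= \sum_(i < N) norm2 ((x n \o l (B i)) - (l (B i) \o x n)) ^+ 2.
  by apply: sumr_ge0 => i _; exact: sqr_ge0.
have : \forall n \near \oo,
    \sum_(i < N) norm2 ((x n \o l (B i)) - (l (B i) \o x n)) ^+ 2 <= e * eps ^+ 2.
  exact: ((cvg0P S0).1 sum0 _ c0).
apply: filterS => n hn; rewrite -(@ler_pXn2r _ 2) ?nnegrE ?sqrtr_ge0 ?(ltW eps0) //.
by rewrite -(ler_pM2l e0); exact: le_trans (key n) hn.
Qed.

(** Let z = <xi, xi'> = p + iq. The vector xi - z xi' has squared norm 1 - |z|^2 <= dl, and pairing
    it with zeta gives |a - z a'|^2 <= dl. Hence q^2 <= 2 dl and p > 0, so p^2 >= 1 - 3 dl and |xi -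
    xi'|^2 = 2 - 2p <= 2(1 - p^2) <= 6 dl. *)
Lemma aligned_unit_vectors (xi xi' zeta : H) (a a' dl : R) :
  L2norm xi = 1 -> L2norm xi' = 1 -> L2norm zeta = 1 ->
  dot xi zeta = a%:C%C -> dot xi' zeta = a'%:C%C -> 0 <= a -> 0 <= a' ->
  1 / 2 <= a ^+ 2 -> 1 / 2 <= a' ^+ 2 -> dl < 1 / 2 -> 1 - dl <= nsq (dot xi xi') ->
  L2norm (xi - xi') ^+ 2 <= 6 * dl.
Proof.
move=> n1 n2 n3 xa xa' a0 a'0 a2 a'2 dl2 hz.
have p1 := rdot_le xi xi'; rewrite n1 n2 mulr1 in p1.
have w2 : L2norm (xi - dot xi xi' *: xi') ^+ 2 = 1 - nsq (dot xi xi').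
  rewrite L2normB_sq L2normZ_sq n1 n2 /rdot dotZr.
  by case: (dot xi xi') => p q; rewrite /nsq /=; ring.
have := nsq_dot_le (xi - dot xi xi' *: xi') zeta.
rewrite w2 n3 dotBl dotZl xa xa' expr1n mulr1 L2normB_sq n1 n2 expr1n.
move: hz p1; rewrite /rdot; case: (dot xi xi') => p q; rewrite /nsq /= => hz p1 h.
have h1 : (a - p * a') ^+ 2 + (q * a') ^+ 2 <= dl.
  by lra.
have q2 : q ^+ 2 <= 2 * dl.
  have : q ^+ 2 * a' ^+ 2 <= dl by have := sqr_ge0 (a - p * a'); nra.
  by have := sqr_ge0 q; nra.
have p0 : 0 < p.
  rewrite ltNge; apply/negP => p0.
  have s0 : a * (p * a') <= 0 by rewrite mulr_ge0_le0 // mulr_le0_ge0.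
  have : a ^+ 2 <= (a - p * a') ^+ 2 by have := sqr_ge0 (p * a'); lra.
  by have := sqr_ge0 (q * a'); lra.
nra.
Qed.

End Gap.

(** * Closedness of the inner automorphism group *)

Section Closed.
Context d (X : measurableType d) (R : realType) (mu : probability X R).
Variables (G : countZmodType) (T : G -> X -> X).
Hypothesis HT : mp_action mu T.
Local Notation nu := (counting_prod mu G).
Local Notation H := (L2 nu).
Local Notation Om := (trace_vec mu G).
Local Notation l := (@left_ind _ X R mu G T).
Local Notation r := (@right_ind _ X R mu G).
Implicit Types (g h : G) (A : set X) (u : H).

Lemma vN_scale (M : set (H -> H)) (k : R[i]) (a : H -> H) : von_neumann M -> M a -> M (k *: a).
Proof.
move=> vM Ma; rewrite (_ : k *: a = (k - 1) *: a + a); first exact: vN_lin.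
by rewrite scalerBl scale1r subrK.
Qed.

Lemma adj_scale (k : R[i]) (a : H -> H) : bounded_op a -> adj (k *: a) = conjc k *: adj a.
Proof.
move=> ba; apply: adj_unique => [|u w].
  by apply: (vN_scale _ (vN_bounded _)); exact: adj_bounded.
rewrite -[(k *: a) u]/(k *: a u) -[(_ *: adj a) w]/(conjc k *: adj a w).
by rewrite dotZl dotZr (adjP ba) conjcK.
Qed.

Lemma conj_phase (k : R[i]) (w a : H -> H) : nsq k = 1 -> bounded_op w -> linear a ->
  (k *: w) \o a \o adj (k *: w) = w \o a \o adj w.
Proof.
move=> k1 bw al; rewrite (adj_scale _ bw); apply/funext => u.
rewrite -[LHS]/(k *: w (a (conjc k *: adj w u))).
rewrite (linear_Z _ _ al) (linear_Z _ _ (bounded_op_lin bw)) scalerA.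
rewrite (_ : k * conjc k = 1) ?scale1r //.
by move: k1; case: (k) => p q; rewrite /nsq /= => k1; congr Complex; [rewrite -k1|]; ring.
Qed.

Lemma unitary_scale (k : R[i]) (w : H -> H) : nsq k = 1 -> unitary_op w -> unitary_op (k *: w).
Proof.
move=> k1 [bw wK Kw].
have kk : k * conjc k = 1.
  by move: k1; case: (k) => p q; rewrite /nsq /= => k1; congr Complex; [rewrite -k1|]; ring.
split; first by apply: (vN_scale _ (vN_bounded _)).
  rewrite (adj_scale _ bw); apply/funext => u.
  rewrite -[LHS]/(conjc k *: adj w (k *: w u)).
  rewrite (linear_Z _ _ (bounded_op_lin (adj_bounded w))) scalerA mulrC kk scale1r.
  by have /(congr1 (@^~ u)) := wK.
rewrite (adj_scale _ bw); apply/funext => u.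
rewrite -[LHS]/(k *: w (conjc k *: adj w u)).
rewrite (linear_Z _ _ (bounded_op_lin bw)) scalerA kk scale1r.
by have /(congr1 (@^~ u)) := Kw.
Qed.

Lemma r_norm_le A u : measurable A -> L2norm (r A u) <= L2norm u.
Proof.
move=> mA; rewrite -(@ler_pXn2r _ 2) ?nnegrE ?L2norm_ge0 //.
by have := mul_op_norm u (r_bound mu G mA); rewrite mul1r.
Qed.

(* Bounded nets in [R_T] converge strongly once they are Cauchy at the trace
   vector, which is cyclic for the commutant. *)
Lemma R_T_cauchy (I : Type) (F : set_system I) {FF : ProperFilter F} (A : I -> H -> H) :
  (forall i, R_T mu T (A i)) -> (forall i, op_bound (A i) 1) ->
  L2norm (A p.1 Om - A p.2 Om) @[p --> filter_prod F F] --> (0 : R) ->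
  exists a, bounded_op a /\ strong_cvg F A a.
Proof.
move=> RA A1 AC; have Al i : linear (A i) by exact: bounded_op_lin (R_T_bounded HT (RA i)).
have [|a [ba _ Aa]] := strong_cauchy (F := F) Al A1; last by exists a.
pose D (p : I * I) u := A p.1 u - A p.2 u.
have Dl p : linear (D p).
  by move=> k u w; rewrite /D !Al opprD addrACA scalerBr.
suff h : forall u, [set u | L2norm (D p u - (fun=> 0 : H) u) @[p --> filter_prod F F] --> (0 : R)] u.
  move=> u; have := h u => /=; rewrite (_ : (fun p => _) = fun p => L2norm (A p.1 u - A p.2 u)) //.
  by apply/funext => p; rewrite subr0.
apply: (@cyl_dense _ _ _ mu G).
  apply: (@strong_cvg_subspace _ _ _ _ _ _ _ _ _ 2) => //.
  - by move=> k u w; rewrite scaler0 addr0.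
  - move=> p u; apply: le_trans (ler_L2normD _ _) _; rewrite L2normN mulr_natl mulr2n.
    by apply: lerD; have := A1 _ u; rewrite mul1r; apply.
  - by move=> u; rewrite L2norm0 mulr_ge0 ?L2norm_ge0.
move=> g B mB /=; apply: (L2norm_cvg_le (h := fun p => L2norm (A p.1 Om - A p.2 Om))) => //.
move=> p; rewrite subr0 /D (R_T_indv HT g (RA p.1) mB) (R_T_indv HT g (RA p.2) mB).
have Ul := bounded_op_lin (U_bounded (mu := mu) HT (- g)).
have rl := bounded_op_lin (r_bounded mu G mB).
rewrite -(linear_B _ _ rl) -(linear_B _ _ Ul).
by apply: le_trans (r_norm_le _ mB) _; rewrite (U_norm HT).
Qed.

(** The identity |x^* Omega| = |x Omega| is applied to the differences A_i - A_j. *)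
Lemma R_T_adj_cauchy (I : Type) (F : set_system I) {FF : ProperFilter F} (A : I -> H -> H) :
  (forall i, R_T mu T (A i)) ->
  L2norm (A p.1 Om - A p.2 Om) @[p --> filter_prod F F] --> (0 : R) ->
  L2norm (adj (A p.1) Om - adj (A p.2) Om) @[p --> filter_prod F F] --> (0 : R).
Proof.
move=> RA; rewrite (_ : (fun p : I * I => L2norm (A p.1 Om - A p.2 Om)) =
  fun p => L2norm (adj (A p.1) Om - adj (A p.2) Om)) //.
apply/funext => p; have vM := R_T_vN HT.
have := adj_trace_norm HT (vN_sub vM (RA p.1) (RA p.2)).
rewrite -[X in _ = L2norm X]/(A p.1 Om - A p.2 Om) => <-.
rewrite addrC -scaleN1r adj_lin; try exact: (R_T_bounded HT (RA _)).
rewrite rmorphN1 -[X in L2norm X]/(-1 *: adj (A p.2) Om + adj (A p.1) Om).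
by rewrite scaleN1r addrC.
Qed.

Lemma trace_projection_norm u : L2norm u = 1 ->
  L2norm (u - dot u Om *: Om) ^+ 2 = 1 - nsq (dot u Om).
Proof.
move=> u1; rewrite L2normB_sq L2normZ_sq u1 trace_vec_norm /rdot dotZr.
by case: (dot u Om) => p q; rewrite /nsq /=; ring.
Qed.

(* If [Ad w] and [Ad w'] are close at the functions witnessing the gap, then
   [w'^* w] almost commutes with them, hence is almost scalar. *)
Lemma Ad_close_phase (B : nat -> set X) (N : nat) (e eta : R) (w w' : H -> H) :
  (forall i, measurable (B i)) -> 0 <= e -> 0 <= eta ->
  (forall h, h != 0 -> exists2 i, (i < N)%N & e <= disp mu T h (B i)) ->
  S_T mu G w -> unitary_op w -> S_T mu G w' -> unitary_op w' ->
  (forall i, (i < N)%N -> L2norm ((w \o l (B i) \o adj w) Om - (w' \o l (B i) \o adj w') Om) <= eta) ->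
  e * (1 - nsq (dot (w Om) (w' Om))) <= N%:R * eta ^+ 2.
Proof.
move=> mB e0 eta0 gap Sw uw Sw' uw' close.
have [bw wK Kw] := uw; have [bw' wK' Kw'] := uw'.
have vR := R_T_vN HT; have Rw := S_T_sub HT Sw; have Rw' := S_T_sub HT Sw'.
pose b := adj w' \o w.
have Sb : S_T mu G b.
  exact: (vN_comp (S_T_vN mu G) (vN_adj (S_T_vN mu G) Sw') Sw).
have bOm : L2norm (b Om) = 1.
  by rewrite /b /= (unitary_norm _ (unitary_adj uw')) (unitary_norm _ uw) trace_vec_norm.
have tb : tau b = dot (w Om) (w' Om).
  by rewrite /tau /b /= (adjP (adj_bounded w')) (adjK bw').
have := spectral_gap HT mB e0 gap Sb.
rewrite [tau b]/tau trace_projection_norm // -/(tau b) tb => /le_trans; apply.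
rewrite (_ : N%:R * eta ^+ 2 = \sum_(i < N) eta ^+ 2); last first.
  by rewrite sumr_const card_ord mulr_natl.
apply: ler_sum => i _; have mBi := mB i.
have Rl : R_T mu T (l (B i)) by exact: l_R_T.
have Rb := S_T_sub HT Sb.
rewrite lerXn2r ?nnegrE ?L2norm_ge0 //.
rewrite L2normB -(commutator_l_norm HT Rb mBi).
pose z := (w \o l (B i) \o adj w) - (w' \o l (B i) \o adj w').
have Rz : R_T mu T z.
  apply: (vN_sub vR).
    exact: (vN_comp vR (vN_comp vR Rw Rl) (vN_adj vR Rw)).
  exact: (vN_comp vR (vN_comp vR Rw' Rl) (vN_adj vR Rw')).
(* The commutator of b = w'^* w with 1_(B_i) is w'^* z w. *)
have E u : b (l (B i) u) - l (B i) (b u) = adj w' (z (w u)).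
  rewrite -[z _]/(w (l (B i) (adj w (w u))) - w' (l (B i) (adj w' (w u)))).
  rewrite (linear_B _ _ (bounded_op_lin (adj_bounded w'))).
  have /(congr1 (@^~ u))/= -> := wK.
  by have /(congr1 (@^~ (l (B i) (adj w' (w u)))))/= -> := wK'.
rewrite E (unitary_norm _ (unitary_adj uw')).
(* The factor w on the right is removed by passing to adjoints: |z w Omega| = |w^* z^* Omega| = |z^*
   Omega| = |z Omega|. *)
rewrite -[z (w Om)]/((z \o w) Om) -(adj_trace_norm HT (vN_comp vR Rz Rw)).
rewrite (adj_comp (R_T_bounded HT Rz) bw) /= (unitary_norm _ (unitary_adj uw)).
by rewrite (adj_trace_norm HT Rz); exact: close (ltn_ord i).
Qed.

Lemma gap_closed (B : nat -> set X) (N : nat) (e : R) :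
  (forall i, measurable (B i)) -> 0 < e ->
  (forall h, h != 0 -> exists2 i, (i < N)%N & e <= disp mu T h (B i)) ->
  closed_in_aut (R_T mu T) (inner_aut (R_T mu T) (S_T mu G)).
Proof.
move=> mB e0 gap theta vth F FF FI Fcv.
pose I := inner_aut (R_T mu T) (S_T mu G).
pose implements (w : H -> H) (sigma : (H -> H) -> (H -> H)) := [/\ S_T mu G w, unitary_op w &
  forall a, R_T mu T a -> sigma a = w \o a \o adj w].
have Rl i : R_T mu T (l (B i)) by exact: l_R_T.
have close (dl : R) : 0 < dl -> exists2 P : set ((H -> H) -> (H -> H)), F P &
    forall s s' w w', P s -> P s' -> implements w s -> implements w' s' ->
      1 - dl <= nsq (dot (w Om) (w' Om)).
  (* [eta] is fitted to N eta^2 <= e dl, using eta <= 1 and eta (N + 1) <= e dl; the successor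
     avoids a division by zero. *)
  move=> dl0; pose N1 : R := (N.+1)%:R.
  have N10 : 0 < N1 by rewrite ltr0n.
  pose eta := Num.min 1 (e * dl / N1).
  have eta0 : 0 < eta by rewrite lt_min ltr01 divr_gt0 ?mulr_gt0.
  have eta2 : N%:R * eta ^+ 2 <= e * dl.
    have h1 : eta <= 1 by rewrite ge_min lexx.
    have h2 : eta * N1 <= e * dl by rewrite -ler_pdivlMr // ge_min lexx orbT.
    have h3 : N%:R <= N1 by rewrite ler_nat.
    apply: le_trans h2; rewrite mulrC ler_pM ?sqr_ge0 ?ler0n //.
    by rewrite expr2 ler_piMr // ltW.
  have eta20 : 0 < eta / 2 by rewrite divr_gt0.
  pose P := [set s : (H -> H) -> (H -> H) |
    forall i : 'I_N, L2norm (s (l (B i)) Om - theta (l (B i)) Om) <= eta / 2].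
  exists P.
    apply: filter_forall => i.
    exact: ((cvg0P (fun s => L2norm_ge0 _)).1 (Fcv _ (Rl i) Om) _ eta20).
  move=> s s' w w' Ps Ps' [Sw uw sw] [Sw' uw' sw'].
  have := Ad_close_phase mB (ltW e0) (ltW eta0) gap Sw uw Sw' uw' _.
  have hc i : (i < N)%N ->
      L2norm ((w \o l (B i) \o adj w) Om - (w' \o l (B i) \o adj w') Om) <= eta.
    move=> iN; rewrite -sw // -sw' //.
    apply: le_trans (ler_L2norm_dist _ (theta (l (B i)) Om) _) _.
    rewrite (splitr eta) lerD //; first exact: (Ps (Ordinal iN)).
    by rewrite L2normB; exact: (Ps' (Ordinal iN)).
  move=> /(_ hc) /le_trans/(_ eta2); rewrite ler_pM2l //; lra.
(* With 1/2, every unitary implementing an element of [P0] has an inner product bounded away from 0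
   with the reference [w0], so its phase can be normalised. *)
have [P0 FP0 hP0] := close (1 / 2) ltac:(lra).
have FPI : F (P0 `&` I) by exact: filterI.
have [s0 [P0s0 [_ [w0 [Sw0 uw0 sw0]]]]] := filter_ex FPI.
pose zeta := w0 Om.
pose good (w : H -> H) (sigma : (H -> H) -> (H -> H)) := implements w sigma /\
  exists a : R, [/\ 0 <= a, 1 / 2 <= a ^+ 2 & dot (w Om) zeta = a%:C%C].
have /choice[w Hw] : forall s, exists w, [/\ S_T mu G w, unitary_op w &
    (P0 `&` I) s -> good w s].
  move=> s; have [[P0s [_ [w [Sw uw sw]]]]|ns] := pselect ((P0 `&` I) s); last first.
    (* A default value off the intersection of [P0] and [I], which is a member of [F]. *)
    exists id; split=> //; first exact: vN_id (S_T_vN mu G).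
    by split; rewrite ?adj_id //; exact: bounded_id.
  have iw : implements w s by split.
  have iw0 : implements w0 s0 by split.
  have := hP0 _ _ _ _ P0s P0s0 iw iw0; rewrite -/zeta; set c := dot (w Om) zeta => hc.
  pose m := Num.sqrt (nsq c).
  have m2 : m ^+ 2 = nsq c by rewrite sqr_sqrtr ?nsq_ge0.
  have m0 : 0 < m by rewrite sqrtr_gt0; lra.
  (* The phase conj(c)/|c| makes the inner product with [zeta] equal to |c| and leaves Ad w
     unchanged. *)
  pose k : R[i] := (m^-1)%:C%C * conjc c.
  have k1 : nsq k = 1.
    rewrite nsqM nsqC -m2 /nsq /= expr0n addr0; field; by rewrite gt_eqF.
  have bw : bounded_op w by case: uw.
  exists (k *: w); have ukw := unitary_scale k1 uw.
  have Skw := vN_scale k (S_T_vN mu G) Sw.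
  split=> // _; split.
    split=> // a Ra; rewrite conj_phase //; first exact: sw.
    exact: bounded_op_lin (R_T_bounded HT Ra).
  exists m; split; [exact: ltW|by rewrite m2; lra|].
  rewrite -[(k *: w) Om]/(k *: w Om) dotZl -/c /k.
  rewrite -mulrA (_ : conjc c * c = (m ^+ 2)%:C%C).
    by rewrite -rmorphM /= expr2 mulrA mulVf ?mul1r // gt_eqF.
  by rewrite m2; case: (c) => p q; rewrite /nsq /=; congr Complex; ring.
have Sw s : S_T mu G (w s) by case: (Hw s).
have uw s : unitary_op (w s) by case: (Hw s).
have wgood s : (P0 `&` I) s -> good (w s) s by case: (Hw s).
have Rw s : R_T mu T (w s) by exact: (S_T_sub HT).
have wC : L2norm (w p.1 Om - w p.2 Om) @[p --> filter_prod F F] --> (0 : R).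
  apply/cvg_pairP => [p|eps eps0]; first exact: L2norm_ge0.
  (* 6 dl <= eps^2 fits the alignment estimate, and 1/4 stays below its threshold 1/2. *)
  pose dl := Num.min (1 / 4) (eps ^+ 2 / 6).
  have dl0 : 0 < dl by rewrite lt_min !divr_gt0 ?exprn_gt0.
  have [P FP hP] := close dl dl0.
  exists (P `&` (P0 `&` I)); first exact: filterI.
  move=> s s' [Ps gs] [Ps' gs'] /=.
  have [is_ [a [a0 a2 sa]]] := wgood _ gs; have [is' [a' [a'0 a'2 sa']]] := wgood _ gs'.
  have n1 t : L2norm (w t Om) = 1 by rewrite unitary_norm // trace_vec_norm.
  have nz : L2norm zeta = 1 by rewrite /zeta unitary_norm // trace_vec_norm.
  rewrite -(@ler_pXn2r _ 2) ?nnegrE ?L2norm_ge0 ?(ltW eps0) //.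
  have h1 : dl <= 1 / 4 by rewrite ge_min lexx.
  have h2 : dl <= eps ^+ 2 / 6 by rewrite ge_min lexx orbT.
  apply: le_trans (aligned_unit_vectors (n1 s) (n1 s') nz sa sa' a0 a'0 a2 a'2 _
    (hP _ _ _ _ Ps Ps' is_ is')) _; lra.
have w1 s : op_bound (w s) 1 by move=> u; rewrite mul1r unitary_norm.
have w1' s : op_bound (adj (w s)) 1.
  by move=> u; rewrite mul1r (unitary_norm _ (unitary_adj (uw s))).
have [a [ba wa]] := R_T_cauchy Rw w1 wC.
have Rw' s : R_T mu T (adj (w s)) by exact: (vN_adj (R_T_vN HT) (Rw s)).
have [b [bb wb]] := R_T_cauchy Rw' w1' (R_T_adj_cauchy Rw wC).
have [ua adja] := unitary_strong_limit uw ba bb wa wb.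
split=> //; exists a; split=> //.
  by apply: (strong_cvg_vN (S_T_vN mu G) _ ba wa); apply: nearW.
move=> c Rc; have bc := R_T_bounded HT Rc; have [rc [rc0 hrc]] := bounded_opP bc.
have wl s : linear (w s) by case: (uw s) => bw _ _; exact: bounded_op_lin.
have c_cst : strong_cvg F (fun=> c) c.
  by move=> u; rewrite subrr L2norm0; exact: cvg_cst.
have h1 := strong_cvg_comp (fun=> bounded_op_lin bc) (fun=> hrc) c_cst wb.
have h2 := strong_cvg_comp wl w1 wa (h1 FF).
(* Along [F] the vectors s(c) u tend to theta(c) u by assumption and to a c a^* u by
   construction. *)
rewrite adja; apply/funext => u.
apply: (@L2_cvg_unique _ _ _ _ _ F _ (fun s => s c u)); first exact: Fcv.
apply: cvg_trans (h2 FF u); apply: near_eq_cvg.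
apply: filterS FPI => s gs; have [[_ _ sw] _] := wgood _ gs.
by rewrite /= (sw _ Rc).
Qed.

End Closed.

(** * A limit of inner automorphisms that is not inner *)

Section NotClosed.
Context d (X : measurableType d) (R : realType) (mu : probability X R).
Variables (G : countZmodType) (T : G -> X -> X).
Hypothesis HT : mp_action mu T.
Local Notation nu := (counting_prod mu G).
Local Notation H := (L2 nu).
Local Notation Om := (trace_vec mu G).
Local Notation v := (@cp_unit _ X R mu G).
Local Notation W := (@koopman_amp _ X R mu G T).
Local Notation l := (@left_ind _ X R mu G T).
Local Notation r := (@right_ind _ X R mu G).
Implicit Types (g h : G) (A : set X) (u : H).

(* Nested balls of a nondiscrete metrizable topology: the limit of [s] avoids
   every point of the countable group. *)
Lemma escaping_sequence (A : nat -> set X) : (forall i, measurable (A i)) ->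
  (forall g, g != 0 -> exists2 e : R, 0 < e & ~ near0 mu T A e g) ->
  (forall e : R, 0 < e -> exists2 g, g != 0 & near0 mu T A e g) ->
  exists (s : nat -> G) (rho : nat -> R), [/\ forall k, 0 < rho k,
    forall k, rho k <= 2^-1 ^+ k,
    forall k m, (k <= m)%N -> near0 mu T A (rho k) (s m - s k) &
    forall h, exists k, ~ near0 mu T A (2 * rho k) (h - s k)].
Proof.
move=> mA sep nondisc.
(* [p] consists of the element h to avoid, the current centre and its radius; [q] is the next centre
   and radius. *)
have step (p : G * (G * R)) : exists q : G * R, 0 < p.2.2 ->
    [/\ 0 < q.2, q.2 <= p.2.2 / 2, near0 mu T A (p.2.2 / 2) (q.1 - p.2.1) &
     ~ near0 mu T A (2 * q.2) (p.1 - q.1)].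
  case: p => h [s e] /=; have [e0|ne0] := pselect (0 < e); last by exists (s, e).
  have e2 : 0 < e / 2 by rewrite divr_gt0.
  have fin s' (c : R) : near0 mu T A (e / 2) (s' - s) -> 0 < c ->
      ~ near0 mu T A c (h - s') -> exists q : G * R, 0 < e ->
      [/\ 0 < q.2, q.2 <= e / 2, near0 mu T A (e / 2) (q.1 - s) & ~ near0 mu T A (2 * q.2) (h - q.1)].
    move=> ns c0 nc; exists (s', Num.min (e / 2) (c / 2)) => _ /=; split=> //.
    - by rewrite lt_min e2 divr_gt0.
    - by rewrite ge_min lexx.
    - move=> nn; apply: nc; apply: near0_le nn.
      have : Num.min (e / 2) (c / 2) <= c / 2 by rewrite ge_min lexx orbT.
      by lra.
  (* If h is the current centre, the centre moves by a small nonzero element; otherwise it stays and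
     only the radius shrinks. *)
  have [hs|hs] := eqVneq h s.
    have [g g0 ng] := nondisc _ e2.
    have [|c c0 nc] := sep (- g); first by rewrite oppr_eq0.
    apply: (fin (s + g) c) => //; first by rewrite addrC addKr.
    by rewrite hs opprD addrA subrr add0r.
  have [|c c0 nc] := sep (h - s); first by rewrite subr_eq0.
  by apply: (fin s c) => //; rewrite subrr; exact: (near0_zero A HT (ltW e2)).
have /choice[f Hf] := step.
(* Stage [pickle h] deals with h; codes of no element fall back to 0. *)
pose hk k : G := odflt 0 (unpickle k).
pose q := fix q k : G * R := if k is k'.+1 then f (hk k', q k') else (0, 1).
have q0 k : 0 < (q k).2.
  by elim: k => [|k IH] //=; have [] := Hf (hk k, q k) IH.
have qS k := Hf (hk k, q k) (q0 k).
have q_half k : (q k.+1).2 <= (q k).2 / 2 by have [] := qS k.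
exists (fun k => (q k).1), (fun k => (q k).2); split=> // [k|k m km|h].
- elim: k => [|k IH]; first by rewrite expr0 /= lexx.
  by apply: le_trans (q_half k) _; rewrite exprS; lra.
- have near_add n : near0 mu T A ((q k).2 - (q (k + n)%N).2) ((q (k + n)%N).1 - (q k).1).
    elim: n => [|n IH]; first by rewrite addn0 !subrr; exact: (near0_zero A HT).
    rewrite addnS; have [_ _ n1 _] := qS (k + n)%N.
    have := near0D HT mA n1 IH; rewrite [(_ - _) + ((q _).1 - _)]addrA subrK.
    by apply: near0_le; have := q_half (k + n)%N; rewrite /=; lra.
  have := near_add (m - k)%N; rewrite subnKC //.
  by apply: near0_le; have := q0 m; lra.
- exists (pickle h).+1.
  have n1 : ~ near0 mu T A (2 * (q (pickle h).+1).2) (hk (pickle h) - (q (pickle h).+1).1).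
    by have [] := qS (pickle h).
  by rewrite [hk _](_ : _ = h) in n1; last by rewrite /hk pickleK.
Qed.

Lemma integral_counting_ge (f : discr G -> R) h : (forall k, 0 <= f k) ->
  ((f h)%:E <= \int[@counting (discr G) R]_k (f k)%:E)%E.
Proof.
move=> f0; have <- : (\int[@counting (discr G) R]_(k in [set h]) (f k)%:E = (f h)%:E)%E.
  rewrite (@eq_integral _ _ _ _ _ (cst (f h)%:E)); last by move=> k; rewrite inE => ->.
  transitivity ((f h)%:E * @counting (discr G) R [set h])%E; first exact: integral_cst.
  rewrite (_ : counting _ = 1%E) ?mule1 //.
  by rewrite /counting asboolT // fset_set1 finmap.cardfs1.
by apply: ge0_subset_integral => // k _; rewrite lee_fin.
Qed.

Lemma coef_neq0 (x : H -> H) : S_T mu G x -> x Om <> 0 -> exists h, coef x h <> 0.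
Proof.
move=> Sx x0; apply: contrapT => nh; apply: x0.
apply/L2_eqP; apply: filterS2 (S_T_const Sx) (L20_ae nu) => p -> ->.
by apply: contrapT => c0; apply: nh; exists p.1.
Qed.

Lemma coef_v g (x : H -> H) h : coef (v (- g) \o x) h = coef x (h + g).
Proof.
rewrite /coef /= (adjP (v_bounded mu (- g))) (v_unitary mu (- g)).2 opprK.
by rewrite v_indv.
Qed.

Lemma W_conj g (a : H -> H) : R_T mu T a -> W g \o a \o W (- g) = v g \o a \o v (- g).
Proof.
move=> Ra; apply/funext => u /=; rewrite !(WE HT).
by rewrite (R_T_U HT _ _ Ra) -(U_v HT (- g) g) (UK HT).
Qed.

Lemma v_conj_R_T g (a : H -> H) : R_T mu T a -> R_T mu T (v g \o a \o v (- g)).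
Proof.
move=> Ra; have vR := R_T_vN HT; have Rv k := S_T_sub HT (v_S_T k).
exact: (vN_comp vR (vN_comp vR (Rv _) Ra) (Rv _)).
Qed.

Lemma rigid_not_closed (A : nat -> set X) : (forall i, measurable (A i)) ->
  separates_mod0 mu A -> generates_mod0 mu A -> free_action mu T -> rigid_action mu T ->
  ~ closed_in_aut (R_T mu T) (inner_aut (R_T mu T) (S_T mu G)).
Proof.
move=> mA sepA genA Tfree /(rigidP HT)[g [gB ginv]] closed.
have nondisc (e : R) : 0 < e -> exists2 g, g != 0 & near0 mu T A e g.
  move=> e0; have g0 : \forall n \near \oo, g n != 0.
    by apply: filterS (gB _ (finite_set1 0)) => n h; apply/eqP => gn; apply: h.
  have : \forall n \near \oo, near0 mu T A e (g n).
    exact: (asymp_invariant_near0 HT mA (fun i => ginv _ (mA i)) e0).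
  by move=> /(filterI g0)/filter_ex[n [gn0 gne]]; exists (g n).
have [s [rho [rho0 rho_le s_near s_esc]]] :=
  escaping_sequence mA (fun g => free_not_near0 HT mA sepA Tfree (g := g)) nondisc.
have rho_small (e : R) : 0 < e -> exists K, rho K <= e.
  move=> e0; have /cvgrPdist_le/(_ _ e0)[N _ HN] : (fun n => 2^-1 ^+ n : R) @ \oo --> 0.
    by apply: cvg_expr; rewrite ger0_norm //; lra.
  exists N; apply: le_trans (rho_le N) _; have := HN N (leqnn N).
  by rewrite sub0r normrN ger0_norm // exprn_ge0.
have sC : forall E, measurable E ->
    asymp_invariant mu T (filter_prod \oo \oo) (fun p : nat * nat => s p.1 - s p.2) E.
  apply: (near0_asymp_invariant HT mA genA) => e e0.
  have [|K Ke] := rho_small (e / 2); first by rewrite divr_gt0.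
  exists ([set n | (K <= n)%N], [set n | (K <= n)%N]).
    by split; exists K.
  move=> [m n] [/= Km Kn].
  have := near0D HT mA (s_near _ _ Km) (near0N HT mA (s_near _ _ Kn)).
  rewrite opprB addrA subrK; apply: near0_le; lra.
(* [sg] stands for the identity or for negation: the operators at s_k and at -s_k must both converge
   for the limit to be unitary. *)
have WC (sg : G -> G) : (forall a b, sg (a - b) = sg a - sg b) ->
    (forall E, measurable E -> asymp_invariant mu T (filter_prod \oo \oo)
      (fun p : nat * nat => sg (s p.1 - s p.2)) E) ->
    forall u, L2norm (W (sg (s p.1)) u - W (sg (s p.2)) u)
      @[p --> filter_prod \oo \oo] --> (0 : R).
  move=> sgB h u; apply: cvg_trans (W_strong_cvg HT h u).
  rewrite (_ : (fun p => _) = fun p => L2norm (W (sg (s p.1 - s p.2)) u - id u)) //.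
  apply/funext => p; have Wl := bounded_op_lin (W_bounded (mu := mu) HT (sg (s p.2))).
  by rewrite -[RHS](W_norm HT (sg (s p.2))) (linear_B _ _ Wl) (WD HT) sgB (addrC (sg (s p.2))) subrK.
have Wb g' : op_bound (W g') 1 by move=> u; rewrite mul1r (W_norm HT).
have Wl g' : linear (W g') by exact: bounded_op_lin (W_bounded HT g').
have [|a [ba _ Wa]] := strong_cauchy (F := \oo) (fun k => Wl (s k)) (fun k => Wb (s k)).
  by apply: (WC id) => //; exact: sC.
have [|b [bb _ Wb']] := strong_cauchy (F := \oo) (fun k => Wl (- s k)) (fun k => Wb (- s k)).
  apply: (WC -%R) => [x y|E mE]; first by rewrite opprB addrC opprK.
  have [_ h] := sC E mE; split=> // e e0; apply: filterS (h e e0) => p.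
  by rewrite (dispN HT).
have uW g' : unitary_op (W g') /\ adj (W g') = W (- g').
  split; last exact: W_adj.
  split; first exact: W_bounded.
    by apply/funext => u; rewrite (W_adj HT) /= (WD HT) addNr (W0 HT).
  by apply/funext => u; rewrite (W_adj HT) /= (WD HT) subrr (W0 HT).
have [ua adja] : unitary_op a /\ adj a = b.
  apply: (unitary_strong_limit (F := \oo) (fun k => (uW (s k)).1) ba bb Wa).
  by rewrite (_ : (fun k => _) = fun k => W (- s k)) //; apply/funext => k; rewrite (W_adj HT).
(* Conjugation by v_g and by [W g] agree on [R_T], so convergence is inherited from the [W]. *)
have conj_cvg (t : nat -> G) (a' b' c : H -> H) : strong_cvg \oo (fun k => W (t k)) a' ->
    strong_cvg \oo (fun k => W (- t k)) b' -> R_T mu T c ->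
    strong_cvg \oo (fun k => v (t k) \o c \o v (- t k)) (a' \o c \o b').
  move=> ta tb Rc; have bc := R_T_bounded HT Rc; have [rc [rc0 hrc]] := bounded_opP bc.
  have c_cst : strong_cvg \oo (fun _ : nat => c) c.
    by move=> u; rewrite subrr L2norm0; exact: cvg_cst.
  have h1 := strong_cvg_comp (fun=> bounded_op_lin bc) (fun=> hrc) c_cst tb.
  have h2 := strong_cvg_comp (fun k => Wl (t k)) (fun k => Wb (t k)) ta (h1 _).
  rewrite (_ : (fun k => _) = fun k => W (t k) \o (c \o W (- t k))); first exact: h2.
  by apply/funext => k; rewrite -W_conj.
have vR := R_T_vN HT.
have Rconj (t : nat -> G) (a' b' c : H -> H) : bounded_op a' -> bounded_op b' ->
    strong_cvg \oo (fun k => W (t k)) a' ->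
    strong_cvg \oo (fun k => W (- t k)) b' -> R_T mu T c -> R_T mu T (a' \o c \o b').
  move=> ba' bb' ta tb Rc; apply: (strong_cvg_vN vR _ _ (conj_cvg _ _ _ _ ta tb Rc)).
    by apply: nearW => k; exact: v_conj_R_T.
  exact: (bounded_comp (bounded_comp ba' (R_T_bounded HT Rc)) bb').
(* Replacing s_k by -s_k exchanges the roles of [a] and [b] and shows that the inverse conjugation
   preserves [R_T]. *)
have Wbb : strong_cvg \oo (fun k => W (- - s k)) a.
  by rewrite (_ : (fun k => _) = fun k => W (s k)) //; apply/funext => k; rewrite opprK.
pose theta (c : H -> H) := a \o c \o adj a.
have th_aut : vN_aut (R_T mu T) theta.
  apply: vN_aut_Ad => // c Rc; rewrite adja; first exact: Rconj Wa Wb' Rc.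
  exact: Rconj Wb' Wbb Rc.
pose Phi (k : nat) (c : H -> H) := v (s k) \o c \o adj (v (s k)).
have PhiI k : inner_aut (R_T mu T) (S_T mu G) (Phi k).
  have Rv := S_T_sub HT (v_S_T (s k)); have [uv _] := v_unitary mu (s k).
  by split; [exact: vN_aut_Ad_mem|exists (v (s k)); split=> //; exact: v_S_T].
have PhiE k c : Phi k c = v (s k) \o c \o v (- s k) by rewrite /Phi (v_unitary mu (s k)).2.
have Phi_cvg c : R_T mu T c -> strong_cvg \oo (fun k => Phi k c) (theta c).
  move=> Rc; rewrite /theta adja (_ : (fun k => _) = fun k => v (s k) \o c \o v (- s k)).
    exact: conj_cvg Wa Wb' Rc.
  by apply/funext => k; rewrite PhiE.
have [_ [w [Sw uw thw]]] : inner_aut (R_T mu T) (S_T mu G) theta.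
  apply: (closed theta th_aut (Phi @ \oo) _ _ Phi_cvg).
  by exists 0%N => // k _; exact: PhiI.
have wOm : w Om <> 0.
  move=> w0; have := unitary_norm Om uw; rewrite w0 L2norm0 trace_vec_norm => /eqP.
  by rewrite eq_sym oner_eq0.
have [h ch] := coef_neq0 Sw wOm.
have c0 : 0 < nsq (coef w h).
  by rewrite lt_neqAle nsq_ge0 andbT eq_sym; apply/eqP => /nsq_eq0.
(* If theta = Ad w, then Ad v_(s_k) and Ad w nearly agree on 1_E at w Omega. Pulled back by v_(s_k),
   this bounds the commutator of 1_E with y = v_(-s_k) w, whose coefficient at h - s_k is that of w
   at h; this single term bounds the displacement of E by h - s_k. *)
have inv E : measurable E -> asymp_invariant mu T \oo (fun k => h - s k) E.
  move=> mE; split=> // e e0.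
  have Rl : R_T mu T (l E) by exact: l_R_T.
  have bw : bounded_op w by case: uw.
  have := Phi_cvg _ Rl (w Om); rewrite thw //.
  have -> : (w \o l E \o adj w) (w Om) = r E (w Om).
    rewrite /= -[adj w (w Om)]/((adj w \o w) Om); have [_ -> _] := uw.
    by rewrite (l_trace_vec HT) // (R_T_r HT) //; exact: S_T_sub.
  move=> Pc; pose m := nsq (coef w h) * (2 * e).
  have m0 : 0 < m by rewrite !mulr_gt0.
  have sm0 : 0 < Num.sqrt m by rewrite sqrtr_gt0.
  have : \forall k \near \oo, L2norm (Phi k (l E) (w Om) - r E (w Om)) <= Num.sqrt m.
    exact: ((cvg0P (fun k => L2norm_ge0 _)).1 Pc _ sm0).
  apply: filterS => k; rewrite -(@ler_pXn2r _ 2) ?nnegrE ?L2norm_ge0 ?sqrtr_ge0 //.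
  rewrite (sqr_sqrtr (ltW m0)) => hk.
  pose y := v (- s k) \o w.
  have Sy : S_T mu G y := vN_comp (S_T_vN mu G) (v_S_T (- s k)) Sw.
  have E1 : Phi k (l E) (w Om) - r E (w Om) = v (s k) (l E (y Om) - r E (y Om)).
    have vl := bounded_op_lin (v_bounded mu (s k)).
    rewrite (linear_B _ _ vl) -(r_v _ _ mE) /y /= (vD (mu := mu)) subrr v0.
    by rewrite PhiE.
  have := commutator_norm HT Sy mE.
  move: hk; rewrite E1 (unitary_norm _ (v_unitary mu (s k)).1) => hk hE.
  have := @integral_counting_ge (fun k' => nsq (coef y k') * (2 * disp mu T k' E)) (h - s k) _.
  have nn k' : 0 <= nsq (coef y k') * (2 * disp mu T k' E).
    by rewrite mulr_ge0 ?nsq_ge0 // mulr_ge0 ?disp_ge0.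
  move=> /(_ nn); rewrite -hE lee_fin => /le_trans/(_ hk).
  by rewrite /y coef_v subrK /m ler_pM2l // ler_pM2l.
(* For large k both h - s_k and s_k - s_K are within rho_K, so h - s_K is within 2 rho_K; this is
   the origin of the factor 2 in the escape condition. *)
have [K nK] := s_esc h; apply: nK.
have : \forall k \near \oo, near0 mu T A (rho K) (h - s k).
  exact: (asymp_invariant_near0 HT mA (fun i => inv _ (mA i)) (rho0 K)).
move=> [M _ HM]; have h1 := HM _ (leq_maxl M K); have h2 := s_near _ _ (leq_maxr M K).
have := near0D HT mA h1 h2; rewrite addrA subrK; apply: near0_le.
by rewrite mulr_natl mulr2n.
Qed.

End NotClosed.

Theorem proposition4p11 (R : realType) (d : measure_display)
    (X : measurableType d) (mu : probability X R)
    (G : countZmodType) (T : G -> X -> X)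
    (HX : lebesgue_space mu) (HT : mp_action mu T)
    (Hfree : free_action mu T) (Herg : ergodic_action mu T) :
  [<-> rigid_action mu T;
       exists x : nat -> L2 (counting_prod mu G) -> L2 (counting_prod mu G),
         [/\ central_sequence mu T x, (forall n, S_T mu G (x n))
           & ~ trivial_sequence mu x];
       ~ closed_in_aut (R_T mu T) (inner_aut (R_T mu T) (S_T mu G))].
Proof.
have [HX' _] := HX.
(* In the cycle, (ii) reaches (iii) through (i): without rigidity the gap makes every central
   sequence in [S_T] trivial. *)
have central_rigid : (exists x : nat -> L2 (counting_prod mu G) -> L2 (counting_prod mu G),
    [/\ central_sequence mu T x, (forall n, S_T mu G (x n)) & ~ trivial_sequence mu x]) ->
    rigid_action mu T.
  move=> [x [xc Sx xnt]]; apply: contrapT => nrig; apply: xnt.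
  have [B [N [e [mB e0 gap]]]] := nonrigid_gap HT HX' Hfree nrig.
  exact: (trivial_of_gap HT mB e0 gap xc Sx).
tfae.
- exact: (rigid_central_sequence HT).
- move=> /central_rigid rig.
  have [A [mA sepA genA]] := standard_countably_generated HX'.
  exact: (rigid_not_closed HT mA sepA genA Hfree rig).
- move=> ncl; apply: contrapT => nrig; apply: ncl.
  have [B [N [e [mB e0 gap]]]] := nonrigid_gap HT HX' Hfree nrig.
  exact: (gap_closed HT mB e0 gap).
Qed.
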